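(* Consider the asymmetric simple exclusion process (ASEP) on $\mathbb{Z}$ with right-jump probability $p$ and left-jump probability $q=1-p$, started from the step initial condition $x_m(0)=m$ for all $m\in\mathbb{Z}^+=\{1,2,3,\dots\}$, where $x_m(t)$ denotes the position at time $t$ of the $m$th particle from the left. Assume $0<p<q$ and put $\gamma=q-p$, $\tau=p/q$. Let $m\in\mathbb{Z}^+$ and $x\in\mathbb{Z}$ be fixed with $x<m$. Then, as $t\to\infty$, $$\mathbb{P}\left(x_m(t/\gamma)>x\right)\sim \prod_{k=1}^\infty (1-\tau^k)\;\frac{t^{2m-x-2}\,e^{-t}}{(m-1)!\,(m-x-1)!},$$ i.e. the ratio of the two sides tends to $1$.
   Context: ASEP on $\mathbb{Z}$: each site holds at most one particle. Each particle, independently, waits an exponential time of mean one, then with probability $p$ attempts to move one step to the right and with probability $q=1-p$ attempts to move one step to the left; the move takes place if the target site is unoccupied, otherwise the particle stays put; then the procedure repeats. Step initial condition: at time $0$ the occupied sites are exactly the positive integers. *)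

(* Defs.v *)
From HB Require Import structures.
From mathcomp Require Import all_boot all_order all_algebra.
From mathcomp Require Import all_classical all_reals all_analysis.

Set Implicit Arguments.
Unset Strict Implicit.
Unset Printing Implicit Defensive.

Import Order.TTheory GRing.Theory Num.Theory.
Import numFieldNormedType.Exports.
Local Open Scope classical_set_scope.
Local Open Scope ring_scope.

(* Mutual independence of the set systems [F i], for [i] ranging over [J]. *)
Definition mutually_independent (R : realType) (d : measure_display)
    (Omega : measurableType d) (P : probability Omega R)
    (I : eqType) (J : set I) (F : I -> set_system Omega) : Prop :=
  forall (s : seq I) (A : I -> set Omega), uniq s ->
    (forall i, i \in s -> J i /\ F i (A i)) ->
    P (\bigcap_(i in [set` s]) A i) = (\prod_(i <- s) P (A i))%E.

Definition generated (d d' : measure_display) (Omega : measurableType d)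
    (E : measurableType d') (Y : Omega -> E) : set_system Omega :=
  preimage_set_system setT Y measurable.

(* Particles are labelled 1, 2, 3, ...; label 0 is never used.
   [W m k] is the waiting time of particle [m] before its attempt number [k]
   (attempts are numbered from 0), and [D m k] is the direction of that attempt:
   [true] for right, [false] for left.  All of them, for all particles and all
   attempts, are jointly independent. *)
Definition asep_clocks (R : realType) (d : measure_display)
    (Omega : measurableType d) (P : probability Omega R) (p : R)
    (W : nat -> nat -> {RV P >-> R}) (D : nat -> nat -> {RV P >-> bool}) :
    Prop :=
  [/\ forall m k, (0 < m)%N -> forall B : set R, measurable B ->
        distribution P (W m k) B = exponential_prob 1 B,
      forall m k, (0 < m)%N -> forall B : set bool, measurable B ->
        distribution P (D m k) B = bernoulli_prob p B
    & mutually_independent P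
        [set i : (nat * nat) + (nat * nat) |
          match i with inl mk | inr mk => (0 < mk.1)%N end]
        (fun i => match i with
                  | inl mk => generated (W mk.1 mk.2)
                  | inr mk => generated (D mk.1 mk.2)
                  end)].

Definition ring_time (R : realType) (w : nat -> R) (k : nat) : R :=
  \sum_(j < k.+1) w j.

Definition occupied (R : realType) (x : nat -> R -> int) (t : R) : set int :=
  [set x m t | m in [set m | (0 < m)%N]].

Definition attempt (A : set int) (y : int) (right : bool) : int :=
  let target := if right then y + 1 else y - 1 in
  if target \in A then y else target.

(* A trajectory of the particle system, driven by the waiting times [w] and the
   directions [b].  Only nonnegative times are meaningful.  Monotonicity in the
   label says both that a site holds at most one particle and that [x m] is the
   m-th particle from the left.  In the last clause the attempt made at a ring
   time is resolved in the configuration just before that time. *)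
Record asep_step_trajectory (R : realType) (w : nat -> nat -> R)
    (b : nat -> nat -> bool) (x : nat -> R -> int) : Prop := {
  asep_step_initial : forall m, (0 < m)%N -> x m 0 = m%:Z;
  asep_ordered : forall m t, (0 < m)%N -> 0 <= t -> x m t < x m.+1 t;
  asep_rest : forall m s t, (0 < m)%N -> 0 <= s -> s <= t ->
    (forall k, ~~ (s < ring_time (w m) k <= t)) -> x m t = x m s;
  asep_jump : forall m k, (0 < m)%N ->
    \forall u \near (ring_time (w m) k)^'-,
      x m (ring_time (w m) k) = attempt (occupied x u) (x m u) (b m k) }.

(* [X m t omega] is the position at time [t] of the m-th particle from the left
   in ASEP with right-jump probability [p], started from the step initial
   condition. *)
Definition asep_step (R : realType) (d : measure_display)
    (Omega : measurableType d) (P : probability Omega R) (p : R)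
    (X : nat -> R -> Omega -> int) : Prop :=
  (forall m t y, (0 < m)%N -> 0 <= t ->
     measurable [set omega | X m t omega = y]) /\
  exists (W : nat -> nat -> {RV P >-> R}) (D : nat -> nat -> {RV P >-> bool}),
    asep_clocks p W D /\
    {ae P, forall omega, asep_step_trajectory
       (fun m k => W m k omega) (fun m k => D m k omega)
       (fun m t => X m t omega)}.

(* The product of the factors 1 - tau^k over all k >= 1. *)
Definition euler_product (R : realType) (tau : R) : R :=
  limn (fun n => \prod_(1 <= k < n.+1) (1 - tau ^+ k)).

(* Main.v *)
Require Import Defs.
From HB Require Import structures.
From mathcomp Require Import all_boot all_order all_algebra.
From mathcomp Require Import all_classical all_reals all_analysis.
From mathcomp Require Import measurable_realfun.
From mathcomp Require Import zify ring lra.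

Set Implicit Arguments.
Unset Strict Implicit.
Unset Printing Implicit Defensive.

Import Order.TTheory GRing.Theory Num.Theory.
Import numFieldNormedType.Exports.
Local Open Scope classical_set_scope.
Local Open Scope ring_scope.

(** Record a configuration by the partition [l] of displacements to the left:
    particle [i+1] sits at [i + 1 - l_i].  The number of particles able to jump
    left minus the number able to jump right is always one, so
    [v_s(l) = exp (gamma s) P(configuration at time s = l)] solves the backward
    equation of the chain in which [p] and [q] are exchanged, with [v_0] the
    indicator of the empty partition.  That chain is reversible for
    [tau ^ |l|], whose total mass is the inverse of the Euler product [E];
    decay of the Dirichlet form gives [v_s(l) -> E] for fixed [l], and a
    Lyapunov function built from [tau ^ - height] makes the convergence uniform
    for [l] within [(1 - eps) gamma s] in both directions, while [v] is
    negligible beyond [(1 + eps) gamma s].  Finally [x_m(s) > x] means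
    [l_n <= k] with [n = m - 1] and [k = m - x - 1], and the number of such
    partitions in an [L x L] box is asymptotic to [L ^ (n + k) / (n! k!)].

    To reach the equation for [v], condition on the event that particle [M+1]
    has not rung by time [s].  Particles [1..M] are then driven by a finite word
    of rings, whose probability is explicit.  These events are independent for
    different [M], so averaging over [M] removes the conditioning. *)

(** * Partitions and exclusion moves *)

(** Infinitely many clocks ring in every time interval, so there is no first jump from which to read
    off a generator. A frozen particle acts as a wall: to its left only finitely many clocks matter.
    That particle [M+1] is frozen is not independent of the configuration, so this event cannot
    simply be divided out; but a second-moment bound shows that the averages over [M] of P(A and
    particle [M+1] frozen) tend to exp(-s) P(A) for every event A.

    The forward equation and the backward equation with exchanged rates have the same off-diagonal
    terms, and their diagonals differ by gamma times the excess of left moves over right moves. This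
    excess being one, the factor exp(gamma s) turns one equation into the other.

    Pointwise convergence of v is too weak, because about s ^ (n + k) partitions contribute: it must
    hold up to the front at distance gamma s. With spatial weights (1 + a) ^ distance the Lyapunov
    function decays at rate about gamma a, so for small a the decay beats its size exactly inside
    the front. *)

Record part := Part { pval :> nat -> nat;
  pval_anti : forall i, (pval i.+1 <= pval i)%N;
  pval_fin : exists n, pval n == 0%N }.

HB.instance Definition _ := gen_eqMixin part.
HB.instance Definition _ := gen_choiceMixin part.

Lemma part_inj (l l' : part) : (forall i, l i = l' i) -> l = l'.
Proof.
case: l l' => [f af ef] [g ag eg] /= /funext fg.
by case: g / fg ag eg => ag eg; congr Part; exact: Prop_irrelevance.
Qed.

Lemma part_le (l : part) i j : (i <= j)%N -> (l j <= l i)%N.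
Proof.
by elim: j => [|j ih]; [case: i | rewrite leq_eqVlt => /predU1P[->//|/ih];
  apply: leq_trans; exact: pval_anti].
Qed.

Definition len (l : part) : nat := ex_minn (pval_fin l).

Lemma len_le (l : part) n : (len l <= n)%N = (l n == 0%N).
Proof.
rewrite /len; case: ex_minnP => m /eqP m0 mmin.
apply/idP/idP => [mn|/mmin//].
by have := part_le l mn; rewrite m0 leqn0.
Qed.

(* Whether particle [i+1] can jump left, respectively right. *)
Definition canL (l : part) i := (i == 0%N) || (l i < l i.-1)%N.
Definition canR (l : part) i := (l i.+1 < l i)%N.

Lemma addp_anti (l : part) i j :
  (l j.+1 + ((j.+1 == i) && canL l i) <= l j + ((j == i) && canL l i))%N.
Proof.
have h := pval_anti l j; rewrite /canL.
by case: (eqVneq j.+1 i) => [<-|_] /=; lia.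
Qed.

Lemma addp_fin (l : part) i : exists n, (l n + ((n == i) && canL l i))%N == 0%N.
Proof.
exists (maxn (len l) i.+1).
have : (len l <= maxn (len l) i.+1)%N by lia.
by rewrite len_le => /eqP ->; lia.
Qed.

(** A blocked move is the identity rather than undefined, so a blocked attempt needs no separate
    treatment in the generator or in the dynamics of words. *)
Definition addp l i := Part (@addp_anti l i) (addp_fin l i).

Lemma remp_anti (l : part) i j :
  (l j.+1 - ((j.+1 == i) && canR l i) <= l j - ((j == i) && canR l i))%N.
Proof.
have h := pval_anti l j; rewrite /canR.
by case: (eqVneq j i) => [<-|_] /=; lia.
Qed.

Lemma remp_fin (l : part) i : exists n, (l n - ((n == i) && canR l i))%N == 0%N.
Proof. by exists (len l); move: (leqnn (len l)); rewrite len_le; lia. Qed.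

Definition remp l i := Part (@remp_anti l i) (remp_fin l i).

Lemma addpE (l : part) i j : addp l i j = (l j + ((j == i) && canL l i))%N.
Proof. by []. Qed.

Lemma rempE (l : part) i j : remp l i j = (l j - ((j == i) && canR l i))%N.
Proof. by []. Qed.

Lemma addp_id (l : part) i : ~~ canL l i -> addp l i = l.
Proof. by move=> /negPf h; apply: part_inj => j; rewrite addpE h andbF addn0. Qed.

Lemma remp_id (l : part) i : ~~ canR l i -> remp l i = l.
Proof. by move=> /negPf h; apply: part_inj => j; rewrite rempE h andbF subn0. Qed.

Lemma canR_addp (l : part) i : canL l i -> canR (addp l i) i.
Proof.
move=> h; rewrite /canR !addpE h eqxx !andbT.
by have := pval_anti l i; lia.
Qed.

Lemma canL_remp (l : part) i : canR l i -> canL (remp l i) i.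
Proof.
move=> h; rewrite /canL; case: (eqVneq i 0%N) => //= i0; rewrite h eqxx !andbT.
by have := pval_anti l i.-1; rewrite prednK ?lt0n//; move: h; rewrite /canR; lia.
Qed.

Lemma addpK (l : part) i : canL l i -> remp (addp l i) i = l.
Proof.
move=> h; apply: part_inj => j; rewrite rempE addpE h canR_addp// !andbT.
by rewrite addnK.
Qed.

Lemma rempK (l : part) i : canR l i -> addp (remp l i) i = l.
Proof.
move=> h; apply: part_inj => j; rewrite addpE rempE h canL_remp// !andbT.
rewrite subnK//; case: eqP => // ->; move: h; rewrite /canR; lia.
Qed.

Lemma canL_len (l : part) i : (len l < i)%N -> ~~ canL l i.
Proof.
case: i => // i; rewrite ltnS len_le /canL /= => /eqP ->.
by rewrite ltn0.
Qed.

Lemma canR_len (l : part) i : (len l <= i)%N -> ~~ canR l i.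
Proof. by rewrite len_le /canR => /eqP ->; rewrite ltn0. Qed.

Lemma canL_at_len (l : part) : canL l (len l).
Proof.
rewrite /canL; case E : (len l) => [//|n] /=.
have /eqP -> : l n.+1 == 0%N by rewrite -len_le E.
by rewrite lt0n -len_le E ltnn.
Qed.

Lemma len_addp_le (l : part) i n : (len l <= n)%N -> (len (addp l i) <= n.+1)%N.
Proof.
move=> ln; rewrite len_le addpE.
have : (len l <= n.+1)%N by lia.
rewrite len_le => /eqP ->; case: (eqVneq n.+1 i) => [<-|]//=.
by rewrite (negPf (canL_len _)).
Qed.

Lemma len_remp_le (l : part) i n : (len l <= n)%N -> (len (remp l i) <= n)%N.
Proof. by rewrite !len_le rempE => /eqP ->. Qed.

Definition empty_part : part :=
  @Part (fun=> 0%N) (fun=> leqnn _) (ex_intro _ 0%N (eqxx _)).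

Lemma len_empty : len empty_part = 0%N.
Proof. by apply/eqP; rewrite -leqn0 len_le. Qed.

Lemma len0_empty l : len l = 0%N -> l = empty_part.
Proof.
move=> h; apply: part_inj => i /=.
by apply/eqP; rewrite -len_le h.
Qed.

(** * The generator adding boxes at rate [p] and removing them at rate [q] *)

Section generator.
Context {R : realType}.
Implicit Types (f g : part -> R) (l : part) (p q : R).

Definition gent p q f l i : R :=
  p * (f (addp l i) - f l) + q * (f (remp l i) - f l).

(* Rows beyond [len l] cannot move. *)
Definition gen p q f l : R := \sum_(i < (len l).+1) gent p q f l i.

Lemma gent_out p q f l i : (len l < i)%N -> gent p q f l i = 0.
Proof.
move=> h; rewrite /gent addp_id ?canL_len// remp_id ?canR_len//; last by lia.
by rewrite subrr !mulr0 addr0.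
Qed.

Lemma sum_wide (F : nat -> R) m n : (m <= n)%N ->
  (forall i, (m <= i)%N -> F i = 0) -> \sum_(i < n) F i = \sum_(i < m) F i.
Proof.
move=> mn F0; rewrite -!(big_mkord xpredT F) (big_cat_nat (n := m))//=.
by rewrite [X in _ + X]big_nat [X in _ + X]big1 ?addr0// => i /andP[? _]; rewrite F0.
Qed.

Lemma gen_wide p q f l n : (len l < n)%N -> gen p q f l = \sum_(i < n) gent p q f l i.
Proof.
move=> h; rewrite /gen [RHS](@sum_wide (gent p q f l) (len l).+1)// => i hi.
by rewrite gent_out.
Qed.

(** [canR l i] and [canL l i.+1] are the same inequality, so the sum telescopes to [canL l 0], and
    row 0 can always grow. *)
Lemma sum_canL_canR l n : (len l < n)%N ->
  \sum_(i < n) ((canL l i)%:R - (canR l i)%:R) = 1 :> R.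
Proof.
have key m : (0 < m)%N ->
  \sum_(i < m) ((canL l i)%:R - (canR l i)%:R) = 1 - (canR l m.-1)%:R :> R.
  elim: m => // -[|m] ih _; first by rewrite big_ord1 /canL eqxx.
  rewrite big_ord_recr/= ih// /canL /canR /=.
  by rewrite addrA subrK.
move=> h; rewrite key; last by lia.
by rewrite (negPf (canR_len _)) ?subr0//; lia.
Qed.

Lemma gentB p q f g l i :
  gent p q (fun x => f x - g x) l i = gent p q f l i - gent p q g l i.
Proof. by rewrite /gent; ring. Qed.

Lemma genB p q f g l : gen p q (fun x => f x - g x) l = gen p q f l - gen p q g l.
Proof. by rewrite /gen -sumrB; apply: eq_bigr => i _; rewrite gentB. Qed.

Lemma genD p q f g l : gen p q (fun x => f x + g x) l = gen p q f l + gen p q g l.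
Proof. by rewrite /gen -big_split; apply: eq_bigr => i _; rewrite /gent/=; ring. Qed.

Lemma genZ p q c f l : gen p q (fun x => c * f x) l = c * gen p q f l.
Proof. by rewrite /gen mulr_sumr; apply: eq_bigr => i _; rewrite /gent/=; ring. Qed.

Lemma gen_cst p q (c : R) l : gen p q (fun=> c) l = 0.
Proof. by rewrite /gen big1// => i _; rewrite /gent subrr !mulr0 addr0. Qed.

Lemma gen_le0_max p q f l : 0 <= p -> 0 <= q -> (forall l', f l' <= f l) ->
  gen p q f l <= 0.
Proof.
move=> p0 q0 h; apply: sumr_le0 => i _; rewrite /gent.
have h1 := h (addp l i); have h2 := h (remp l i).
by rewrite -oppr_ge0 opprD; apply: addr_ge0; rewrite -mulrN mulr_ge0// opprB subr_ge0.
Qed.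

Lemma gen_head p q (F : nat -> R) l : gen p q (fun l' => F (l' 0%N)) l =
  p * (F (l 0%N).+1 - F (l 0%N)) + q * (F (l 0 - canR l 0)%N - F (l 0%N)).
Proof.
rewrite /gen big_ord_recl [X in _ + X]big1 ?addr0; last first.
  by move=> i _; rewrite /gent !addpE !rempE /= addn0 subn0 !subrr !mulr0 addr0.
by rewrite /gent addpE rempE /= addn1.
Qed.

Lemma len_addp_at l : len (addp l (len l)) = (len l).+1.
Proof.
apply/eqP; rewrite eqn_leq len_addp_le// andTb ltnNge len_le addpE eqxx canL_at_len.
by rewrite addn1.
Qed.

Lemma len_addp_lt l i : (i < len l)%N -> len (addp l i) = len l.
Proof.
move=> il; apply/eqP; rewrite eqn_leq; apply/andP; split.
  have /eqP h0 : l (len l) == 0%N by rewrite -len_le.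
  by rewrite len_le addpE h0; case: (eqVneq (len l) i) => [E|//]; lia.
case E : (len l) il => [//|n] il; rewrite ltnNge len_le addpE addn_eq0.
by rewrite -len_le E ltnn.
Qed.

Lemma len_remp_lt l i : (i.+1 < len l)%N -> len (remp l i) = len l.
Proof.
move=> il; apply/eqP; rewrite eqn_leq len_remp_le//=.
case E : (len l) il => [//|n] il; rewrite ltnNge len_le rempE.
case: (eqVneq n i) => [|_]; first by lia.
by rewrite subn0 -len_le E ltnn.
Qed.

Lemma len_remp_at l n : len l = n.+1 ->
  len (remp l n) = (if l n == 1%N then n else n.+1).
Proof.
move=> E.
have /eqP h0 : l n.+1 == 0%N by rewrite -len_le E.
have h1 : l n != 0%N by rewrite -len_le E ltnn.
have hR : canR l n by rewrite /canR h0 lt0n.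
case: eqP => h.
  apply/eqP; rewrite eqn_leq len_le rempE eqxx hR h /=.
  case: n E h0 h1 hR h => [//|n] E h0 h1 hR h.
  rewrite ltnNge len_le rempE; case: (eqVneq n n.+1) => [|_]; first by lia.
  by rewrite subn0 -len_le E; lia.
apply/eqP; rewrite eqn_leq len_remp_le ?E// ltnNge len_le rempE eqxx hR /=; lia.
Qed.

(** The length grows only through the first empty row, which is always free to grow, and shrinks
    only when the last row is a single box. *)
Lemma gen_len p q (F : nat -> R) l : gen p q (fun l' => F (len l')) l =
  p * (F (len l).+1 - F (len l)) +
  (if (len l == 0)%N || (l (len l).-1 != 1%N) then 0 else q * (F (len l).-1 - F (len l))).
Proof.
rewrite /gen big_ord_recr /= {2}/gent len_addp_at remp_id ?canR_len// subrr mulr0 addr0.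
case E : (len l) => [|n] /=; first by rewrite big_ord0 add0r addr0.
rewrite big_ord_recr [X in X + _ + _]big1 ?add0r; last first.
  move=> i _; have hi : (i.+1 < len l)%N by rewrite E ltnS ltn_ord.
  rewrite /gent /= (len_addp_lt (ltnW hi)) (len_remp_lt hi).
  by rewrite subrr !mulr0 addr0.
rewrite /gent /= len_addp_lt ?E// subrr mulr0 add0r addrC (len_remp_at E).
by case: eqP => //=; rewrite subrr mulr0.
Qed.

End generator.

(** * Boxes of partitions and the Euler product *)

Lemma consp_anti c (l : part) i :
  ((if i.+1 is j.+1 then minn (l j) c else c) <= (if i is j.+1 then minn (l j) c else c))%N.
Proof. by case: i => [|i]; rewrite ?geq_minr// leq_min geq_minr geq_min pval_anti. Qed.

Lemma consp_fin c (l : part) : exists n, (if n is j.+1 then minn (l j) c else c) == 0%N.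
Proof. by exists (len l).+1; move: (leqnn (len l)); rewrite len_le; lia. Qed.

(** The truncation by [minn] makes this total; it is applied where [l 0 <= c], and there it just
    prepends a row of length [c]. *)
Definition consp c l := Part (consp_anti c l) (consp_fin c l).

Lemma tailp_fin (l : part) : exists n, l n.+1 == 0%N.
Proof. by exists (len l); rewrite -len_le leqnSn. Qed.

Definition tailp (l : part) := @Part (fun i => l i.+1) (fun i => pval_anti l i.+1) (tailp_fin l).

Lemma consp0 c l : consp c l 0%N = c. Proof. by []. Qed.

Lemma tailpK (l : part) : consp (l 0%N) (tailp l) = l.
Proof.
by apply: part_inj => -[|i] //=; apply/minn_idPl; apply: part_le.
Qed.

Lemma conspK c (l : part) : (l 0%N <= c)%N -> tailp (consp c l) = l.
Proof.
move=> lc; apply: part_inj => i /=; apply/minn_idPl.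
by apply: leq_trans lc; exact: part_le.
Qed.

Fixpoint box a b : seq part :=
  if a is a'.+1 then flatten [seq [seq consp c l | l <- box a' c] | c <- iota 0 b.+1]
  else [:: empty_part].

Lemma mem_box a b (l : part) : (l \in box a b) = (len l <= a)%N && (l 0%N <= b)%N.
Proof.
elim: a b l => [|a ih] b l.
  rewrite inE leqn0; apply/eqP/andP => [->|[/eqP h _]]; last exact: len0_empty.
  by rewrite len_empty.
apply/flatten_mapP/andP => [[c]|[la lb]].
  rewrite mem_iota add0n => /= cb /mapP[m]; rewrite ih => /andP[ma mc] ->.
  split; last by rewrite consp0.
  by rewrite len_le /=; move: ma; rewrite len_le => /eqP ->; rewrite min0n.
exists (l 0%N); first by rewrite mem_iota add0n.
apply/mapP; exists (tailp l); last by rewrite tailpK.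
rewrite ih /= pval_anti andbT len_le /=.
by move: la; rewrite len_le.
Qed.

Lemma boxS a b : box a.+1 b =
  flatten [seq [seq consp c l | l <- box a c] | c <- iota 0 b.+1].
Proof. by []. Qed.

Lemma box_uniq a b : uniq (box a b).
Proof.
elim: a b => // a ih b; rewrite boxS.
elim: b.+1 0%N => // n ihn m.
have -> : iota m n.+1 = m :: iota m.+1 n by [].
rewrite map_cons -cat1s flatten_cat cat_uniq ihn andbT [flatten [:: _]]cats0; apply/andP; split.
  rewrite map_inj_in_uniq// => x y; rewrite !mem_box => /andP[_ hx] /andP[_ hy] /(congr1 tailp).
  by rewrite !conspK.
apply/hasPn => x /flatten_mapP[c]; rewrite mem_iota => /andP[mc _] /mapP[y _ ->].
by apply/negP => /mapP[z _ /(congr1 (fun l : part => l 0%N))]; rewrite !consp0; lia.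
Qed.

(** Pascal's rule at the level of lists: the first row is at most [b], or it equals [b.+1]. *)
Lemma boxSS a b : box a.+1 b.+1 = box a.+1 b ++ [seq consp b.+1 l | l <- box a b.+1].
Proof.
rewrite !boxS; have -> : iota 0 b.+2 = iota 0 b.+1 ++ [:: b.+1].
  by rewrite -(addn1 b.+1) iotaD add0n.
by rewrite map_cat flatten_cat [flatten [seq _ | _ <- [:: _]]]cats0.
Qed.

Definition psize (l : part) : nat := (\sum_(i < len l) l i)%N.

Lemma psize_wide (l : part) n : (len l <= n)%N -> psize l = (\sum_(i < n) l i)%N.
Proof.
elim: n => [|n ih]; first by rewrite leqn0 /psize => /eqP ->.
rewrite leq_eqVlt => /predU1P[<-//|]; rewrite ltnS => h; rewrite big_ord_recr /= -ih//.
by move: h; rewrite len_le => /eqP ->; rewrite addn0.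
Qed.

Lemma psize_consp c (l : part) : (l 0%N <= c)%N -> psize (consp c l) = (c + psize l)%N.
Proof.
move=> lc; rewrite (@psize_wide _ (len l).+1); last first.
  by move: (leqnn (len l)); rewrite !len_le /= => /eqP ->; rewrite min0n.
rewrite big_ord_recl; congr (_ + _)%N; apply: eq_bigr => i _ /=.
by apply/minn_idPl; apply: leq_trans lc; exact: part_le.
Qed.

Lemma psize_addp l i : canL l i -> psize (addp l i) = (psize l).+1.
Proof.
move=> h; have il : (i < (len l).+1)%N.
  by rewrite ltnNge; apply: contraL h; exact: canL_len.
rewrite (@psize_wide (addp l i) (len l).+1) ?len_addp_le// (@psize_wide l (len l).+1)//.
under eq_bigr do rewrite addpE h andbT.
rewrite big_split/= -[RHS]addn1; congr addn.
by rewrite (bigD1 (Ordinal il))//= eqxx big1// => j /negPf; rewrite -val_eqE /= => ->.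
Qed.

Lemma psize_empty : psize empty_part = 0%N.
Proof. by rewrite /psize big1. Qed.

(** * Gaussian binomial coefficients *)

Section gauss.
Context {R : realType} (tau : R).
Hypotheses (tau0 : 0 < tau) (tau1 : tau < 1).

Definition eprod n : R := \prod_(1 <= k < n.+1) (1 - tau ^+ k).
Definition Zbox a b : R := \sum_(l <- box a b) tau ^+ psize l.

Lemma eprodS n : eprod n.+1 = eprod n * (1 - tau ^+ n.+1).
Proof. by rewrite /eprod big_nat_recr. Qed.

Lemma eprod_gt0 n : 0 < eprod n.
Proof.
elim: n => [|n ih]; first by rewrite /eprod big_nil.
rewrite eprodS mulr_gt0// subr_gt0.
by apply: exprn_ilt1 => //; exact: ltW.
Qed.

Lemma Zbox_recS a b : Zbox a.+1 b.+1 = Zbox a.+1 b + tau ^+ b.+1 * Zbox a b.+1.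
Proof.
rewrite /Zbox boxSS big_cat/=; congr (_ + _); rewrite big_map mulr_sumr.
rewrite big_seq [RHS]big_seq; apply: eq_bigr => l; rewrite mem_box => /andP[_ lb].
by rewrite psize_consp// exprD.
Qed.

Lemma box_a0 a : box a 0 = [:: empty_part].
Proof.
elim: a => //= a ->; rewrite cats0 /=; congr [:: _].
by apply: part_inj => -[|i]//=.
Qed.

Lemma Zbox_gauss a b : Zbox a b * eprod a * eprod b = eprod (a + b).
Proof.
have e0 : eprod 0 = 1 by rewrite /eprod big_nil.
elim: a b => [|a iha] b.
  by rewrite /Zbox /= big_seq1 psize_empty e0 expr0 !mul1r.
elim: b => [|b ihb].
  by rewrite /Zbox box_a0 big_seq1 psize_empty e0 expr0 mul1r mulr1 addn0.
have -> : (a.+1 + b.+1)%N = (a.+1 + b).+1 by lia.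
rewrite Zbox_recS (eprodS (a.+1 + b)) -{1}ihb.
have := iha b.+1; rewrite -addSnnS -{1}ihb !eprodS -addSn exprD => e.
rewrite !mulrDl -[X in _ + X]mulrA.
have -> : tau ^+ b.+1 * Zbox a b.+1 * (eprod a * (1 - tau ^+ a.+1) * (eprod b * (1 - tau ^+ b.+1))) =
  tau ^+ b.+1 * (1 - tau ^+ a.+1) * (Zbox a b.+1 * eprod a * (eprod b * (1 - tau ^+ b.+1))) by ring.
by rewrite e !exprS; ring.
Qed.

End gauss.
Section gauss_limit.
Context {R : realType} (tau : R).
Hypotheses (tau0 : 0 < tau) (tau1 : tau < 1).

Let e0 n := eprod_gt0 tau0 tau1 n.

Lemma eprod_nincr : nonincreasing_seq (eprod tau).
Proof.
apply/nonincreasing_seqP => n; rewrite eprodS ler_piMr ?(ltW (e0 _))//.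
by rewrite gerBl exprn_ge0// ltW.
Qed.

Lemma eprod_lower N j :
  eprod tau N * (1 - \sum_(i < j) tau ^+ (N + i).+1) <= eprod tau (N + j).
Proof.
elim: j => [|j ih]; first by rewrite big_ord0 addn0 subr0 mulr1.
rewrite addnS eprodS big_ord_recr/=.
have t0 : 0 <= tau ^+ (N + j).+1 by rewrite exprn_ge0// ltW.
have t1 : tau ^+ (N + j).+1 <= 1 by rewrite exprn_ile1// ltW.
apply: le_trans (_ : eprod tau N * (1 - \sum_(i < j) tau ^+ (N + i).+1) * (1 - tau ^+ (N + j).+1) <= _); last first.
  by rewrite ler_wpM2r// subr_ge0.
rewrite -mulrA ler_wpM2l ?(ltW (e0 _))//.
have s0 : 0 <= \sum_(i < j) tau ^+ (N + i).+1.
  by apply: sumr_ge0 => i _; rewrite exprn_ge0// ltW.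
by nra.
Qed.

Lemma eprod_ge : exists2 c : R, 0 < c & forall n, c <= eprod tau n.
Proof.
have nt : `|tau| < 1 by rewrite ger0_norm// ltW.
have : (fun n => tau ^+ n) @ \oo --> (0 : R) by exact: cvg_expr.
(* This bound on [tau ^+ N.+1] makes the geometric tail beyond [N] at most 1/2, so the later factors
   at worst halve the product. *)
move/cvgrPdist_lt => /(_ ((1 - tau) / 2)); rewrite divr_gt0 ?subr_gt0// => /(_ isT)[N _ hN].
have {hN} tN : tau ^+ N.+1 < (1 - tau) / 2.
  by have := hN N.+1 (leqnSn N); rewrite /= sub0r normrN ger0_norm// exprn_ge0// ltW.
have hs j : \sum_(i < j) tau ^+ (N + i).+1 <= 1 / 2.
  have -> : \sum_(i < j) tau ^+ (N + i).+1 = tau ^+ N.+1 * \sum_(i < j) tau ^+ i.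
    by rewrite mulr_sumr; apply: eq_bigr => i _; rewrite -exprD addSn.
  have h1 : (1 - tau) * \sum_(i < j) tau ^+ i = 1 - tau ^+ j.
    elim: j => [|j ih]; first by rewrite big_ord0 mulr0 expr0 subrr.
    by rewrite big_ord_recr/= mulrDr ih exprS; ring.
  have tj : 0 <= tau ^+ j by rewrite exprn_ge0// ltW.
  have S0 : 0 <= \sum_(i < j) tau ^+ i.
    by apply: sumr_ge0 => i _; rewrite exprn_ge0// ltW.
  by nra.
exists (eprod tau N / 2) => [|n]; first by rewrite divr_gt0// e0.
case: (leqP N n) => Nn.
  rewrite -(subnKC Nn); apply: le_trans (eprod_lower N (n - N)).
  by have := hs (n - N)%N; have := e0 N; nra.
have := eprod_nincr (ltnW Nn); have := e0 N; lra.
Qed.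

Lemma eprod_cvg : eprod tau @ \oo --> euler_product tau.
Proof.
have [c c0 hc] := eprod_ge.
apply: (@nonincreasing_is_cvgn _ (eprod tau)); first exact: eprod_nincr.
by exists c => _ [n _ <-].
Qed.

Lemma euler_gt0 : 0 < euler_product tau.
Proof.
have [c c0 hc] := eprod_ge.
apply: (lt_le_trans c0); apply: limr_ge; last by apply: nearW => n; exact: hc.
by apply/cvg_ex; exists (euler_product tau); exact: eprod_cvg.
Qed.

(** Square boxes exhaust all partitions, so the limit is the total mass of [tau ^ |l|]; in the
    Gaussian binomial it appears as E / (E * E). *)
Lemma Zbox_cvg : (fun K => Zbox tau K K) @ \oo --> (euler_product tau)^-1.
Proof.
have h : (fun K => eprod tau (K + K) / (eprod tau K * eprod tau K)) @ \oo -->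
    euler_product tau / (euler_product tau * euler_product tau).
  apply: cvgM.
    apply: (@cvg_comp _ _ _ (fun K => K + K)%N (eprod tau) _ \oo); last exact: eprod_cvg.
    by apply/cvgnyPge => A; exists A => // n /= An; lia.
  apply: cvgV; last by apply: cvgM; exact: eprod_cvg.
  by rewrite mulf_neq0// gt_eqF// euler_gt0.
have e1 := euler_gt0.
have -> : (euler_product tau)^-1 = euler_product tau / (euler_product tau * euler_product tau).
  by field; rewrite gt_eqF.
apply: cvg_trans h; apply: near_eq_cvg; near=> K => /=.
rewrite -Zbox_gauss//; field.
by rewrite gt_eqF// e0.
Unshelve. all: by end_near.
Qed.

(** The outer layer of a large square box has vanishing mass; this removes the boundary terms when
    summing by parts over boxes. *)
Lemma Zbox_diff_cvg : (fun K => Zbox tau K.+1 K.+1 - Zbox tau K K) @ \oo --> (0 : R).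
Proof.
rewrite -(subrr (euler_product tau)^-1); apply: cvgB Zbox_cvg.
by have := Zbox_cvg; rewrite -(cvg_shiftS (fun K => Zbox tau K K)).
Qed.

End gauss_limit.

(** * Comparison for the backward equation *)

Lemma is_derive_affine {R : realType} (e a b s : R) :
  is_derive s 1 (fun s => e * (a + b * s)) (e * b).
Proof.
apply/is_derive1_caratheodory; exists (cst (e * b)); split => //=.
  by move=> z; ring.
exact: cst_continuous.
Qed.

(** Only earlier times are compared, because the maximum may sit at the right end of the time
    interval. *)
Lemma left_max_derive_ge0 {R : realType} (f : R -> R) (s D : R) :
  0 < s -> is_derive s 1 f D -> (forall r : R, 0 <= r < s -> f r <= f s) -> 0 <= D.
Proof.
move=> s0 [dv <-] fmax; rewrite leNgt; apply/negP => D0.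
have /cvgrPdist_lt/(_ (- 'D_1 f s)) := dv; rewrite oppr_gt0 => /(_ D0).
move=> [e /= e0 he].
pose h := - (Num.min (e / 2) (s / 2)).
have h0 : h < 0 by rewrite /h oppr_lt0 lt_min !divr_gt0.
have hs : - h <= s / 2 by rewrite /h opprK ge_min lexx orbT.
have he2 : - h < e by rewrite /h opprK gt_min; apply/orP; left; lra.
have := he h; rewrite /ball /= sub0r normrN ltr0_norm// => /(_ he2 (ltr0_neq0 h0)).
rewrite /= -[in X in `|_ - X|]/('D_1 f s) [h%:A]mulr1.
have := fmax (h + s); have -> : 0 <= h + s < s by lra.
move=> /(_ isT) fh; set Q := h^-1 *: _.
have Q0 : 0 <= Q by rewrite /Q /= -[_ *: _]/(_ * _) nmulr_rge0 ?invr_lt0// subr_le0.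
rewrite -/('D_1 f s) ltr0_norm; lra.
Qed.

Lemma seq_argmax {R : realType} {T : eqType} (g : T -> R) (x0 : T) (s : seq T) :
  x0 \in s -> exists2 x, x \in s & forall y, y \in s -> g y <= g x.
Proof.
elim: s x0 => // a s ih x0 _; case: s ih => [_|b s ih].
  by exists a; rewrite ?mem_head// => y; rewrite inE => /eqP ->.
have [x xs hx] := ih b (mem_head _ _).
have [ax|xa] := leP (g a) (g x).
  by exists x; rewrite ?(inE _ (b :: s)) 1?in_cons ?xs ?orbT// => y; rewrite inE => /predU1P[->//|/hx].
exists a; rewrite ?mem_head// => y; rewrite inE => /predU1P[->//|/hx] yx.
by apply: le_trans yx (ltW xa).
Qed.

Section maximum_principle.
Context {R : realType} (p q : R).
Hypotheses (p0 : 0 <= p) (q0 : 0 <= q).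

Definition width (l : part) : nat := l 0%N + len l.

Lemma gen_width l : gen p q (fun l => (width l)%:R) l <= 2 * p.
Proof.
have -> : (fun l => (width l)%:R : R) = (fun l => (fun n => n%:R) (l 0%N) + (fun n => n%:R) (len l)).
  by apply/funext => l'; rewrite /width natrD.
rewrite genD (gen_head p q (fun n => n%:R)) (gen_len p q (fun n => n%:R)).
have h1 n : n.+1%:R - n%:R = 1 :> R by rewrite -natr1 addrC addKr.
have h2 : q * ((l 0 - canR l 0)%:R - (l 0)%:R) <= 0.
  by rewrite mulr_ge0_le0// subr_le0 ler_nat leq_subr.
have h3 : (if (len l == 0)%N || (l (len l).-1 != 1%N) then 0
    else q * ((len l).-1%:R - (len l)%:R)) <= 0.
  by case: ifP => // _; rewrite mulr_ge0_le0// subr_le0 ler_nat leq_pred.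
rewrite !h1 mulr1; apply: le_trans (lerD (lerD (lexx p) h2) (lerD (lexx p) h3)) _; lra.
Qed.

(** Among infinitely many states a supremum need not be attained. Subtracting a small multiple of
    [width] plus a linear function of time confines the maximum to a finite box, and [gen_width]
    keeps the effect of the penalty under control. *)
Lemma max_principle (w dw : R -> part -> R) (T C : R) :
  (forall l, {within `[0, T], continuous (w^~ l)}) ->
  (forall (s : R) l, 0 < s <= T -> is_derive s 1 (w^~ l) (dw s l)) ->
  (forall (s : R) l, 0 < s <= T -> dw s l <= gen p q (w s) l) ->
  (forall (s : R) l, 0 <= s <= T -> w s l <= C) ->
  (forall l, w 0 l <= 0) ->
  forall (s : R) l, 0 <= s <= T -> w s l <= 0.
Proof.
move=> cw iw dle wC w0 s1 l1 s1T; rewrite leNgt; apply/negP => w1.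
have T0 : 0 <= T by case/andP: s1T => /le_trans h /h.
have p21 : 0 <= 2 * p + 1 by move: p0; lra.
pose c1 := (width l1)%:R + 1 + (2 * p + 1) * s1.
have c1_gt0 : 0 < c1.
  by rewrite /c1 ltr_wpDr// mulr_ge0//; case/andP: s1T.
(* [c1] is the penalty at the offending point, so with this [e] half of the positive value survives
   there. *)
pose e := w s1 l1 / c1 / 2.
have e0 : 0 < e by rewrite !divr_gt0.
pose we s l := w s l - e * ((width l)%:R + 1 + (2 * p + 1) * s).
have we1 : 0 < we s1 l1.
  suff -> : we s1 l1 = w s1 l1 / 2 by rewrite divr_gt0.
  by rewrite /we -/c1 /e; field; rewrite gt_eqF.
(* Outside [box K K] the width exceeds [C / e], so the penalty exceeds the bound [C] on [w]. *)
have [K hK] : exists K : nat, C / e <= K%:R.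
  by exists (Num.truncn (C / e)).+1; rewrite ltW// truncnS_gt.
have out (s : R) l : 0 <= s <= T -> l \notin box K K -> we s l < 0.
  move=> sT; rewrite mem_box negb_and -!ltnNge => h.
  have Kw : (K.+1 <= width l)%N by case/orP: h => h; [exact: leq_trans h (leq_addl _ _)|exact: leq_trans h (leq_addr _ _)].
  have : C < e * (width l)%:R.
    rewrite mulrC -ltr_pdivrMr//; apply: le_lt_trans hK _; by rewrite ltr_nat.
  have := wC s l sT; rewrite /we.
  have : 0 <= e * ((2 * p + 1) * s) by exact: mulr_ge0 (ltW e0) (mulr_ge0 p21 (andP sT).1).
  move: (e * (width l)%:R) (e * ((2 * p + 1) * s)) (mulrDr e ((width l)%:R + 1) ((2 * p + 1) * s)) (mulrDr e (width l)%:R 1) => a b -> ->.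
  by rewrite mulr1; move: e0; lra.
have in1 : l1 \in box K K.
  by apply/negPn/negP => /(out s1 l1 s1T); rewrite ltNge (ltW we1).
have cwe l : {within `[0, T], continuous (we^~ l)}.
  have -> : we^~ l = (w^~ l) - (fun s => e * ((width l)%:R + 1 + (2 * p + 1) * s)).
    by apply/funext.
  apply: within_continuousB; first exact: cw.
  apply: derivable_within_continuous => x _.
  by have [] := is_derive_affine e ((width l)%:R + 1) (2 * p + 1) x.
have /choice[c hc] l : exists c, 0 <= c <= T /\ forall s, 0 <= s <= T -> we s l <= we c l.
  have [c + hc] := EVT_max T0 (cwe l); rewrite in_itv /= => cT.
  by exists c; split => // s sT; apply: hc; rewrite in_itv.
have [l0 l0in hl0] := seq_argmax (fun l => we (c l) l) in1.
have [s0T hs0] := hc l0; set s0 := c l0 in s0T hs0.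
have we0 : 0 < we s0 l0.
  by apply: lt_le_trans we1 _; apply: le_trans (hl0 _ in1); exact: (hc l1).2.
have glob (s : R) l : 0 <= s <= T -> we s l <= we s0 l0.
  move=> sT; case: (boolP (l \in box K K)) => [lin|/(out _ _ sT)/ltW h].
    by apply: le_trans ((hc l).2 _ sT) _; exact: hl0.
  exact: le_trans h (ltW we0).
have s0_gt0 : 0 < s0.
  rewrite lt_neqAle (andP s0T).1 andbT; apply/eqP => s00; move: we0; rewrite /we -s00.
  apply/negP; rewrite -leNgt mulr0 addr0 subr_le0; apply: le_trans (w0 l0) _.
  by rewrite mulr_ge0 ?(ltW e0)// addr_ge0.
have s0T' : 0 < s0 <= T by rewrite s0_gt0 (andP s0T).2.
have dwe : is_derive s0 1 (we^~ l0) (dw s0 l0 - e * (2 * p + 1)).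
  have h1 := iw s0 l0 s0T'.
  have -> : we^~ l0 = (w^~ l0) - (fun s => e * ((width l0)%:R + 1 + (2 * p + 1) * s)).
    by apply/funext.
  exact: is_deriveB (is_derive_affine _ _ _ _).
have : 0 <= dw s0 l0 - e * (2 * p + 1).
  apply: left_max_derive_ge0 s0_gt0 dwe _ => r /andP[r0 rs].
  by apply: glob; rewrite r0/= (le_trans (ltW rs))// (andP s0T).2.
have g1 : gen p q (we s0) l0 <= 0 by apply: gen_le0_max => // l'; exact: glob.
have gE : gen p q (we s0) l0 = gen p q (w s0) l0 - e * gen p q (fun l => (width l)%:R) l0.
  have -> : we s0 = fun l => (w s0 l - e * (width l)%:R) - e * (1 + (2 * p + 1) * s0).
    by apply/funext => l; rewrite /we; ring.
  by rewrite genB genB genZ gen_cst subr0.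
(* The time derivative at the maximum forces [dw s0 l0 >= e * (2 * p + 1)], while the equation and
   [gen_width] allow at most [e * (2 * p)]. *)
have := dle s0 l0 s0T'; have := gen_width l0; move: g1; rewrite gE.
move: (gen p q (fun l => (width l)%:R) l0) (gen p q (w s0) l0) => G H.
move=> g1 h1 h2; have := mulr_ge0 (ltW e0) (_ : 0 <= 2 * p - G); rewrite subr_ge0 => /(_ h1).
by move: g1 h2 e0; lra.
Qed.
End maximum_principle.

(* [v s l] stands for [exp ((q - p) s)] times the probability of [l] at time
   [s]; the factor turns the forward equation into this backward one. *)
Record backward_solution {R : realType} (p q : R) (v : R -> part -> R) : Prop := {
  bs_init : forall l, v 0 l = (l == empty_part)%:R;
  bs_cont : forall (T : R) l, {within `[0, T], continuous (v^~ l)};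
  bs_derive : forall (s : R) l, 0 < s -> is_derive s 1 (v^~ l) (gen p q (v s) l);
  bs_ge0 : forall (s : R) l, 0 <= s -> 0 <= v s l;
  bs_bound : forall T, exists C, forall (s : R) l, 0 <= s <= T -> v s l <= C }.

Lemma is_derive_add_time {R : realType} (f : R -> R) (a s D : R) :
  is_derive (a + s) 1 f D -> is_derive s 1 (fun r => f (a + r)) D.
Proof.
move=> h; have := is_derive1_comp (f := f) (g := fun r => 1 * (a + 1 * r)) (x := s).
have := is_derive_affine 1 a 1 s; move=> /[swap] /(_ D (1 * 1)).
rewrite /= !mul1r mulr1 => H1 H2; have -> : (fun r => f (a + r)) = f \o (fun r => 1 * (a + 1 * r)).
  by apply/funext => r /=; rewrite !mul1r.
exact: H1.
Qed.

Lemma is_derive_expRZ {R : realType} (k s c : R) :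
  is_derive s 1 (fun s => expR (k * s) * c) (k * (expR (k * s) * c)).
Proof.
have h : is_derive s 1 (fun s => expR (k * s)) (expR (k * s) * k).
  have -> : (fun s => expR (k * s)) = expR \o (fun s => k * (0 + 1 * s)).
    by apply/funext => r /=; rewrite add0r mul1r.
  have h1 := is_derive_affine k 0 1 s.
  have := is_derive1_comp (f := expR) (x := s) (is_derive_expR _) h1.
  by rewrite /= add0r mul1r mulr1.
have := is_deriveM h (is_derive_cst c s 1).
rewrite scaler0 add0r => H.
by apply: is_derive_eq => /=; rewrite -[_ *: _]/(_ * _); ring.
Qed.

Section comparison.
Context {R : realType} (p q : R) (v : R -> part -> R).
Hypotheses (p0 : 0 < p) (pq : p < q) (pq1 : p + q = 1).
Hypothesis sol : backward_solution p q v.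

Let q0 : 0 < q. Proof. exact: lt_trans pq. Qed.

Lemma bs_shift_cont (a T : R) l : 0 <= a ->
  {within `[0, T], continuous (fun s => v (a + s) l)}.
Proof.
rewrite le_eqVlt => /predU1P[<-|a0].
  by have -> : (fun s => v (0 + s) l) = v^~ l;
    [apply/funext => s; rewrite add0r|exact: bs_cont sol _ _].
apply: derivable_within_continuous => x; rewrite in_itv/= => /andP[x0 _].
by have [] := is_derive_add_time (bs_derive sol l (ltr_pwDl a0 x0)).
Qed.

Lemma bs_shift_derive (a s : R) l : 0 <= a -> 0 < s ->
  is_derive s 1 (fun s => v (a + s) l) (gen p q (v (a + s)) l).
Proof.
by move=> a0 s0; exact: is_derive_add_time (bs_derive sol l (ltr_wpDl a0 s0)).
Qed.

(** Nonnegativity of [psi] bounds the difference from above, as the maximum principle demands. The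
    starting time [a] is free because comparison is later restarted once [v] is near its limit on a
    box. *)
Lemma bs_le_super (a : R) (psi dpsi : R -> part -> R) : 0 <= a ->
  (forall (s : R) l, is_derive s 1 (psi^~ l) (dpsi s l)) ->
  (forall (s : R) l, 0 < s -> gen p q (psi s) l <= dpsi s l) ->
  (forall (s : R) l, 0 <= s -> 0 <= psi s l) ->
  (forall l, v a l <= psi 0 l) ->
  forall (s : R) l, 0 <= s -> v (a + s) l <= psi s l.
Proof.
move=> a0 dps gps ps0 h0 s l s0; rewrite -subr_le0.
have [C hC] := bs_bound sol (a + s).
apply: (@max_principle _ p q (ltW p0) (ltW q0) (fun s l => v (a + s) l - psi s l)
  (fun s l => gen p q (v (a + s)) l - dpsi s l) s C) (s) (l) _ => //.
- move=> l'; apply: within_continuousB; first exact: bs_shift_cont.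
  by apply: derivable_within_continuous => x _; have [] := dps x l'.
- move=> r l' /andP[r0 _]; exact: is_deriveB (bs_shift_derive l' a0 r0) (dps r l').
- by move=> r l' /andP[r0 _]; rewrite genB lerB// gps.
- move=> r l' /andP[r0 rs]; apply: le_trans (_ : v (a + r) l' <= C).
    by rewrite gerBl ps0.
  by apply: hC; rewrite addr_ge0//= lerD2l.
- by move=> l'; rewrite addr0 subr_le0.
- by rewrite s0 lexx.
Qed.

Lemma bs_ge_sub (a C : R) (psi dpsi : R -> part -> R) : 0 <= a ->
  (forall (s : R) l, is_derive s 1 (psi^~ l) (dpsi s l)) ->
  (forall (s : R) l, 0 < s -> dpsi s l <= gen p q (psi s) l) ->
  (forall (s : R) l, 0 <= s -> psi s l <= C) ->
  (forall l, psi 0 l <= v a l) ->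
  forall (s : R) l, 0 <= s -> psi s l <= v (a + s) l.
Proof.
move=> a0 dps gps psC h0 s l s0; rewrite -subr_le0.
apply: (@max_principle _ p q (ltW p0) (ltW q0) (fun s l => psi s l - v (a + s) l)
  (fun s l => dpsi s l - gen p q (v (a + s)) l) s C) (s) (l) _ => //.
- move=> l'; apply: within_continuousB; last exact: bs_shift_cont.
  by apply: derivable_within_continuous => x _; have [] := dps x l'.
- move=> r l' /andP[r0 _]; exact: is_deriveB (dps r l') (bs_shift_derive l' a0 r0).
- by move=> r l' /andP[r0 _]; rewrite genB lerB// gps.
- move=> r l' /andP[r0 rs]; apply: le_trans (psC _ l' r0).
  by rewrite gerBl (bs_ge0 sol)// addr_ge0.
- by move=> l'; rewrite addr0 subr_le0.
- by rewrite s0 lexx.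
Qed.

(** The bound [bs_bound] may grow with the time horizon; comparison with the constant solution 1
    removes this growth. *)
Lemma bs_le1 (s : R) l : 0 <= s -> v s l <= 1.
Proof.
move=> s0; rewrite -[s]add0r.
apply: (@bs_le_super 0 (fun _ _ => 1) (fun _ _ => 0)) => //.
- by move=> r l'; exact: is_derive_cst.
- by move=> r l' _; rewrite gen_cst.
- by move=> l'; rewrite (bs_init sol); case: eqP.
Qed.

Section tails.
Variables (b : R).
Hypotheses (b0 : 0 < b) (b1 : b < 1).
Let k := p * b + q / b - 1.

Lemma tail_up n : p * (b ^+ n.+1 - b ^+ n) = p * (b - 1) * b ^+ n.
Proof. by rewrite exprS; ring. Qed.

Lemma tail_down n : q * (b ^+ n - b ^+ n.+1) = q * (b^-1 - 1) * b ^+ n.+1.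
Proof. by rewrite exprS; field; rewrite gt_eqF. Qed.

Let kE : k = p * (b - 1) + q * (b^-1 - 1).
Proof. by rewrite /k -[X in _ - X = _]pq1; ring. Qed.

Let qb0 : 0 <= q * (b^-1 - 1).
Proof. by rewrite mulr_ge0 ?(ltW q0)// subr_ge0 invf_ge1// ltW. Qed.

Let bn0 n : 0 <= b ^+ n. Proof. by rewrite exprn_ge0// ltW. Qed.

(** [k] is the growth rate of [b ^ n] under a walk going up at rate [p] and down at rate [q]. Row 0
    follows this walk except that downward steps may be blocked, and blocking only lowers the
    generator since [b < 1]. *)
Lemma bs_tail_head (s : R) l : 0 <= s -> v s l <= expR (k * s) * b ^+ l 0%N.
Proof.
move=> s0; rewrite -[s in v s]add0r.
apply: (@bs_le_super 0 (fun s l => expR (k * s) * b ^+ l 0%N)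
  (fun s l => k * (expR (k * s) * b ^+ l 0%N))) => //.
- by move=> r l'; exact: is_derive_expRZ.
- move=> r l' _; rewrite genZ (gen_head p q (fun n => b ^+ n)) mulrCA ler_pM2l ?expR_gt0//.
  rewrite tail_up kE mulrDl lerD2l.
  case E : (l' 0%N) => [|n]; first by rewrite sub0n subrr mulr0 mulr_ge0.
  case: (canR l' 0); last by rewrite subn0 subrr mulr0 mulr_ge0.
  by rewrite subn1 tail_down.
- by move=> r l' _; rewrite mulr_ge0 ?expR_ge0.
- move=> l'; rewrite (bs_init sol) mulr0 expR0 mul1r; case: eqP => [->|]//=.
Qed.

Lemma bs_tail_len (s : R) l : 0 <= s -> v s l <= expR (k * s) * b ^+ len l.
Proof.
move=> s0; rewrite -[s in v s]add0r.
apply: (@bs_le_super 0 (fun s l => expR (k * s) * b ^+ len l)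
  (fun s l => k * (expR (k * s) * b ^+ len l))) => //.
- by move=> r l'; exact: is_derive_expRZ.
- move=> r l' _; rewrite genZ (gen_len p q (fun n => b ^+ n)) mulrCA ler_pM2l ?expR_gt0//.
  rewrite tail_up kE mulrDl lerD2l.
  case: ifP => [|/norP[]]; first by rewrite mulr_ge0.
  by case: (len l') => //= n _ _; rewrite tail_down.
- by move=> r l' _; rewrite mulr_ge0 ?expR_ge0.
- by move=> l'; rewrite (bs_init sol) mulr0 expR0 mul1r; case: eqP => [->|]//=; rewrite len_empty.
Qed.

End tails.
End comparison.

(** * Convergence to equilibrium *)

Arguments box : simpl never.

Lemma box_sub_sum {R : zmodType} (F : part -> R) a b a' b' : (a <= a')%N -> (b <= b')%N ->
  \sum_(l <- box a' b') F l =
  \sum_(l <- box a b) F l + \sum_(l <- box a' b' | l \notin box a b) F l.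
Proof.
move=> aa bb; rewrite (bigID (fun l => l \in box a b))/=; congr (_ + _).
rewrite -big_filter; apply: perm_big; apply: uniq_perm; rewrite ?filter_uniq ?box_uniq// => l.
rewrite mem_filter !mem_box; case: (leqP (len l) a) => //= la; case: (leqP (l 0%N) b) => //= lb.
by rewrite (leq_trans la)// (leq_trans lb).
Qed.

Lemma is_derive_sum_seq {R : realType} {T : Type} (r : seq T) (f : T -> R -> R) (df : T -> R) (s : R) :
  (forall l, is_derive s 1 (f l) (df l)) ->
  is_derive s 1 (fun s => \sum_(l <- r) f l s) (\sum_(l <- r) df l).
Proof.
move=> h; elim: r => [|a r ih].
  rewrite big_nil; have -> : (fun s => \sum_(l <- [::]) f l s) = cst 0.
    by apply/funext => x; rewrite big_nil.
  exact: is_derive_cst.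
rewrite big_cons; have -> : (fun s => \sum_(l <- a :: r) f l s) = f a + (fun s => \sum_(l <- r) f l s).
  by apply/funext => x; rewrite big_cons.
exact: is_deriveD.
Qed.

Lemma within_continuous_sum_seq {R : realType} {T : Type} (r : seq T) (f : T -> R -> R) (A : set R) :
  (forall l, {within A, continuous (f l)}) ->
  {within A, continuous (fun s => \sum_(l <- r) f l s)}.
Proof.
move=> h; elim: r => [|a r ih].
  have -> : (fun s => \sum_(l <- [::]) f l s) = cst 0 by apply/funext => x; rewrite big_nil.
  by apply: continuous_subspaceT => x; exact: cst_continuous.
have -> : (fun s => \sum_(l <- a :: r) f l s) = f a + (fun s => \sum_(l <- r) f l s).
  by apply/funext => x; rewrite big_cons.
exact: within_continuousD.
Qed.

Lemma mvt_le {R : realType} (f df : R -> R) (a b c : R) : a <= b ->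
  {within `[a, b], continuous f} ->
  (forall x, a < x < b -> is_derive x 1 f (df x)) ->
  (forall x, a < x < b -> df x <= c) -> f b - f a <= c * (b - a).
Proof.
rewrite le_eqVlt => /predU1P[->|ab] cf df1 dfc; first by rewrite !subrr mulr0.
have h x : x \in `]a, b[%R -> is_derive x 1 f (df x) by rewrite in_itv; exact: df1.
have [x xab ->] := MVT ab h cf.
by rewrite ler_pM2r ?subr_gt0// dfc//; move: xab; rewrite in_itv.
Qed.

Section dirichlet.
Context {R : realType} (p q : R).
Hypotheses (p0 : 0 < p) (pq : p < q) (pq1 : p + q = 1).
Let q0 : 0 < q. Proof. exact: lt_trans pq. Qed.
Let tau := p / q.
Let pi l := tau ^+ psize l.

(** Removing a box from [l] stays inside the square while adding one may leave it, hence the extra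
    condition on the right. *)
Lemma reindex_remp (F : part -> R) i K :
  \sum_(l <- box K K | canR l i) F l =
  \sum_(l <- box K K | canL l i && (addp l i \in box K K)) F (addp l i).
Proof.
rewrite -[LHS]big_filter -[RHS]big_filter -(big_map (addp^~ i) xpredT F).
apply: perm_big; apply: uniq_perm; first by rewrite filter_uniq// box_uniq.
  rewrite map_inj_in_uniq ?filter_uniq ?box_uniq// => x y.
  rewrite !mem_filter => /andP[/andP[hx _] _] /andP[/andP[hy _] _] e.
  by rewrite -(addpK hx) e addpK.
move=> l; apply/idP/mapP => [|[m]]; rewrite mem_filter.
  move=> /andP[hR lB]; exists (remp l i); last by rewrite rempK.
  rewrite mem_filter rempK// canL_remp// lB /=.
  move: lB; rewrite !mem_box => /andP[h1 h2]; rewrite len_remp_le//=.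
  by apply: leq_trans h2; exact: leq_subr.
by move=> /andP[/andP[hL hB] _] ->; rewrite mem_filter hB canR_addp.
Qed.

(** Summation by parts: detailed balance [pi (addp l i) * q = pi l * p] merges the two directions of
    each edge. An edge leaving the square keeps only its inner endpoint, which is the role of the
    membership factor. *)
Lemma dirichlet (f g : part -> R) K :
  \sum_(l <- box K K) pi l * (f l * gen p q g l) =
  \sum_(i < K.+1) \sum_(l <- box K K | canL l i)
     pi l * p * (g (addp l i) - g l) * (f l - (addp l i \in box K K)%:R * f (addp l i)).
Proof.
transitivity (\sum_(l <- box K K) \sum_(i < K.+1) pi l * (f l * gent p q g l i)).
  rewrite big_seq [RHS]big_seq; apply: eq_bigr => l; rewrite mem_box => /andP[lK _].
  by rewrite (@gen_wide _ _ _ _ _ K.+1)// -!mulr_sumr.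
rewrite exchange_big/=; apply: eq_bigr => i _.
transitivity (\sum_(l <- box K K | canL l i) pi l * p * (g (addp l i) - g l) * f l +
   \sum_(l <- box K K | canR l i) pi l * q * (g (remp l i) - g l) * f l).
  rewrite (big_mkcond (canL^~ i)) (big_mkcond (canR^~ i)) -big_split/=.
  apply: eq_bigr => l _; rewrite /gent; case: ifPn => hL; case: ifPn => hR;
    rewrite ?(addp_id hL) ?(remp_id hR); ring.
rewrite reindex_remp [X in _ + X]big_mkcondr -big_split/=; apply: eq_bigr => l hL.
case: ifP => _; last by rewrite mul0r subr0 addr0.
have tq : tau * q = p by rewrite /tau divfK// gt_eqF.
have -> : pi (addp l i) * q = pi l * p.
  by rewrite /pi psize_addp// exprS mulrAC tq mulrC.
by rewrite addpK// mul1r; ring.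
Qed.

Lemma pi_ge0 l : 0 <= pi l.
Proof. by rewrite exprn_ge0// divr_ge0// ltW. Qed.

Definition boundary K := Zbox tau K.+1 K.+1 - Zbox tau K K.

(** There are only two ways out of the square: row 0 exceeds the width, or the first row below the
    square becomes nonempty. Each starts from a partition outside the next smaller square, whence
    two copies of the layer's mass. *)
Lemma crossing_le (h : nat -> part -> R) K :
  (forall i l, canL l i -> addp l i \notin box K.+1 K.+1 -> h i l <= 1) ->
  \sum_(i < K.+2) \sum_(l <- box K.+1 K.+1 | canL l i && (addp l i \notin box K.+1 K.+1)) pi l * h i l
   <= 2 * boundary K.
Proof.
move=> hle.
apply: (@le_trans _ _ (\sum_(i < K.+2) \sum_(l <- box K.+1 K.+1 | l \notin box K K)
     ((i == 0 :> nat)%:R + (i == K.+1 :> nat)%:R) * pi l)).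
  apply: ler_sum => i _; rewrite [leRHS]big_mkcond [leLHS]big_mkcond/= big_seq [leRHS]big_seq.
  apply: ler_sum => l lB.
  have pl := pi_ge0 l; set c := _%:R + _%:R.
  have c0 : 0 <= c by rewrite /c addr_ge0.
  case: ifP => [/andP[hL hB]|_]; last by case: ifP => // _; rewrite mulr_ge0.
  have hl : pi l * h i l <= pi l by rewrite -[leRHS]mulr1 ler_wpM2l// hle.
  have [hc hn] : 1 <= c /\ l \notin box K K.
    move: lB hB; rewrite !mem_box !negb_and -!ltnNge => /andP[l1 l2].
    rewrite [(_ < len _)%N]ltnNge len_le addpE.
    have /eqP -> : l K.+1 == 0%N by rewrite -len_le.
    rewrite add0n addpE hL !andbT /c.
    have : canL l i := hL; rewrite /canL.
    case: (eqVneq (i : nat) 0%N) => [->|i0]/=.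
      by rewrite addn1 ltnS => _ ->; rewrite addr0 orbT.
    rewrite addn0 (ltnNge K.+1) l2 orbF.
    rewrite eqb0 negbK => hlt /eqP Ei; move: hlt; rewrite -Ei eqxx add0r => hlt; split => //.
    by rewrite ltnNge len_le -lt0n (leq_ltn_trans _ hlt).
  by rewrite hn; apply: le_trans hl _; rewrite ler_peMl.
rewrite exchange_big/= /boundary /Zbox (@box_sub_sum _ _ K K K.+1 K.+1)// [_ + _ - _]addrC addKr mulr_sumr.
apply: ler_sum => l _; rewrite -mulr_suml ler_wpM2r ?pi_ge0//.
rewrite big_split/= big_ord_recl [X in 1 + X]big1 ?addr0//.
rewrite big_ord_recr/= eqxx [X in 1 + (X + _)]big1 ?add0r//.
by move=> i _; rewrite ltn_eqF.
Qed.

End dirichlet.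

Lemma mem_box_width l K : (width l <= K)%N -> l \in box K.+1 K.+1.
Proof. by rewrite mem_box /width => h; apply/andP; split; lia. Qed.

Lemma is_derive_cM {R : realType} (c : R) (f : R -> R) (s D : R) :
  is_derive s 1 f D -> is_derive s 1 (fun s => c * f s) (c * D).
Proof. exact: (@is_deriveZ R R R f c s 1 D). Qed.

Lemma is_derive_sqr {R : realType} (f : R -> R) (s D : R) :
  is_derive s 1 f D -> is_derive s 1 (fun s => f s * f s) (2 * (f s * D)).
Proof.
move=> h; have -> : 2 * (f s * D) = f s *: D + f s *: D by rewrite -mulr2n mulr_natl.
exact: is_deriveM.
Qed.

Section equilibrium.
Context {R : realType} (p q : R) (v : R -> part -> R).
Hypotheses (p0 : 0 < p) (pq : p < q) (pq1 : p + q = 1).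
Hypothesis sol : backward_solution p q v.
Let q0 : 0 < q. Proof. exact: lt_trans pq. Qed.
Let tau := p / q.
Let tau0 : 0 < tau. Proof. exact: divr_gt0. Qed.
Let tau1 : tau < 1. Proof. by rewrite ltr_pdivrMr// mul1r. Qed.
Let pi l := tau ^+ psize l.
Let pi0 l : 0 <= pi l. Proof. exact: pi_ge0. Qed.

Let p1 : p <= 1. Proof. by rewrite -pq1 lerDl ltW. Qed.

Let v1 (s : R) l : 0 <= s -> v s l <= 1. Proof. exact: (bs_le1 p0 pq sol). Qed.
Let v0 (s : R) l : 0 <= s -> 0 <= v s l. Proof. exact: bs_ge0 sol _ _. Qed.

Let dv1 (s : R) l l' : 0 <= s -> `|v s l' - v s l| <= 1.
Proof.
move=> s0; have := v1 l s0; have := v1 l' s0; have := v0 l s0; have := v0 l' s0.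
by rewrite ler_norml; lra.
Qed.

Lemma gen_bound (s : R) l : 0 <= s -> `|gen p q (v s) l| <= (len l).+1%:R.
Proof.
move=> s0; apply: le_trans (ler_norm_sum _ _ _) _.
rewrite -[X in _ <= X%:R]card_ord -sumr_const; apply: ler_sum => i _.
apply: le_trans (ler_normD _ _) _; rewrite !normrM (gtr0_norm p0) (gtr0_norm q0).
by rewrite -[leRHS]pq1; apply: lerD; rewrite ler_piMr ?dv1 ?(ltW p0) ?(ltW q0).
Qed.

Let mass K s := \sum_(l <- box K.+1 K.+1) pi l * v s l.
Let energy K s := \sum_(l <- box K.+1 K.+1) pi l * (v s l * v s l).
Let bd K := boundary p q K.

Let is_derive_mass K (s : R) : 0 < s ->
  is_derive s 1 (mass K) (\sum_(l <- box K.+1 K.+1) pi l * (1 * gen p q (v s) l)).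
Proof.
move=> s0; apply: (@is_derive_sum_seq _ _ _ (fun l s => pi l * v s l)) => l.
rewrite mul1r.
exact: is_derive_cM (bs_derive sol l s0).
Qed.

Let is_derive_energy K (s : R) : 0 < s ->
  is_derive s 1 (energy K) (2 * \sum_(l <- box K.+1 K.+1) pi l * (v s l * gen p q (v s) l)).
Proof.
move=> s0; rewrite mulr_sumr; apply: (@is_derive_sum_seq _ _ _ (fun l s => pi l * (v s l * v s l))) => l.
have -> : 2 * (pi l * (v s l * gen p q (v s) l)) = pi l * (2 * (v s l * gen p q (v s) l)) by ring.
exact: is_derive_cM (is_derive_sqr (bs_derive sol l s0)).
Qed.

Let cont_mass K T : {within `[0, T], continuous (mass K)}.
Proof.
apply: (@within_continuous_sum_seq _ _ _ (fun l s => pi l * v s l)) => l.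
by move=> x; apply: cvgM; [exact: cvg_cst|exact: (bs_cont sol)].
Qed.

Let cont_energy K T : {within `[0, T], continuous (energy K)}.
Proof.
apply: (@within_continuous_sum_seq _ _ _ (fun l s => pi l * (v s l * v s l))) => l.
by move=> x; apply: cvgM; [exact: cvg_cst|apply: cvgM; exact: (bs_cont sol)].
Qed.

Let mass_rate K (s : R) : 0 <= s ->
  `|\sum_(l <- box K.+1 K.+1) pi l * (1 * gen p q (v s) l)| <= 2 * bd K.
Proof.
move=> s0; rewrite (@dirichlet _ p q p0 pq (fun=> 1)).
apply: le_trans (ler_norm_sum _ _ _) _.
apply: le_trans (crossing_le p0 pq (h := fun i l => `|p * (v s (addp l i) - v s l)|) _); last first.
  by move=> i l _ _; rewrite normrM gtr0_norm// -[leRHS]mulr1 ler_pM ?dv1// ltW.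
apply: ler_sum => i _; apply: le_trans (ler_norm_sum _ _ _) _.
rewrite [leRHS]big_mkcondr; apply: ler_sum => l _.
case: ifPn => [_|/negPn ->]; last by rewrite mul1r subrr mulr0 normr0.
case: (addp l i \in _); first by rewrite mul1r subrr mulr0 normr0; apply: mulr_ge0 => //; exact: pi0.
by rewrite mul0r subr0 mulr1 -mulrA normrM (ger0_norm (pi0 l)).
Qed.

(** In [dirichlet] with both functions equal to [v], interior edges contribute negative squares, of
    which a single one is retained, and the leaving edges are bounded by [crossing_le]. *)
Let energy_rate K (s : R) l0 (i0 : 'I_K.+2) : 0 <= s -> canL l0 i0 ->
  l0 \in box K.+1 K.+1 -> addp l0 i0 \in box K.+1 K.+1 ->
  \sum_(l <- box K.+1 K.+1) pi l * (v s l * gen p q (v s) l) <=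
   2 * bd K - pi l0 * p * (v s (addp l0 i0) - v s l0) ^+ 2.
Proof.
move=> s0 hL lB aB; rewrite dirichlet//.
pose a (i : nat) l := pi l * p * (v s (addp l i) - v s l) ^+ 2.
have a0 i l : 0 <= a i l by exact: mulr_ge0 (mulr_ge0 (pi0 l) (ltW p0)) (sqr_ge0 _).
rewrite -/(a i0 l0).
have hA : a i0 l0 <= \sum_(i < K.+2) \sum_(l <- box K.+1 K.+1 | canL l i && (addp l i \in box K.+1 K.+1)) a i l.
  rewrite (bigD1 i0)//= -[leLHS]addr0 lerD ?sumr_ge0//; last first.
    by move=> i _; rewrite sumr_ge0.
  by rewrite -big_filter (bigD1_seq l0) ?filter_uniq ?box_uniq ?mem_filter ?hL ?aB//= lerDl sumr_ge0.
have hB := crossing_le p0 pq (h := fun i l => p * (v s (addp l i) - v s l) * v s l) (K := K) _.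
apply: le_trans (_ : _ <= \sum_(i < K.+2) \sum_(l <- box K.+1 K.+1 | canL l i && (addp l i \notin box K.+1 K.+1))
   pi l * (p * (v s (addp l i) - v s l) * v s l) -
  \sum_(i < K.+2) \sum_(l <- box K.+1 K.+1 | canL l i && (addp l i \in box K.+1 K.+1)) a i l) _; last first.
  apply: lerB hA; apply: hB => i l _ _.
  apply: le_trans (ler_norm _) _; rewrite !normrM (gtr0_norm p0) (ger0_norm (v0 l s0)).
  by rewrite mulr_ile1 ?mulr_ile1 ?mulr_ge0 ?normr_ge0 ?v0 ?v1 ?dv1 ?(ltW p0).
rewrite -sumrB; apply: ler_sum => i _.
rewrite [X in _ <= X - _]big_mkcondr [X in _ <= _ - X]big_mkcondr -sumrB.
apply: ler_sum => l _; rewrite /a /pi /tau le_eqVlt; apply/orP; left; apply/eqP.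
by case: (addp l i \in _) => /=; ring.
Qed.

Let energy0 K : energy K 0 = 1.
Proof.
rewrite /energy (bigD1_seq empty_part) ?box_uniq//=; last by rewrite mem_box len_empty.
rewrite (bs_init sol) eqxx /pi psize_empty !mulr1 big1 ?addr0// => l /negPf h.
by rewrite (bs_init sol) h mulr0 mulr0.
Qed.

Let mass0 K : mass K 0 = 1.
Proof.
rewrite /mass (bigD1_seq empty_part) ?box_uniq//=; last by rewrite mem_box len_empty.
rewrite (bs_init sol) eqxx /pi psize_empty !mulr1 big1 ?addr0// => l /negPf h.
by rewrite (bs_init sol) h mulr0.
Qed.

Let energy_ge0 K (s : R) : 0 <= s -> 0 <= energy K s.
Proof. by move=> s0; apply: sumr_ge0 => l _; rewrite mulr_ge0 ?mulr_ge0 ?v0. Qed.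

Let sub_itv_cont (f : R -> R) (a b : R) : 0 <= a ->
  (forall T : R, {within `[0, T], continuous f}) -> {within `[a, b], continuous f}.
Proof.
move=> a0 cf; apply: continuous_subspaceW (cf b) => x /=; rewrite !in_itv/= => /andP[ax ->].
by rewrite (le_trans a0 ax).
Qed.

(** The total of [pi * v] is conserved up to the flow through the boundary of the square, and it
    starts at 1 because [v 0] is the indicator of the empty partition. *)
Let mass_near1 K (s : R) : 0 <= s -> `|mass K s - 1| <= 2 * bd K * s.
Proof.
move=> s0; rewrite ler_norml; apply/andP; split.
  have := @mvt_le R (fun s => - mass K s) _ 0 s (2 * bd K) s0 _
    (fun x hx => is_deriveN (is_derive_mass K (andP hx).1)).
  rewrite mass0 subr0 opprK => h; rewrite -lerN2 opprK opprB addrC; apply: h.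
    by move=> x; apply: cvgN; exact: sub_itv_cont.
  move=> x /andP[x0 _]; apply: le_trans (mass_rate K (ltW x0)).
  by rewrite -normrN ler_norm.
have := @mvt_le R (mass K) _ 0 s (2 * bd K) s0 _ (fun x hx => is_derive_mass K (andP hx).1).
rewrite mass0 subr0; apply; first exact: sub_itv_cont.
by move=> x /andP[x0 _]; apply: le_trans (mass_rate K (ltW x0)); exact: ler_norm.
Qed.

Let bd_ge0 K : 0 <= bd K.
Proof.
rewrite /bd /boundary /Zbox (@box_sub_sum _ _ K K K.+1 K.+1)// [_ + _ - _]addrC addKr.
by apply: sumr_ge0 => l _; exact: pi0.
Qed.

Let energy_step K (a b c : R) : 0 <= a -> a <= b ->
  (forall s, a < s < b -> \sum_(l <- box K.+1 K.+1) pi l * (v s l * gen p q (v s) l) <= 2 * bd K - c) ->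
  energy K b - energy K a <= (4 * bd K - 2 * c) * (b - a).
Proof.
move=> a0 ab h; apply: (@mvt_le R (energy K) _ a b _ ab _
  (fun x hx => is_derive_energy K (le_lt_trans a0 (andP hx).1))).
  exact: sub_itv_cont.
by move=> x xab; have := h _ xab; lra.
Qed.

(** The energy starts at 1 and is nonnegative. If the difference across the edge were at least [eta]
    at arbitrarily late times, its Lipschitz bound would keep it above [eta / 2] for a fixed
    duration each time, and each such episode would consume a fixed amount of energy. *)
Lemma gradient_cvg0 l i : canL l i ->
  (fun s => v s (addp l i) - v s l) @ +oo --> (0 : R).
Proof.
move=> hL; apply/cvgrPdist_lt => eta eta0; apply: contrapT => /not_near_inftyP hbad.
pose g s := v s (addp l i) - v s l.
pose C : R := (len (addp l i)).+1%:R + (len l).+1%:R.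
have C0 : 0 < C by rewrite addr_gt0.
have dg (s : R) : 0 < s -> is_derive s 1 g (gen p q (v s) (addp l i) - gen p q (v s) l).
  by move=> s0; exact: is_deriveB (bs_derive sol _ s0) (bs_derive sol _ s0).
have dgC (s : R) : 0 < s -> `|gen p q (v s) (addp l i) - gen p q (v s) l| <= C.
  by move=> s0; apply: le_trans (ler_normB _ _) _; rewrite lerD// gen_bound// ltW.
have cg T : {within `[0, T], continuous g}.
  by apply: within_continuousB; exact: (bs_cont sol).
have lip (a b : R) : 0 <= a -> a <= b -> `|g b - g a| <= C * (b - a).
  move=> a0 ab; rewrite ler_norml; apply/andP; split.
    have := @mvt_le R (fun s => - g s) _ a b C ab _
      (fun x hx => is_deriveN (dg x (le_lt_trans a0 (andP hx).1))).
    rewrite -opprD -lerN2 !opprK => h; apply: h; first by move=> x; apply: cvgN; exact: sub_itv_cont.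
    move=> x /andP[ax _]; apply: le_trans (dgC x (le_lt_trans a0 ax)).
    by rewrite -normrN ler_norm.
  apply: (@mvt_le R g _ a b C ab _ (fun x hx => dg x (le_lt_trans a0 (andP hx).1))).
    exact: sub_itv_cont.
  move=> x /andP[ax _]; apply: le_trans (dgC x (le_lt_trans a0 ax)); exact: ler_norm.
(* Over a time [w] the difference changes by at most [C * w = eta / 2]. *)
pose w := eta / (2 * C).
have w0 : 0 < w by rewrite divr_gt0// mulr_gt0.
have wC : C * w = eta / 2 by rewrite /w; field; rewrite gt_eqF.
pose D := pi l * p * (eta / 2) ^+ 2.
have D0 : 0 < D.
  rewrite mulr_gt0 ?exprn_gt0 ?divr_gt0// mulr_gt0// /pi exprn_gt0//.
pose K0 := (width (addp l i) + width l + i)%N.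
have inB K : (K0 <= K)%N -> l \in box K.+1 K.+1 /\ addp l i \in box K.+1 K.+1.
  by move=> KK; split; apply: mem_box_width; apply: leq_trans KK; rewrite /K0 -addnA;
    [exact: leq_trans (leq_addr _ _) (leq_addl _ _)|exact: leq_addr].
have rate K (s : R) : (K0 <= K)%N -> 0 <= s ->
    \sum_(l <- box K.+1 K.+1) pi l * (v s l * gen p q (v s) l) <= 2 * bd K - pi l * p * g s ^+ 2.
  move=> KK s0; have [lB aB] := inB K KK.
  have iK : (i < K.+2)%N by rewrite ltnS; apply: leqW; apply: leq_trans KK; exact: leq_addl.
  exact: (@energy_rate K s l (Ordinal iK)).
(* [T] does not depend on [K], so after [n] episodes have been collected the boundary error
   [4 * bd K * T] can be made small by enlarging [K]. *)
have claim n : exists2 T : R, 0 <= T &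
    forall K, (K0 <= K)%N -> energy K T <= 1 - n%:R * (2 * D * w) + 4 * bd K * T.
  elim: n => [|n [T T0 hT]].
    by exists 0 => // K _; rewrite energy0 mul0r mulr0 subr0 addr0.
  have [s Ts hs] := hbad (T + 1) (num_real _).
  have {hs} gs : eta <= `|g s| by rewrite leNgt; apply/negP => hh; apply: hs; rewrite sub0r normrN.
  have s0 : 0 <= s by lra.
  exists (s + w); first by rewrite addr_ge0// ltW.
  move=> K KK.
  have TsW : T <= s by lra.
  have e1 : energy K s - energy K T <= (4 * bd K - 2 * 0) * (s - T).
    apply: energy_step => // x /andP[Tx _].
    have x0 : 0 <= x by rewrite (le_trans T0)// ltW.
    apply: le_trans (rate K x KK x0) _; rewrite lerD2l lerN2.
    by rewrite mulr_ge0 ?sqr_ge0// mulr_ge0 ?pi0// ltW.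
  have e2 : energy K (s + w) - energy K s <= (4 * bd K - 2 * D) * (s + w - s).
    apply: energy_step => //; first by rewrite lerDl ltW.
    move=> x /andP[sx xw]; have x0 : 0 <= x by rewrite (le_trans s0)// ltW.
    apply: le_trans (rate K x KK x0) _; rewrite lerD2l lerN2 /D.
    rewrite ler_wpM2l ?mulr_ge0 ?pi0 ?(ltW p0)// -[leRHS]real_normK ?num_real//.
    have h2 : eta / 2 <= `|g x|.
      have := lip s x s0 (ltW sx); have : C * (x - s) <= eta / 2.
        by rewrite -wC ler_pM2l//; lra.
      have := ler_dist_dist (g s) (g x); rewrite distrC => h3 h4 h5.
      have := ler_normD (g s - g x) (g x); rewrite subrK; rewrite distrC in h5; lra.
    by rewrite ler_pXn2r ?nnegrE// divr_ge0// ltW.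
  have e3 := hT K KK.
  rewrite -natr1; move: e1 e2 e3; move: (energy K _) (energy K _) (energy K _) (bd K) => E1 E2 E3 B.
  have -> : s + w - s = w by ring.
  by lra.
have [n hn] : exists n : nat, 2 < n%:R * (2 * D * w).
  exists (Num.truncn (2 / (2 * D * w))).+1; rewrite -ltr_pdivrMr ?truncnS_gt//.
  by apply: mulr_gt0 => //; apply: mulr_gt0.
have [T T0 hT] := claim n.
(* With the boundary mass below this value the error is less than 1, whereas the episodes have
   consumed more than 2: the energy would be negative. *)
have /cvgrPdist_lt/(_ (1 / (4 * T + 1))) := Zbox_diff_cvg tau0 tau1.
have T41 : 0 < 4 * T + 1 by lra.
rewrite divr_gt0// => /(_ isT)[N _ hN].
have := hN (maxn N K0) (leq_maxl _ _); rewrite /= sub0r normrN -/tau.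
rewrite -/(boundary p q _) -/(bd _) ger0_norm ?bd_ge0//.
have := hT (maxn N K0) (leq_maxr _ _); have := @energy_ge0 (maxn N K0) T T0.
have := bd_ge0 (maxn N K0).
move: (energy _ _) (bd _) => E B B0 E0 h1; rewrite ltr_pdivlMr// => h2.
lra.
Qed.

(** Boxes are removed one at a time from the last row, each removal being an edge covered by
    [gradient_cvg0]. *)
Lemma bs_sub_empty_cvg0 l : (fun s => v s l - v s empty_part) @ +oo --> (0 : R).
Proof.
have [n] := ubnP (psize l); elim: n l => // n ih l; rewrite ltnS => ln.
case E : (len l) => [|m].
  rewrite (len0_empty E); under eq_fun do rewrite subrr; exact: cvg_cst.
have hR : canR l m.
  have /eqP h0 : l m.+1 == 0%N by rewrite -len_le E.
  by rewrite /canR h0 lt0n -len_le E ltnn.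
have hL := canL_remp hR.
have -> : (fun s => v s l - v s empty_part) =
    (fun s => (v s (addp (remp l m) m) - v s (remp l m)) + (v s (remp l m) - v s empty_part)).
  by apply/funext => s; rewrite rempK// addrA subrK.
rewrite -[0]addr0; apply: cvgD; first exact: gradient_cvg0.
apply: ih; have := psize_addp hL; rewrite rempK// => e.
by apply: leq_trans ln; rewrite e.
Qed.

(** All values approach the value at the empty partition, and the conserved total of [pi * v] is 1,
    so that value must approach the inverse of the total mass of [pi]. *)
Theorem bs_equilibrium l : v^~ l @ +oo --> euler_product tau.
Proof.
suff h : v^~ empty_part @ +oo --> euler_product tau.
  have -> : v^~ l = (fun s => (v s l - v s empty_part) + v s empty_part).
    by apply/funext => s; rewrite subrK.
  by rewrite -[euler_product tau]add0r; apply: cvgD h; exact: bs_sub_empty_cvg0.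
have E0 := euler_gt0 tau0 tau1; set E := euler_product tau in E0 *.
suff h : (fun s => v s empty_part * E^-1) @ +oo --> (1 : R).
  have -> : v^~ empty_part = (fun s => (v s empty_part * E^-1) * E).
    by apply/funext => s; rewrite divfK// gt_eqF.
  by rewrite -[X in _ --> X]mul1r; apply: cvgM => //; exact: cvg_cst.
apply/cvgrPdist_le => e e0.
have Zc := Zbox_cvg tau0 tau1; rewrite -/E in Zc.
(* Since [v <= 1], the part of the conserved total outside this fixed square is at most [e / 2] at
   every time. *)
have [K0 hK0] : exists K0, forall K, (K0 <= K)%N -> `|E^-1 - Zbox tau K.+1 K.+1| <= e / 4.
  have /cvgrPdist_le/(_ (e / 4)) := Zc; rewrite divr_gt0// => /(_ isT)[N _ hN].
  by exists N => K NK; apply: hN; exact: leqW.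
have massK (s : R) : 0 <= s -> `|mass K0 s - 1| <= e / 2.
  move=> s0.
  have hup K : (K0 <= K)%N -> mass K0 s <= mass K s <= mass K0 s + e / 2.
    move=> KK; rewrite /mass [in X in _ <= X <= _](@box_sub_sum _ _ K0.+1 K0.+1 K.+1 K.+1)// lerDl lerD2l.
    rewrite sumr_ge0/=; last by move=> l' _; rewrite mulr_ge0 ?v0.
    apply: (@le_trans _ _ (Zbox tau K.+1 K.+1 - Zbox tau K0.+1 K0.+1)).
      rewrite /Zbox (@box_sub_sum _ _ K0.+1 K0.+1 K.+1 K.+1)// [_ + _ - _]addrC addKr.
      by apply: ler_sum => l' _; rewrite ler_piMr ?v1// pi0.
    have := hK0 K KK; have := hK0 K0 (leqnn _); rewrite !ler_norml.
    by move=> /andP[? ?] /andP[? ?]; lra.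
  have bc : (fun K => 2 * bd K * s) @ \oo --> (0 : R).
    have := Zbox_diff_cvg tau0 tau1; rewrite -/tau => h.
    have -> : 0 = 2 * 0 * s :> R by rewrite mulr0 mul0r.
    by apply: cvgM; [apply: cvgM; [exact: cvg_cst|exact: h]|exact: cvg_cst].
  have key (d : R) : 0 < d -> `|mass K0 s - 1| <= e / 2 + d.
    move=> d0; have /cvgrPdist_le/(_ d d0)[N _ hN] := bc.
    have := hN (maxn N K0) (leq_maxl _ _); rewrite /= sub0r normrN => h1.
    have := mass_near1 (maxn N K0) s0; have /andP[h2 h3] := hup (maxn N K0) (leq_maxr _ _).
    move: h1; rewrite ger0_norm ?mulr_ge0 ?bd_ge0// => h1.
    rewrite !ler_norml => /andP[h4 h5]; apply/andP; split; lra.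
  by apply/ler_addgt0Pr => d d0; exact: key.
have dc : (fun s => mass K0 s - v s empty_part * Zbox tau K0.+1 K0.+1) @ +oo --> (0 : R).
  have -> : (fun s => mass K0 s - v s empty_part * Zbox tau K0.+1 K0.+1) =
      (fun s => \sum_(l' <- box K0.+1 K0.+1) pi l' * (v s l' - v s empty_part)).
    apply/funext => s; rewrite /mass /Zbox mulr_sumr -sumrB; apply: eq_bigr => l' _.
    by rewrite /pi; ring.
  elim: (box K0.+1 K0.+1) => [|a r ih].
    by under eq_fun do rewrite big_nil; exact: cvg_cst.
  under eq_fun do rewrite big_cons.
  have h : (fun s => pi a * (v s a - v s empty_part)) @ +oo --> (0 : R).
    rewrite -(mulr0 (pi a)); apply: cvgM; [exact: cvg_cst|exact: bs_sub_empty_cvg0].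
  by have := cvgD h ih; rewrite addr0 => hh; apply: hh.
have /cvgrPdist_le/(_ (e / 4)) := dc; rewrite divr_gt0// => /(_ isT) hd.
near=> s; have s0 : 0 <= s by near: s; apply: nbhs_pinfty_ge.
have : `|0 - (mass K0 s - v s empty_part * Zbox tau K0.+1 K0.+1)| <= e / 4 by near: s.
have := massK s s0; have := hK0 K0 (leqnn _).
have := v0 empty_part s0; have := v1 empty_part s0.
move: (Zbox _ _ _) (mass _ _) (v s _) => Z M V V1 V0 hZ hM hV.
have : `|V * E^-1 - V * Z| <= e / 4.
  by rewrite -mulrBr normrM (ger0_norm V0); apply: le_trans hZ; rewrite ler_piMl.
move: hM hV; rewrite !ler_norml => /andP[? ?] /andP[? ?] /andP[? ?].
by apply/andP; split; lra.
Unshelve. all: by end_near.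
Qed.

End equilibrium.

(** * A Lyapunov function *)

Section height.
Implicit Types (l : part) (y : int).

Lemma height_ex l y : exists n, (l n)%:Z + y <= n%:Z.
Proof.
exists (maxn (len l) `|y|%N); have : (len l <= maxn (len l) `|y|)%N by lia.
by rewrite len_le => /eqP ->; lia.
Qed.

(* The number of particles of the configuration [l] at sites at most [y]. *)
Definition height l y : nat := ex_minn (height_ex l y).

Lemma height_le l y n : (height l y <= n)%N = ((l n)%:Z + y <= n%:Z).
Proof.
rewrite /height; case: ex_minnP => m hm mmin; apply/idP/idP => [mn|/mmin//].
by have := part_le l mn; lia.
Qed.

Lemma height_gt l y n : (n < height l y)%N = (n%:Z < (l n)%:Z + y).
Proof. by rewrite ltnNge height_le -ltNge. Qed.

Lemma height_eq l y n : (l n)%:Z + y <= n%:Z ->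
  (n == 0%N) || ((n.-1)%:Z < (l n.-1)%:Z + y) -> height l y = n.
Proof.
move=> h1 h2; apply/eqP; rewrite eqn_leq height_le h1/=.
by case: n h1 h2 => //= n _ h2; rewrite height_gt.
Qed.

Lemma height_prev l y n : height l y = n.+1 -> n%:Z < (l n)%:Z + y.
Proof. by move=> h; rewrite -height_gt h. Qed.

Lemma height_at l y : (l (height l y))%:Z + y <= (height l y)%:Z.
Proof. by rewrite -height_le. Qed.

(** The particle [i+1] moves from site [i + 1 - l i] to [i - l i], so only the count at the latter
    site changes. *)
Lemma height_addp l i y : height (addp l i) y =
  (height l y + (canL l i && ((l i)%:Z + y == i%:Z)%R))%N.
Proof.
have h1 := height_at l y.
have h2 : (height l y == 0%N) || (((height l y).-1)%:Z < (l (height l y).-1)%:Z + y).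
  by case E : (height l y) => [//|n] /=; exact: height_prev.
move: (height l y) h1 h2 => n h1 h2.
case: (boolP (canL l i)) => [hL|/addp_id ->]; last by rewrite addn0; exact: height_eq.
case: (eqVneq ((l i)%:Z + y) i%:Z) => [e|ne] /=; last first.
  rewrite addn0; apply: height_eq; rewrite !addpE hL !andbT.
    by case: (eqVneq n i) h1 h2 => [->|_] h1 h2 /=; lia.
  by move: h2; case: (eqVneq n 0%N) => //= n0; lia.
have ni : n = i.
  have hi1 : (n <= i)%N.
    rewrite leqNgt; apply/negP => hin; case: n h1 h2 hin => //= n h1 h2 hin.
    have hh : (i <= n)%N by lia.
    by have := part_le l hh; lia.
  have [//|lt] : n = i \/ (n < i)%N by lia.
  have hh : (n <= i.-1)%N by lia.
  have := part_le l hh; move: hL; rewrite /canL; lia.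
subst n; rewrite addn1; apply: height_eq; rewrite !addpE hL !andbT.
  by have := pval_anti l i; case: eqP; lia.
by rewrite eqxx /=; lia.
Qed.

Lemma height_remp l i y : height (remp l i) y =
  (height l y - (canR l i && ((l i)%:Z + y == i.+1%:Z)%R))%N.
Proof.
case: (boolP (canR l i)) => [hR|/remp_id ->]; last by rewrite subn0.
have hL := canL_remp hR; have := height_addp (remp l i) i y.
rewrite rempK// hL /= => ->.
have -> : ((remp l i i)%:Z + y == i%:Z) = ((l i)%:Z + y == i.+1%:Z).
  by rewrite rempE eqxx hR /=; move: hR; rewrite /canR; lia.
by rewrite addnK.
Qed.

Lemma height_succ l y : height l (y + 1) =
  (height l y + ((l (height l y))%:Z + y == (height l y)%:Z)%R)%N.
Proof.
have h1 := height_at l y.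
have h2 : (height l y == 0%N) || (((height l y).-1)%:Z < (l (height l y).-1)%:Z + y).
  by case E : (height l y) => [//|n] /=; exact: height_prev.
move: (height l y) h1 h2 => n h1 h2.
case: eqP => e; rewrite ?addn0 ?addn1; apply: height_eq => //=.
- by have := pval_anti l n; lia.
- by lia.
- by lia.
- by move: h2; case: (n == 0%N) => //=; lia.
Qed.

Lemma height_pred l y : height l (y - 1) =
  (height l y - ((0 < height l y)%N && ((l (height l y).-1)%:Z + y == (height l y)%:Z)%R))%N.
Proof.
have h1 := height_at l y.
have h2 : (height l y == 0%N) || (((height l y).-1)%:Z < (l (height l y).-1)%:Z + y).
  by case E : (height l y) => [//|n] /=; exact: height_prev.
move: (height l y) h1 h2 => [|n] h1 h2 /=; first by rewrite sub0n; apply: height_eq => //; lia.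
rewrite /= in h2; case: eqP => e; rewrite ?subn0 ?subn1 /=; apply: height_eq => //=; last 2 first.
- by lia.
- by lia.
- by lia.
- by case: n h1 h2 e => //= n h1 h2 e; have := pval_anti l n; lia.
Qed.

End height.

Lemma absz_posD1 n : absz (Posz n + 1) = n.+1. Proof. lia. Qed.
Lemma posz_predn n : Posz n.+1 - 1 = Posz n. Proof. lia. Qed.
Lemma absz_negzD1 n : absz (Negz n + 1) = n. Proof. lia. Qed.
Lemma absz_negzB1 n : absz (Negz n - 1) = n.+2. Proof. lia. Qed.

(** Sites are enumerated by natural numbers so that summation by parts can be done by induction;
    [j.+1] below [K.*2.+1] covers the sites from [1 - K] to [K]. *)
Definition shifted (K j : nat) : int := j%:Z - K%:Z.

Lemma shifted_surj w y : exists2 j,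
  (j < ((w + `|y|).+1).*2)%N & shifted (w + `|y|).+1 j.+1 = y.
Proof. exists (absz (y + (w + `|y|)%N%:Z)); rewrite /shifted; lia. Qed.

Lemma absz_shifted_first K : (K <= absz (shifted K.+1 1))%N.
Proof. rewrite /shifted; lia. Qed.

Lemma absz_shifted_last K : (K <= absz (shifted K.+1 K.*2.+2))%N.
Proof. rewrite /shifted; lia. Qed.

Lemma shifted_SS K j : shifted K.+1 j.+2 = shifted K j.+1.
Proof. rewrite /shifted; lia. Qed.

Section lyapunov.
Context {R : realType} (p q : R).
Hypotheses (p0 : 0 < p) (pq : p < q) (pq1 : p + q = 1).
Let q0 : 0 < q. Proof. exact: lt_trans pq. Qed.
Let rho := q / p.
Let rho0 : 0 < rho. Proof. exact: divr_gt0. Qed.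
Let rho1 : 1 < rho. Proof. by rewrite ltr_pdivlMr// mul1r. Qed.
Let prho : p * rho = q. Proof. by rewrite /rho mulrC divfK// gt_eqF. Qed.
Implicit Types (l : part) (y : int).

Definition Qh l y : R := rho ^+ height l y.

Lemma gentE l y i n : height l y = n -> gent p q (Qh^~ y) l i =
  (i == n)%:R * (canL l n && ((l n)%:Z + y == n%:Z))%:R * ((q - p) * rho ^+ n) -
  (i.+1 == n)%:R * (canR l n.-1 && ((l n.-1)%:Z + y == n%:Z))%:R * ((q - p) * rho ^+ n).
Proof.
move=> hn; rewrite /gent /Qh height_addp height_remp hn.
have -> : (canL l i && ((l i)%:Z + y == i%:Z)) =
    (i == n) && (canL l n && ((l n)%:Z + y == n%:Z)).
  case: (eqVneq i n) => [->//|/eqP ne] /=; apply/negP => /andP[hL /eqP e]; apply: ne.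
  rewrite -hn; apply/esym/height_eq; first by lia.
  by move: hL; rewrite /canL; case: (eqVneq i 0%N) => //= i0; lia.
have -> : (canR l i && ((l i)%:Z + y == i.+1%:Z)) =
    (i.+1 == n) && (canR l n.-1 && ((l n.-1)%:Z + y == n%:Z)).
  case: (eqVneq i.+1 n) => [<-//|/eqP ne] /=; apply/negP => /andP[hR /eqP e]; apply: ne.
  rewrite -hn; apply/esym/height_eq => /=; last by lia.
  by move: hR; rewrite /canR; lia.
have h1 : p * (rho ^+ n.+1 - rho ^+ n) = (q - p) * rho ^+ n.
  by rewrite exprS mulrBr mulrA prho -mulrBl.
have h2 m : n = m.+1 -> q * (rho ^+ m - rho ^+ n) = - ((q - p) * rho ^+ n).
  by move=> ->; rewrite exprS -prho; ring.
case: (eqVneq i n) => [->|_] /=.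
  have -> /= : (n.+1 == n) = false by apply/negbTE; rewrite eqn_leq ltnn.
  rewrite subn0 subrr mulr0 addr0 mul0r mul0r subr0 mul1r.
  by case: (_ && _); rewrite ?addn1 ?addn0 ?subrr ?mulr0 ?mul0r ?mul1r.
rewrite addn0 subrr mulr0 add0r mul0r mul0r sub0r.
case: (eqVneq i.+1 n) => [e|_] /=; last by rewrite subn0 subrr mulr0 !mul0r oppr0.
rewrite mul1r; case: (_ && _); last by rewrite subn0 subrr mulr0 mul0r oppr0.
by rewrite mul1r; apply: h2; rewrite -e subn1.
Qed.

(** This is the Gärtner transform: an exponential of the height obeys a closed linear equation
    although the exclusion dynamics is not linear. It works because [p * rho = q]: only a particle
    crossing between [y] and [y + 1] matters, and all four occupations of these two sites give the
    same formula. *)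
Lemma gen_Qh l y : gen p q (Qh^~ y) l = p * Qh l (y + 1) + q * Qh l (y - 1) - Qh l y.
Proof.
have [n hn] : exists n, height l y = n by exists (height l y).
rewrite (@gen_wide _ _ _ _ _ (n + len l).+1); last by lia.
under eq_bigr do rewrite (gentE _ hn).
rewrite sumrB -!mulr_suml.
have -> : \sum_(i < (n + len l).+1) (i == n :> nat)%:R = 1 :> R.
  have nM : (n < (n + len l).+1)%N by lia.
  rewrite (bigD1 (Ordinal nM))//= eqxx big1 ?addr0// => i.
  by rewrite -val_eqE /= => /negPf ->.
have -> : \sum_(i < (n + len l).+1) (i.+1 == n)%:R = (0 < n)%:R :> R.
  case: (n) => [|m]; first by rewrite big1.
  have nM : (m < (m.+1 + len l).+1)%N by lia.
  rewrite (bigD1 (Ordinal nM))//= eqxx big1 ?addr0// => i.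
  by rewrite -val_eqE /= eqSS => /negPf ->.
have h1 := height_at l y; have h2 := height_succ l y; have h3 := height_pred l y.
have h4 : (0 < n)%N -> (n.-1)%:Z < (l n.-1)%:Z + y.
  by move: hn; case: (n) => //= m hn _; exact: height_prev.
rewrite /Qh h2 h3 hn {h2 h3}; rewrite hn in h1.
(* [A] says that site [y + 1] is occupied and [B] that site [y] is; exclusion allows a crossing only
   if exactly one of them holds. *)
pose A := (l n)%:Z + y == n%:Z; pose B := (0 < n)%N && ((l n.-1)%:Z + y == n%:Z).
have -> : canL l n && ((l n)%:Z + y == n%:Z) = A && ~~ B.
  rewrite /A /B /canL; case: (eqVneq n 0%N) => [->//=|n0]; first by rewrite andbT.
  rewrite lt0n n0 /=; have := pval_anti l n.-1; rewrite prednK ?lt0n//.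
  by case: eqP => //=; rewrite ?andbF ?andbT//; case: eqP => //=; lia.
have e : (0 < n)%:R * (canR l n.-1 && ((l n.-1)%:Z + y == n%:Z))%:R = (B && ~~ A)%:R :> R.
  rewrite /A /B /canR; case: (posnP n) => [->|n0]; first by rewrite mul0r.
  rewrite prednK// mul1r; congr (_ %:R); congr nat_of_bool; move: (h4 n0).
  have := pval_anti l n.-1; rewrite prednK//=.
  by case: eqP => //=; rewrite ?andbF ?andbT//; case: eqP => //=; lia.
rewrite e mul1r -/A -/B.
have e1 : p * rho ^+ n.+1 = q * rho ^+ n by rewrite exprS mulrA prho.
have hB : B -> q * rho ^+ (n - 1) = p * rho ^+ n.
  by rewrite /B => /andP[n0 _]; rewrite -{2}(prednK n0) exprS mulrA prho subn1.
have -> : p * rho ^+ (n + A) + q * rho ^+ (n - B) - rho ^+ n =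
    p * rho ^+ (n + A) + q * rho ^+ (n - B) - (p + q) * rho ^+ n by rewrite pq1 mul1r.
clear e; move: A B hB => A B hB; case: A; case: B hB => hB; rewrite /= ?addn1 ?addn0 ?subn0 ?e1 ?hB//; ring.
Qed.

(** For the step configuration this is the height at [y], so [M] below is [Qh] of the empty
    partition. *)
Definition pos_part y : nat := if y is Posz n then n else 0%N.
Let M y : R := rho ^+ pos_part y.

Lemma pos_part_le_height l y : (pos_part y <= height l y)%N.
Proof.
case: y => // n /=; rewrite leqNgt; apply/negP => h.
by have := height_at l n; lia.
Qed.

(** The subtracted profile solves the same linear equation except for a unit source of strength
    [q - p] at the corner of the step. *)
Let M_harmonic y : p * M (y + 1) + q * M (y - 1) - M y = (q - p) * (y == 0)%:R.
Proof.
case: y => [[|n]|n]; rewrite /M.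
- have -> : pos_part (Posz 0 + 1) = 1%N by [].
  have -> : pos_part (Posz 0 - 1) = 0%N by [].
  by rewrite /= !expr0 expr1 prho !mulr1 -[X in _ - X = _]pq1; ring.
- have -> : pos_part (Posz n.+1 + 1) = n.+2 by rewrite -PoszD addn1.
  rewrite posz_predn.
  have -> : (Posz n.+1 == 0) = false by [].
  rewrite /= mulr0 !exprS mulrA prho -[X in _ - X]mul1r -pq1.
  by rewrite -{2}prho; ring.
- have -> : pos_part (Negz n + 1) = 0%N by case: n.
  have -> : pos_part (Negz n - 1) = 0%N by case: n.
  by rewrite /= !expr0 !mulr1 pq1 subrr mulr0.
Qed.

Variable al : R.
Hypotheses (al1 : 1 < al) (al2 : al ^+ 2 <= rho).
Let al0 : 0 < al. Proof. exact: lt_trans al1. Qed.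

(** Dividing by [M] makes the two half-lines symmetric: on each of them the adjoint operator
    multiplies the weight by exactly [decay]. *)
Definition weight y : R := al ^+ `|y|%N / M y.
Definition decay := p * al + q / al - 1.

Let weight_ge0 y : 0 <= weight y.
Proof. by rewrite divr_ge0// exprn_ge0// ltW. Qed.

(** Equality holds off the origin. At the origin the outward weight is [al] on both sides, and
    [al ^+ 2 <= rho] is what turns [q * al / rho] into at most [q / al]. *)
Let weight_super y : p * weight (y - 1) + q * weight (y + 1) - weight y <= decay * weight y.
Proof.
have rq : q = p * rho by rewrite prho.
have al' : al != 0 by rewrite gt_eqF.
have rho' : rho != 0 by rewrite gt_eqF.
case: y => [[|n]|n]; rewrite /weight /decay /M.
- have -> : pos_part (Posz 0 + 1) = 1%N by [].
  have -> : pos_part (Posz 0 - 1) = 0%N by [].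
  have -> : absz (Posz 0 + 1) = 1%N by [].
  have -> : absz (Posz 0 - 1) = 1%N by [].
  rewrite /= !expr0 !expr1 !divr1 !mulr1 lerB// lerD2l ler_pM2l//.
  by rewrite ler_pdivrMr// mulrC ler_pdivlMr// -expr2.
- have -> : pos_part (Posz n.+1 + 1) = n.+2 by rewrite -PoszD addn1.
  rewrite posz_predn.
  rewrite absz_posD1.
  rewrite /= le_eqVlt; apply/orP; left; apply/eqP.
  rewrite !exprS {1 2}rq; field.
  by rewrite al' rho' expf_neq0.
- have -> : pos_part (Negz n + 1) = 0%N by case: n.
  have -> : pos_part (Negz n - 1) = 0%N by case: n.
  rewrite absz_negzD1.
  rewrite absz_negzB1.
  rewrite /= !expr0 !divr1 le_eqVlt; apply/orP; left; apply/eqP.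
  by rewrite !exprS; field.
Qed.

Definition Psi_term l y : R := weight y * (Qh l y - M y).

Lemma Psi_term_ge0 l y : 0 <= Psi_term l y.
Proof.
rewrite mulr_ge0// subr_ge0 /Qh /M ler_eXn2l//; exact: pos_part_le_height.
Qed.

Lemma height_right l n : (len l <= n)%N -> height l n = n.
Proof.
move=> h; apply: height_eq; first by move: h; rewrite len_le; lia.
by case: n h => //= n h; lia.
Qed.

Lemma height_left l y : (l 0%N)%:Z + y <= 0 -> height l y = 0%N.
Proof. by move=> h; exact: height_eq. Qed.

Lemma Qh_out l (K : nat) y : (width l <= K)%N -> (K <= `|y|)%N -> Qh l y = M y.
Proof.
rewrite /width => wK; case: y => n word_mass; rewrite /Qh.
  rewrite height_right//; apply: leq_trans word_mass; apply: leq_trans wK; exact: leq_addl.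
rewrite height_left//; rewrite NegzE subr_le0 lez_nat.
by apply: leq_trans word_mass; apply: leq_trans wK; exact: leq_addr.
Qed.

Lemma Psi_term_out l (K : nat) y : (width l <= K)%N -> (K <= `|y|)%N -> Psi_term l y = 0.
Proof. by move=> wK Ky; rewrite /Psi_term (Qh_out wK Ky) subrr mulr0. Qed.

Definition PsiK K l : R := \sum_(j < K.*2) Psi_term l (shifted K j.+1).

(** Terms at distance at least [width l] from the origin vanish, so this is the sum of [Psi_term]
    over all sites. *)
Definition Psi l := PsiK (width l) l.

Lemma PsiK_S K l : (width l <= K)%N -> PsiK K.+1 l = PsiK K l.
Proof.
move=> wK; rewrite /PsiK doubleS big_ord_recl big_ord_recr.
rewrite (Psi_term_out wK (absz_shifted_first K)) (Psi_term_out wK (absz_shifted_last K)).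
by rewrite add0r [LHS]addr0; apply: eq_bigr => i _; exact: congr1 (shifted_SS K i).
Qed.

Lemma PsiK_wide K l : (width l <= K)%N -> PsiK K l = Psi l.
Proof.
elim: K => [|K ih]; first by rewrite leqn0 /Psi => /eqP ->.
by rewrite leq_eqVlt => /predU1P[<-//|]; rewrite ltnS => h; rewrite PsiK_S ?ih.
Qed.

Lemma Psi_ge_term l y : Psi_term l y <= Psi l.
Proof.
pose K := (width l + `|y|).+1.
rewrite -(@PsiK_wide K) /PsiK; last by rewrite /K leqW// leq_addr.
have [j jK jy] := shifted_surj (width l) y.
rewrite (bigD1 (Ordinal jK))//= jy.
by rewrite lerDl sumr_ge0// => i _; exact: Psi_term_ge0.
Qed.

Lemma sum_by_parts (C D : nat -> R) n : D 0%N = 0 -> D 1%N = 0 -> D n = 0 -> D n.+1 = 0 ->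
  \sum_(j < n) C j.+1 * (p * D j.+2 + q * D j - D j.+1) =
  \sum_(j < n) (p * C j + q * C j.+2 - C j.+1) * D j.+1.
Proof.
move=> D0 D1 Dn Dn1.
suff h : \sum_(j < n) C j.+1 * (p * D j.+2 + q * D j - D j.+1) =
  \sum_(j < n) (p * C j + q * C j.+2 - C j.+1) * D j.+1 +
   (p * C n * D n.+1 - p * C 0%N * D 1%N - q * C n.+1 * D n + q * C 1%N * D 0%N).
  by rewrite h D0 D1 Dn Dn1 !mulr0 !subr0 addr0 addr0.
clear Dn Dn1; elim: n => [|n ih]; first by rewrite !big_ord0; ring.
by rewrite !big_ord_recr/= ih; ring.
Qed.

Lemma gen_sum (I : Type) (r : seq I) (F : I -> part -> R) l :
  gen p q (fun l => \sum_(i <- r) F i l) l = \sum_(i <- r) gen p q (F i) l.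
Proof.
elim: r => [|a r ih].
  by under eq_fun do rewrite big_nil; rewrite gen_cst big_nil.
by under eq_fun do rewrite big_cons; rewrite genD ih big_cons.
Qed.

Lemma eq_gen (f g : part -> R) l :
  f l = g l -> (forall i, f (addp l i) = g (addp l i)) ->
  (forall i, f (remp l i) = g (remp l i)) -> gen p q f l = gen p q g l.
Proof. by move=> h1 h2 h3; apply: eq_bigr => i _; rewrite /gent h1 h2 h3. Qed.

Lemma width_addp l i : (width (addp l i) <= (width l).+2)%N.
Proof.
rewrite /width addpE; have := len_addp_le i (leqnn (len l)).
by case: (_ && _); lia.
Qed.

Lemma width_remp l i : (width (remp l i) <= width l)%N.
Proof. by rewrite /width rempE; have := len_remp_le i (leqnn (len l)); lia. Qed.

(** The linear operator of [gen_Qh] is moved onto the weights by [sum_by_parts], where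
    [weight_super] applies; the constant is the source of [M_harmonic] at the origin, where the
    weight is 1. *)
Lemma gen_Psi l : gen p q Psi l <= decay * Psi l + (q - p).
Proof.
(* A single window must serve [l] and all its neighbours, and adding a box can raise the width by 2,
   when it is put into the empty partition. *)
pose K := (width l).+3.
have -> : gen p q Psi l = gen p q (PsiK K) l.
  apply: eq_gen => [|i|i]; rewrite PsiK_wide// /K.
  - by rewrite -addn3 leq_addr.
  - by apply: leq_trans (width_addp l i) _.
  - by apply: leq_trans (width_remp l i) _; rewrite -addn3 leq_addr.
rewrite gen_sum.
pose Dq y := Qh l y - M y.
pose D j := Dq (shifted K j); pose C j := weight (shifted K j).
have sS j : shifted K j.+1 + 1 = shifted K j.+2 by rewrite /shifted; lia.
have sP j : shifted K j.+1 - 1 = shifted K j by rewrite /shifted; lia.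
have -> : \sum_(j < K.*2) gen p q ((Psi_term)^~ (shifted K j.+1)) l =
   \sum_(j < K.*2) C j.+1 * (p * D j.+2 + q * D j - D j.+1) +
   \sum_(j < K.*2) C j.+1 * ((q - p) * (shifted K j.+1 == 0)%:R).
  rewrite -big_split/=; apply: eq_bigr => j _; rewrite /Psi_term genZ genB gen_cst subr0.
  by rewrite gen_Qh -M_harmonic -mulrDr; congr (_ * _); rewrite /D /Dq sS sP; ring.
apply: lerD.
  have D_out j : (width l <= absz (shifted K j))%N -> D j = 0.
    by move=> h; rewrite /D /Dq (Qh_out (leqnn _) h) subrr.
  rewrite sum_by_parts; last 4 first.
  - by apply: D_out; rewrite /shifted /K; lia.
  - by apply: D_out; rewrite /shifted /K; lia.
  - by apply: D_out; rewrite /shifted /K; lia.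
  - by apply: D_out; rewrite /shifted /K; lia.
  rewrite -(@PsiK_wide K) ?mulr_sumr; last by rewrite /K -addn3 leq_addr.
  apply: ler_sum => j _; rewrite /Psi_term -/(Dq _) -/(D _) mulrA ler_wpM2r//.
    by rewrite /D /Dq subr_ge0 /Qh /M ler_eXn2l//; exact: pos_part_le_height.
  by have := weight_super (shifted K j.+1); rewrite sS sP.
have KK : ((width l).+2 < K.*2)%N by rewrite /K; lia.
rewrite (bigD1 (Ordinal KK))//= [X in _ + X]big1 ?addr0; last first.
  move=> j; rewrite -val_eqE /= => jK; have -> : (shifted K j.+1 == 0) = false.
    apply/negP => /eqP h; move/eqP: jK; apply; move: h; rewrite /shifted /K /=; lia.
  by rewrite !mulr0.
by rewrite /C /shifted subrr /weight /M /= !expr0 divr1 mulr1 mul1r.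
Qed.

Lemma Psi_ge0 l : 0 <= Psi l.
Proof. by apply: sumr_ge0 => i _; exact: Psi_term_ge0. Qed.

(** One site is enough: a partition longer than [r] has excess height at [r], and one with first row
    longer than [r] has a particle at or below [- r]. *)
Lemma Psi_notin_box l r : l \notin box r r -> al ^+ r * (rho - 1) <= Psi l.
Proof.
have step h0 h1 (c : R) : (h0 < h1)%N -> 0 <= c -> c * rho ^+ h0 * (rho - 1) <= c * (rho ^+ h1 - rho ^+ h0).
  move=> hh c0; rewrite -mulrA ler_wpM2l// mulrBr mulr1 lerD2r -exprSr ler_eXn2l//.
have ale n : 0 <= al ^+ n by rewrite exprn_ge0// ltW.
rewrite mem_box negb_and -!ltnNge => /orP[h|h].
  apply: le_trans (Psi_ge_term l r%:Z); rewrite /Psi_term /weight /Qh /M /=.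
  have rr : rho ^+ r != 0 by rewrite expf_neq0// gt_eqF.
  have hh : (r < height l r%:Z)%N by rewrite height_gt; move: h; rewrite ltnNge len_le; lia.
  apply: le_trans (step _ _ (al ^+ r / rho ^+ r) hh _); first by rewrite divfK.
  by rewrite divr_ge0// exprn_ge0// ltW.
apply: le_trans (Psi_ge_term l (- r%:Z)); rewrite /Psi_term /weight /Qh /M.
have -> : pos_part (- r%:Z) = 0%N by case: (r).
have -> : absz (- r%:Z) = r by lia.
have hh : (0 < height l (- r%:Z))%N by rewrite height_gt; lia.
rewrite expr0 divr1; have := step _ _ (al ^+ r) hh (ale r).
by rewrite expr0 mulr1.
Qed.

(** The condition [l n <= k] keeps the height within [n + k] of the step profile at every site, so
    only the weight [al ^ |y|] grows with the box; the window contains [4 * L] sites. *)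
Lemma Psi_le n k L l : (l n <= k)%N -> l \in box L L ->
  Psi l <= (L.*2.*2)%:R * (rho ^+ (n + k) * al ^+ L).
Proof.
move=> ln; rewrite mem_box => /andP[lL l0].
have wL : (width l <= L.*2)%N by rewrite /width -addnn leq_add.
rewrite -(PsiK_wide wL) /PsiK -[X in _ <= X%:R * _]card_ord mulr_natl -sumr_const.
apply: ler_sum => j _; move: (shifted _ _) => y.
have c0 : 0 <= rho ^+ (n + k) * al ^+ L by rewrite mulr_ge0// exprn_ge0// ltW.
have [h|h] := leqP L `|y|.
  suff -> : Psi_term l y = 0 by [].
  rewrite /Psi_term (_ : Qh l y = M y) ?subrr ?mulr0// /Qh; case: y h => m h /=.
    by rewrite height_right// (leq_trans lL).
  by rewrite height_left//; rewrite NegzE subr_le0 lez_nat (leq_trans l0).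
rewrite /Psi_term /weight.
have hy : (height l y <= pos_part y + (n + k))%N.
  have a1 : (n <= pos_part y + (n + k))%N by lia.
  have := part_le l a1; rewrite height_le; case: y {h a1} => m /=; lia.
have M0 : M y != 0 by rewrite /M expf_neq0// gt_eqF.
apply: (@le_trans _ _ (al ^+ `|y| / M y * (M y * rho ^+ (n + k)))).
  rewrite ler_wpM2l ?weight_ge0// lerBlDr ler_wpDr// ?exprn_ge0 ?(ltW rho0)//.
  by rewrite /Qh /M -exprD ler_eXn2l.
rewrite mulrA divfK// mulrC ler_wpM2l ?exprn_ge0 ?(ltW rho0)//.
by rewrite ler_eXn2l// ltnW.
Qed.

End lyapunov.

(** * Uniform convergence in the bulk *)

Section bulk.
Context {R : realType} (p q : R) (v : R -> part -> R).
Hypotheses (p0 : 0 < p) (pq : p < q) (pq1 : p + q = 1).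
Hypothesis sol : backward_solution p q v.
Let q0 : 0 < q. Proof. exact: lt_trans pq. Qed.
Let rho := q / p.
Let rho1 : 1 < rho. Proof. by rewrite ltr_pdivlMr// mul1r. Qed.
Let E := euler_product (p / q).
Let E0 : 0 < E. Proof. by apply: euler_gt0; rewrite ?divr_gt0// ltr_pdivrMr// mul1r. Qed.

Lemma euler_le1 : E <= 1.
Proof.
have h := @bs_equilibrium _ p q v p0 pq pq1 sol empty_part.
rewrite /E -(cvg_lim _ h)//; apply: limr_le; first by apply/cvg_ex; exists E.
by near=> s; apply: (bs_le1 p0 pq sol); near: s; exact: nbhs_pinfty_ge.
Unshelve. all: by end_near.
Qed.

Variable al : R.
Hypotheses (al1 : 1 < al) (al2 : al ^+ 2 <= rho).
Let kap := decay p q al.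
Hypothesis kap0 : kap < 0.

(** Inside the box the discrepancy is at most [d] by hypothesis; outside it is at most 1, which
    [Psi / Z] dominates. The Lyapunov inequality makes the resulting envelope a supersolution above
    and a subsolution below. *)
Lemma bulk_estimate r (a d s : R) l : 0 <= a -> 0 <= d ->
  (forall l, l \in box r r -> `|v a l - E| <= d) -> 0 <= s ->
  `|v (a + s) l - E| <= d + (expR (kap * s) * Psi p q al l + (q - p) / - kap) / (al ^+ r * (rho - 1)).
Proof.
move=> a0 d0 hd s0.
have al0 : 0 < al by exact: lt_trans al1.
set Z := al ^+ r * (rho - 1).
have Z0 : 0 < Z by rewrite mulr_gt0 ?subr_gt0// exprn_gt0.
(* [G] is the level at which the drift bound [kap * Psi + (q - p)] vanishes; centring there leaves
   pure exponential decay. *)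
pose G := (q - p) / - kap.
have G0 : 0 < G by rewrite divr_gt0 ?oppr_gt0 ?subr_gt0.
have kG : kap * G = - (q - p) by rewrite /G; field; rewrite lt_eqF.
pose phi (s : R) l := expR (kap * s) * (Psi p q al l - G).
have dphi (x : R) l' : is_derive x 1 (phi^~ l') (kap * phi x l') by exact: is_derive_expRZ.
have gphi (x : R) l' : gen p q (phi x) l' <= kap * phi x l'.
  rewrite /phi genZ genB gen_cst subr0 mulrCA ler_pM2l ?expR_gt0// mulrBr kG opprK.
  exact: gen_Psi.
have phi_ge (x : R) l' : 0 <= x -> - G <= phi x l'.
  move=> x0; have P0 := Psi_ge0 p0 pq al1 l'.
  rewrite /phi mulrBr -[leLHS]add0r lerD ?mulr_ge0 ?expR_ge0// lerN2 ler_piMl ?(ltW G0)//.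
  by rewrite -expR0 ler_expR mulr_le0_ge0// ltW.
have Gle (x : R) l' : 0 <= x -> phi x l' + G <= expR (kap * x) * Psi p q al l' + G.
  by move=> x0; rewrite /phi mulrBr lerD2r gerBl mulr_ge0 ?expR_ge0// ltW.
have psi0 l' : phi 0 l' + G = Psi p q al l' by rewrite /phi mulr0 expR0 mul1r subrK.
have outb l' : l' \notin box r r -> 1 <= Psi p q al l' / Z.
  by move=> h; rewrite ler_pdivlMr// mul1r; exact: Psi_notin_box.
have dpsi (b c x : R) l' : is_derive x 1 (fun x => c + b * phi x l') (b * (kap * phi x l')).
  have := is_deriveD (is_derive_cst c x 1) (is_derive_cM b (dphi x l')).
  by rewrite add0r.
have gpsi (b c x : R) l' : gen p q (fun l => c + b * phi x l) l' = b * gen p q (phi x) l'.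
  by rewrite genD gen_cst add0r genZ.
have iZ0 : 0 < Z^-1 by rewrite invr_gt0.
have v0 := bs_ge0 sol; have v1 := bs_le1 p0 pq sol; have E1 := euler_le1.
apply: le_trans (_ : _ <= d + (phi s l + G) / Z) _; last first.
  by rewrite lerD2l ler_pM2r// Gle.
have eZ x l' : (phi x l' + G) / Z = Z^-1 * phi x l' + G / Z by ring.
have phiZ (x : R) l' : 0 <= x -> 0 <= Z^-1 * phi x l' + G / Z.
  by move=> x0; rewrite -eZ divr_ge0 ?(ltW Z0)//; have := phi_ge x l' x0; lra.
have in0 x : Z^-1 * phi 0 x + G / Z = Psi p q al x / Z by rewrite -eZ psi0.
rewrite eZ ler_norml; apply/andP; split.
  have := @bs_ge_sub _ p q v p0 pq sol a E (fun x l => (E - d - G / Z) + (- Z^-1) * phi x l)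
    (fun x l => (- Z^-1) * (kap * phi x l)) a0
    (fun x l => dpsi (- Z^-1) (E - d - G / Z) x l).
  move=> h; suff : (E - d - G / Z) + (- Z^-1) * phi s l <= v (a + s) l by rewrite mulNr; lra.
  apply: h => // x.
  - by move=> l' _; rewrite gpsi !mulNr lerN2 ler_pM2l.
  - by move=> l' x0; have := phiZ x l' x0; rewrite mulNr; lra.
  - have := in0 x; have := hd x; have := v0 a x a0; rewrite mulNr.
    case: (boolP (x \in box r r)) => [hx vx /(_ isT)|hx vx _].
      by rewrite ler_norml => /andP[? ?]; have := phiZ 0 x (lexx 0); lra.
    by have := outb x hx; lra.
have := @bs_le_super _ p q v p0 pq sol a (fun x l => (E + d + G / Z) + Z^-1 * phi x l)
    (fun x l => Z^-1 * (kap * phi x l)) a0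
    (fun x l => dpsi Z^-1 (E + d + G / Z) x l).
move=> h; suff : v (a + s) l <= (E + d + G / Z) + Z^-1 * phi s l by lra.
apply: h => // x.
- by move=> l' _; rewrite gpsi ler_pM2l.
- by move=> l' x0; have := phiZ x l' x0; have := E0; lra.
- have := in0 x; have := hd x; have := v1 a x a0.
  case: (boolP (x \in box r r)) => [hx vx /(_ isT)|hx vx _].
    by rewrite ler_norml => /andP[? ?]; have := phiZ 0 x (lexx 0); lra.
  by have := outb x hx; have := E0; lra.
Qed.
End bulk.

Lemma near_pinfty_scale {R : realType} (c : R) (A : set R) : 0 < c ->
  (\forall x \near +oo, A x) -> \forall s \near +oo, A (c * s).
Proof.
move=> c0 [M [Mr hM]]; exists (M / c); split; first by rewrite num_real.
by move=> x Mx; apply: hM; rewrite -ltr_pdivrMl// mulrC.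
Qed.

Lemma near_expRN_le {R : realType} (c C eta : R) : 0 < c -> 0 < C -> 0 < eta ->
  \forall s \near +oo, C * expR (- (c * s)) <= eta.
Proof.
move=> c0 C0 eta0; apply: (@near_pinfty_scale _ c (fun x => C * expR (- x) <= eta)) => //.
have /cvgrPdist_le/(_ (eta / C)) := @cvgr_expR R; rewrite divr_gt0// => /(_ isT).
apply: filterS => x; rewrite sub0r normrN ger0_norm ?expR_ge0// => h.
by rewrite mulrC -ler_pdivlMr.
Qed.

Lemma poly_le_expR {R : realType} (D m : nat) (c : R) : 0 < c -> exists2 C : R, 0 < C &
  forall x : R, 0 <= x -> (x + m%:R) ^+ D <= C * expR (c * x).
Proof.
move=> c0; case: D => [|D].
  by exists 1 => // x x0; rewrite expr0 mul1r -expR0 ler_expR mulr_ge0// ltW.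
exists ((D.+1)`!%:R / c ^+ D.+1 * expR (c * m%:R)).
  by rewrite mulr_gt0 ?expR_gt0// divr_gt0 ?exprn_gt0// ltr0n fact_gt0.
move=> x x0; rewrite -[leRHS]mulrA -expRD -mulrDr [m%:R + x]addrC.
have y0 : 0 <= x + m%:R by rewrite addr_ge0.
have := expR_ge1Dxn D (mulr_ge0 (ltW c0) y0).
have f0 : 0 < (D.+1)`!%:R :> R by rewrite ltr0n fact_gt0.
rewrite mulrAC ler_pdivlMr ?exprn_gt0// => h.
have h2 : (c * (x + m%:R)) ^+ D.+1 / (D.+1)`!%:R <= expR (c * (x + m%:R)) by lra.
by move: h2; rewrite ler_pdivrMr// -exprMn [_ * c]mulrC [_ * expR _]mulrC.
Qed.

Lemma onepDx_expR {R : realType} (a : R) (L : nat) : 0 <= a -> (1 + a) ^+ L <= expR (a * L%:R).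
Proof.
by move=> a0; rewrite expRM_natr lerXn2r ?nnegrE ?expR_ge0 ?expR_ge1Dx// addr_ge0.
Qed.

Lemma bernoulli_ineq {R : realType} (a : R) (r : nat) : 0 <= a -> 1 + r%:R * a <= (1 + a) ^+ r.
Proof.
move=> a0; elim: r => [|r ih]; first by rewrite mul0r addr0 expr0.
rewrite exprS -natr1; have : (1 + a) * (1 + r%:R * a) <= (1 + a) * (1 + a) ^+ r.
  by rewrite ler_wpM2l// addr_ge0.
by have : 0 <= r%:R * a * a :> R; [rewrite !mulr_ge0|lra].
Qed.

Section bulk_uniform.
Context {R : realType} (p q : R) (v : R -> part -> R).
Hypotheses (p0 : 0 < p) (pq : p < q) (pq1 : p + q = 1).
Hypothesis sol : backward_solution p q v.
Let q0 : 0 < q. Proof. exact: lt_trans pq. Qed.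
Let q1 : q <= 1. Proof. by rewrite -pq1 lerDr ltW. Qed.
Let gam := q - p.
Let gam0 : 0 < gam. Proof. by rewrite subr_gt0. Qed.
Let rho := q / p.
Let rho1 : 1 < rho. Proof. by rewrite ltr_pdivlMr// mul1r. Qed.
Let E := euler_product (p / q).

Lemma bulk_uniform (n k : nat) (eps del : R) : 0 < eps -> eps < 1 -> 0 < del ->
  \forall s \near +oo, forall L (l : part), (l n <= k)%N -> l \in box L L ->
    L%:R <= (1 - eps) * (gam * s) -> `|v s l - E| <= del.
Proof.
move=> e0 e1 d0.
(* The last two bounds give [(1 + a) ^+ 2 <= 1 + 3 * a <= rho]; the first makes the quadratic error
   in [kap] at most half of the gain [a * (eps * gam)]. *)
pose a := Num.min (eps * gam / 2) (Num.min 1 ((rho - 1) / 3)).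
have a0 : 0 < a.
  have h1 : 0 < eps * gam / 2 by rewrite divr_gt0// mulr_gt0.
  have h2 : 0 < (rho - 1) / 3 by rewrite divr_gt0// subr_gt0.
  by rewrite /a !lt_min h1 h2 ltr01.
have a1 : a <= eps * gam / 2 by rewrite ge_min lexx.
have a2 : a <= 1 by rewrite /a !ge_min lexx orbT.
have a3 : a <= (rho - 1) / 3 by rewrite /a !ge_min lexx !orbT.
pose al := 1 + a.
have al1 : 1 < al by rewrite ltrDl.
have al2 : al ^+ 2 <= rho by rewrite expr2 /al; nra.
pose kap := decay p q al.
have kap_le : kap <= - (gam * a) + a ^+ 2.
  rewrite /kap /decay.
  have h : q / al <= q * (1 - a + a ^+ 2).
    rewrite ler_pM2l// /al invf_ple ?posrE//; last 2 first.
    - by rewrite addr_gt0.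
    - by rewrite expr2; nra.
    rewrite -div1r ler_pdivrMr; last by rewrite expr2; nra.
    by rewrite expr2; nra.
  have : q * a ^+ 2 <= a ^+ 2 by rewrite ler_piMl// exprn_ge0// ltW.
  by rewrite /al /gam; move: h pq1; lra.
have ega : eps * gam <= gam by rewrite ler_piMl// ltW.
have [c c0 kc] : exists2 c, 0 < c & kap + (1 - eps) * gam * a <= - c.
  exists (a * (eps * gam) / 2); first by rewrite divr_gt0// mulr_gt0// mulr_gt0.
  by move: kap_le; rewrite expr2; nra.
have kap0 : kap < 0.
  have : 0 <= (1 - eps) * gam * a by rewrite !mulr_ge0 ?(ltW gam0) ?(ltW a0)//; lra.
  by lra.
pose G := (q - p) / - kap.
have G0 : 0 < G by rewrite divr_gt0 ?oppr_gt0.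
(* The term that does not decay in time is made small by the radius [r], via Bernoulli's inequality;
   only then is a time [t] chosen at which [v] has nearly converged on that box. *)
have [r hr] : exists r, G / (al ^+ r * (rho - 1)) <= del / 3.
  have r1 : 0 < rho - 1 by rewrite subr_gt0.
  exists (Num.truncn (3 * G / (del * (rho - 1)) / a)).+1.
  set r := _.+1.
  have hr : 3 * G / (del * (rho - 1)) <= r%:R * a.
    by rewrite -ler_pdivrMr// ltW// truncnS_gt.
  have hb : r%:R * a <= al ^+ r.
    by have := bernoulli_ineq r (ltW a0); rewrite -/al; lra.
  rewrite ler_pdivrMr ?mulr_gt0 ?exprn_gt0 ?(lt_trans _ al1)//.
  have dr : 0 < del * (rho - 1) by rewrite mulr_gt0.
  have : 3 * G <= al ^+ r * (del * (rho - 1)).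
    by rewrite -ler_pdivrMr//; exact: le_trans hr hb.
  by lra.
have r1 : 0 < rho - 1 by rewrite subr_gt0.
set Z := al ^+ r * (rho - 1) in hr.
have Z0 : 0 < Z by rewrite mulr_gt0// exprn_gt0// (lt_trans _ al1).
have [t t0 ht] : exists2 t : R, 0 < t & forall l, l \in box r r -> `|v t l - E| <= del / 3.
  suff : \forall t \near +oo, forall l, l \in box r r -> `|v t l - E| <= del / 3.
    by move=> h; have [t t0 ht] := pinfty_ex_gt0 h; exists t.
  elim: (box r r) => [|l0 b ih]; first by apply: nearW.
  have /cvgrPdist_le/(_ (del / 3)) := @bs_equilibrium _ p q v p0 pq pq1 sol l0.
  rewrite divr_gt0// => /(_ isT) h.
  near=> t => l; rewrite inE => /predU1P[->|lb]; first by rewrite distrC; near: t.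
  by move: l lb; near: t.
pose D := (n + k)%N.
pose C := expR (- kap * t) * (4 * gam * rho ^+ D) * (2 / c) / Z.
have C0 : 0 < C.
  apply: divr_gt0 => //; apply: mulr_gt0; last exact: divr_gt0.
  apply: mulr_gt0; first exact: expR_gt0.
  by apply: mulr_gt0; [exact: mulr_gt0|rewrite exprn_gt0// (lt_trans _ rho1)].
have c2 : 0 < c / 2 by rewrite divr_gt0.
near=> s => L l lk lB Ls.
have ts : t <= s by near: s; apply: nbhs_pinfty_ge; rewrite num_real.
have s0 : 0 <= s by rewrite (le_trans (ltW t0)).
have Cs : C * expR (- (c / 2 * s)) <= del / 3.
  by near: s; apply: near_expRN_le => //; exact: divr_gt0.
have st0 : 0 <= s - t by rewrite subr_ge0.
have d30 : 0 <= del / 3 by rewrite divr_ge0// ltW.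
have := bulk_estimate p0 pq pq1 sol al1 al2 kap0 l (ltW t0) d30 ht st0.
rewrite addrCA subrr addr0 => h; apply: le_trans h _.
rewrite -/kap -/rho -/Z mulrDl -/G.
suff : expR (kap * (s - t)) * Psi p q al l / Z <= del / 3 by move: hr; rewrite -/kap -/G; lra.
apply: (le_trans _ Cs); rewrite /C [leRHS]mulrAC ler_pM2r ?invr_gt0//.
have hP := Psi_le p0 pq al1 al2 lk lB.
apply: (@le_trans _ _ (expR (kap * (s - t)) * ((4 * (gam * s)) * (rho ^+ D * expR (a * ((1 - eps) * (gam * s))))))).
  rewrite ler_wpM2l ?expR_ge0//; apply: le_trans hP _.
  have rD : 0 <= rho ^+ D by rewrite exprn_ge0// ltW// (lt_trans _ rho1).
  have L4 : (L.*2.*2)%:R <= 4 * (gam * s).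
    have -> : (L.*2.*2)%:R = 4 * L%:R :> R by rewrite -!muln2 !natrM; ring.
    rewrite ler_pM2l//; apply: le_trans Ls _; rewrite ler_piMl ?mulr_ge0 ?(ltW gam0)//; lra.
  apply: ler_pM => //; first by rewrite mulr_ge0// exprn_ge0// (ltW (lt_trans _ al1)).
  rewrite ler_wpM2l//; apply: le_trans (onepDx_expR L (ltW a0)) _.
  by rewrite ler_expR ler_pM2l.
(* Half of the rate [c] is spent on absorbing the factor [s] that comes from the number of sites in
   the window. *)
have sexp : s <= 2 / c * expR (c / 2 * s).
  have := expR_ge1Dx (c / 2 * s) => h; have : c / 2 * s <= expR (c / 2 * s) by lra.
  by rewrite -ler_pdivlMl// invf_div.
have -> : expR (kap * (s - t)) * (4 * (gam * s) * (rho ^+ D * expR (a * ((1 - eps) * (gam * s))))) =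
  expR (- kap * t) * (4 * gam * rho ^+ D) * (s * expR ((kap + (1 - eps) * gam * a) * s)).
  have -> : kap * (s - t) = - kap * t + kap * s by ring.
  have -> : (kap + (1 - eps) * gam * a) * s = kap * s + a * ((1 - eps) * (gam * s)) by ring.
  by rewrite !expRD; ring.
rewrite -[leRHS]mulrA ler_pM2l; last first.
  by rewrite mulr_gt0 ?expR_gt0// mulr_gt0 ?mulr_gt0// exprn_gt0// (lt_trans _ rho1).
apply: (@le_trans _ _ (2 / c * expR (c / 2 * s) * expR (- c * s))).
  by apply: ler_pM => //; rewrite ?expR_ge0// ler_expR ler_wpM2r.
rewrite -mulrA -expRD ler_pM2l ?divr_gt0// ler_expR; lra.
Unshelve. all: by end_near.
Qed.
End bulk_uniform.

(** * Counting partitions *)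

Section counting.
Local Open Scope nat_scope.

Lemma size_box a b : size (box a b) = 'C(a + b, a).
Proof.
elim: a b => [|a iha] b; first by rewrite bin0.
elim: b => [|b ihb]; first by rewrite box_a0 addn0 binn.
by rewrite boxSS size_cat size_map ihb iha !addSn !addnS binS.
Qed.

Lemma bin_addr a k : 'C(a + k, a) = 'C(a + k, k).
Proof. by rewrite -(bin_sub (leq_addl a k)) addnK. Qed.

Definition cnt n k a b := count (fun l : part => l n <= k) (box a b).

Lemma cnt0_le k a b : cnt 0 k a b <= 'C(a + k, k).
Proof.
rewrite /cnt -size_filter -bin_addr -size_box.
apply: uniq_leq_size; first by rewrite filter_uniq// box_uniq.
by move=> l; rewrite mem_filter !mem_box => /andP[-> /andP[->]].
Qed.

Lemma cnt0_ge k a b : k <= b -> 'C(a + k, k) <= cnt 0 k a b.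
Proof.
move=> kb; rewrite /cnt -size_filter -bin_addr -size_box.
apply: uniq_leq_size; first by rewrite box_uniq.
by move=> l; rewrite mem_filter !mem_box => /andP[-> h]; rewrite h (leq_trans h).
Qed.

(** After the first row [c] has been fixed, the tail is any partition in [box a c], and the
    constrained row moves up by one. *)
Lemma cntS n k a b : cnt n.+1 k a.+1 b = \sum_(c < b.+1) cnt n k a c.
Proof.
rewrite /cnt boxS count_flatten sumnE !big_map -(big_mkord xpredT (fun c => count (fun l : part => l n <= k) (box a c))).
rewrite /index_iota subn0; apply: eq_bigr => c _; rewrite count_map.
apply: eq_in_count => l; rewrite mem_box => /andP[_ lc] /=.
by rewrite (minn_idPl _)// (leq_trans _ lc)// part_le.
Qed.

Lemma sum_bin n b : \sum_(c < b.+1) 'C(c + n, n) = 'C(b + n.+1, n.+1).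
Proof.
elim: b => [|b ih]; first by rewrite big_ord1 !add0n !binn.
by rewrite big_ord_recr/= ih [in RHS]addSn binS addSnnS.
Qed.

(** The first [n] rows and the remaining rows, the latter at most [k], are chosen separately;
    forgetting how they fit together gives an upper bound. *)
Lemma cnt_le n k a b : cnt n k (n + a) b <= 'C(a + k, k) * 'C(b + n, n).
Proof.
elim: n b => [|n ih] b; first by rewrite bin0 muln1 cnt0_le.
by rewrite addSn cntS -sum_bin big_distrr; apply: leq_sum.
Qed.

(** If the first [n] rows all have length at least [k], they fit above any choice of the remaining
    rows; the [k] extra columns make room for this. *)
Lemma cnt_ge n k a b : 'C(a + k, k) * 'C(b + n, n) <= cnt n k (n + a) (k + b).
Proof.
elim: n b => [|n ih] b; first by rewrite bin0 muln1 cnt0_ge// leq_addr.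
rewrite addSn cntS -sum_bin big_distrr -addnS big_split_ord/=.
by apply: leq_trans (leq_addl _ _); apply: leq_sum.
Qed.

Lemma leq_exp2l_base m n e : m <= n -> m ^ e <= n ^ e.
Proof. by move=> mn; case: e => // e; rewrite leq_exp2r. Qed.

Lemma ffact_le_exp m n : (m + n) ^_ n <= (m + n) ^ n.
Proof.
elim: n m => // n ih m; rewrite ffactnS expnS leq_mul2l -addSnnS /=.
by apply: leq_trans (ih _) _; apply: leq_exp2l_base; lia.
Qed.

Lemma ffact_ge_exp m n : m ^ n <= (m + n) ^_ n.
Proof.
elim: n => // n ih; rewrite addnS ffactSS expnS leq_mul//.
by rewrite leqW// leq_addr.
Qed.

Lemma cnt_diag_le n k L : n <= L -> n`! * k`! * cnt n k L L <= (L + (n + k)) ^ (n + k).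
Proof.
move=> nL; rewrite -{1}(subnKC nL); set a := L - n.
apply: leq_trans (leq_mul (leqnn _) (cnt_le n k a L)) _.
have -> : n`! * k`! * ('C(a + k, k) * 'C(L + n, n)) =
    ('C(L + n, n) * n`!) * ('C(a + k, k) * k`!) by lia.
rewrite !bin_ffact expnD; apply: leq_mul; apply: leq_trans (ffact_le_exp _ _) _;
  by apply: leq_exp2l_base; rewrite /a; lia.
Qed.

Lemma cnt_diag_ge n k L : n + k <= L -> (L - (n + k)) ^ (n + k) <= n`! * k`! * cnt n k L L.
Proof.
move=> DL.
have nL : n <= L by lia.
have kL : k <= L by lia.
rewrite -{2}(subnKC nL); set a := L - n; rewrite -{2}(subnKC kL); set b := L - k.
apply: leq_trans (leq_mul (leqnn _) (cnt_ge n k a b)).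
have -> : n`! * k`! * ('C(a + k, k) * 'C(b + n, n)) =
    ('C(b + n, n) * n`!) * ('C(a + k, k) * k`!) by lia.
rewrite !bin_ffact expnD; apply: leq_mul; apply: leq_trans (ffact_ge_exp _ _);
  by apply: leq_exp2l_base; rewrite /a /b; lia.
Qed.

End counting.

Lemma near_ge_scale {R : realType} (c x : R) : 0 < c -> \forall s \near +oo, x <= c * s.
Proof.
move=> c0; near=> s; rewrite mulrC -ler_pdivrMr//; by near: s; exact: nbhs_pinfty_ge.
Unshelve. all: by end_near.
Qed.

(** * Summing [v] over the partitions with [l n <= k] *)

Section sum_asymptotics.
Context {R : realType} (p q : R) (v : R -> part -> R).
Hypotheses (p0 : 0 < p) (pq : p < q) (pq1 : p + q = 1).
Hypothesis sol : backward_solution p q v.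
Let q0 : 0 < q. Proof. exact: lt_trans pq. Qed.
Let p1 : p <= 1. Proof. by rewrite -pq1 lerDl ltW. Qed.
Let gam := q - p.
Let gam0 : 0 < gam. Proof. by rewrite subr_gt0. Qed.
Let E := euler_product (p / q).
Let E0 : 0 < E. Proof. by apply: euler_gt0; rewrite ?divr_gt0// ltr_pdivrMr// mul1r. Qed.
Let v1 (s : R) l : 0 <= s -> v s l <= 1. Proof. exact: (bs_le1 p0 pq sol). Qed.
Let v0 (s : R) l : 0 <= s -> 0 <= v s l. Proof. exact: bs_ge0 sol _ _. Qed.

(** A Chernoff bound from [bs_tail_head] and [bs_tail_len]: near [b = 1] the growth rate [k] is
    about [gam * (1 - b)], so [expR (k * s) * b ^+ j] decays once [j] exceeds [gam * s] by a fixed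
    factor. *)
Lemma tail_estimate (eps : R) : 0 < eps -> exists2 c : R, 0 < c &
  forall (s : R) (l : part) (j : nat), 0 <= s -> (1 + eps) * (gam * s) <= j%:R ->
    (j <= len l)%N || (j <= l 0%N)%N -> v s l <= expR (- (c * j%:R)).
Proof.
move=> e0.
have e1 : 0 < 1 + eps by lra.
pose K := gam^-1 + (1 + eps).
have K0 : 0 < K by rewrite addr_gt0// invr_gt0.
(* [K] collects the coefficients of the two quadratic errors, in the growth rate and in the
   logarithm of [b]; the second bound lets them consume at most half of the linear gain. *)
pose be := Num.min (1 / 2) (eps / (2 * (1 + eps) * K)).
have be0 : 0 < be by rewrite lt_min !divr_gt0// !mulr_gt0.
have be2 : be <= 1 / 2 by rewrite ge_min lexx.
have beK : be * K <= eps / (2 * (1 + eps)).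
  apply: (@le_trans _ _ (eps / (2 * (1 + eps) * K) * K)).
    by rewrite ler_pM2r// ge_min lexx orbT.
  by rewrite invfM mulrA divfK// gt_eqF.
pose b := (1 + be)^-1.
have b0 : 0 < b by rewrite invr_gt0 addr_gt0.
have b1 : b < 1 by rewrite invf_lt1 ?ltrDl// addr_gt0.
have bup : b <= 1 - be + be ^+ 2.
  by rewrite /b -div1r ler_pdivrMr ?addr_gt0// expr2; nra.
have bexp : b <= expR (- be + be ^+ 2).
  by apply: le_trans bup _; apply: le_trans (expR_ge1Dx _); lra.
pose k := p * b + q / b - 1.
have k_le : k <= gam * be + be ^+ 2.
  rewrite /k /b invrK; have h := ler_wpM2l (ltW p0) bup.
  have h2 : p * be ^+ 2 <= be ^+ 2 by rewrite ler_piMl// exprn_ge0// ltW.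
  by move: h h2 pq1; rewrite /b /gam; lra.
exists (be * (eps / (2 * (1 + eps)))); first by rewrite mulr_gt0 ?divr_gt0// mulr_gt0.
move=> s l j s0 sj hl.
have vle : v s l <= expR (k * s) * b ^+ j.
  have bj n : (j <= n)%N -> expR (k * s) * b ^+ n <= expR (k * s) * b ^+ j.
    by move=> jn; rewrite ler_wpM2l ?expR_ge0// ler_wiXn2l// ltW.
  case/orP: hl => hl; apply: le_trans (bj _ hl).
    exact: (bs_tail_len p0 pq pq1 sol b0 b1).
  exact: (bs_tail_head p0 pq pq1 sol b0 b1).
apply: le_trans vle _.
apply: (@le_trans _ _ (expR (k * s) * expR ((- be + be ^+ 2) * j%:R))).
  by rewrite ler_wpM2l ?expR_ge0// expRM_natr lerXn2r ?nnegrE ?expR_ge0// ltW.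
rewrite -expRD ler_expR.
have gs : s <= j%:R / ((1 + eps) * gam).
  by rewrite ler_pdivlMr ?mulr_gt0//; move: sj; lra.
have h1 : k * s <= (gam * be + be ^+ 2) * (j%:R / ((1 + eps) * gam)).
  apply: (@le_trans _ _ ((gam * be + be ^+ 2) * s)); first by rewrite ler_wpM2r.
  by rewrite ler_wpM2l// addr_ge0 ?mulr_ge0 ?exprn_ge0 ?(ltW gam0) ?(ltW be0).
have eq1 : (gam * be + be ^+ 2) * (j%:R / ((1 + eps) * gam)) + (- be + be ^+ 2) * j%:R =
   j%:R * (be * ((be * K) / (1 + eps) - eps / (1 + eps))).
  rewrite /K; field; rewrite !gt_eqF//.
have j0 : 0 <= j%:R :> R by [].
apply: le_trans (lerD h1 (lexx _)) _; rewrite eq1.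
have -> : - (be * (eps / (2 * (1 + eps))) * j%:R) = j%:R * (be * - (eps / (2 * (1 + eps)))) by ring.
rewrite ler_wpM2l// ler_wpM2l ?(ltW be0)//.
have h3 : be * K / (1 + eps) <= eps / (2 * (1 + eps)).
  by apply: le_trans beK; rewrite ler_pdivrMr// ler_peMr ?mulr_ge0 ?(ltW be0) ?(ltW K0)//; lra.
have -> : eps / (1 + eps) = eps / (2 * (1 + eps)) + eps / (2 * (1 + eps)).
  by field; rewrite gt_eqF.
by lra.
Qed.

Definition tail_sum n k L (s : R) : R := \sum_(l <- box L L | (l n <= k)%N) v s l.

Lemma tail_sum_count n k a b : \sum_(l <- box a b | ((l : part) n <= k)%N) (1 : R) = (cnt n k a b)%:R.
Proof. by rewrite /cnt -sum1_count natr_sum. Qed.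

Lemma tail_sum_split n k L L' s : (L <= L')%N -> tail_sum n k L' s =
  tail_sum n k L s + \sum_(l <- box L' L' | l \notin box L L) (if (l n <= k)%N then v s l else 0).
Proof.
move=> LL; rewrite /tail_sum [LHS]big_mkcond [X in _ = X + _]big_mkcond/=; exact: box_sub_sum.
Qed.

Lemma tail_sum_incr n k L L' s : 0 <= s -> (L <= L')%N -> tail_sum n k L s <= tail_sum n k L' s.
Proof.
move=> s0 LL; rewrite (@tail_sum_split n k L L')// lerDl sumr_ge0// => l _.
by case: ifP => // _; exact: v0.
Qed.

Lemma cnt_split n k L L' : (L <= L')%N -> (cnt n k L' L')%:R = (cnt n k L L)%:R +
  \sum_(l <- box L' L' | l \notin box L L) (if (l n <= k)%N then 1 else 0) :> R.
Proof.
move=> LL; rewrite -!tail_sum_count [LHS]big_mkcond [X in _ = X + _]big_mkcond/=; exact: box_sub_sum.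
Qed.

(** Layer by layer the number of partitions grows polynomially and is absorbed by half of the
    exponential decay, leaving a geometric series. *)
Lemma outer_sum n k (eps : R) : 0 < eps -> exists c C : R, [/\ 0 < c, 0 < C &
  forall (s : R) (L0 L : nat), 0 <= s -> (n <= L0)%N -> (1 + eps) * (gam * s) <= L0%:R ->
    (L0 <= L)%N -> tail_sum n k L s <= tail_sum n k L0 s + C * expR (- (c * L0%:R))].
Proof.
move=> e0; have [c c0 hc] := tail_estimate e0.
have c2 : 0 < c / 2 by rewrite divr_gt0.
have [C C0 hC] := @poly_le_expR R (n + k) (n + k) (c / 2) c2.
pose x := expR (- (c / 2)).
have x0 : 0 < x by exact: expR_gt0.
have x1 : x < 1 by rewrite /x expR_lt1 oppr_lt0.
exists (c / 2), (C / (1 - x)); split => //; first by rewrite divr_gt0// subr_gt0.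
move=> s L0 L s0 nL0 sL0 LL.
have xE m : expR (- (c / 2 * m%:R)) = x ^+ m by rewrite -mulNr expRM_natr.
suff h : tail_sum n k L s <= tail_sum n k L0 s + C / (1 - x) * (x ^+ L0 - x ^+ L).
  apply: le_trans h _; rewrite lerD2l xE ler_pM2l ?divr_gt0 ?subr_gt0//.
  by rewrite gerBl exprn_ge0// ltW.
elim: L LL => [|L ih]; first by rewrite leqn0 => /eqP ->; rewrite subrr mulr0 addr0.
rewrite leq_eqVlt => /predU1P[<-|]; first by rewrite subrr mulr0 addr0.
rewrite ltnS => LL; rewrite (@tail_sum_split n k L L.+1)//.
have hstep : \sum_(l <- box L.+1 L.+1 | l \notin box L L) (if (l n <= k)%N then v s l else 0) <=
    C * x ^+ L.+1.
  apply: (@le_trans _ _ ((cnt n k L.+1 L.+1)%:R * expR (- (c * L.+1%:R)))).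
    apply: (@le_trans _ _ (\sum_(l <- box L.+1 L.+1 | l \notin box L L)
       (if (l n <= k)%N then 1 else 0) * expR (- (c * L.+1%:R)))).
      apply: ler_sum => l; rewrite mem_box negb_and -!ltnNge => hl.
      case: ifP => _; last by rewrite mul0r.
      rewrite mul1r; apply: hc => //; apply: le_trans sL0 _; by rewrite ler_nat leqW.
    rewrite -mulr_suml ler_wpM2r ?expR_ge0// (@cnt_split n k L L.+1)// lerDr//.
  have hcnt : (cnt n k L.+1 L.+1)%:R <= C * expR (c / 2 * L.+1%:R).
    apply: le_trans (hC L.+1%:R (ler0n _ _)); rewrite -natrD -natrX ler_nat.
    apply: leq_trans (cnt_diag_le k (leq_trans nL0 (leqW LL))).
    by rewrite leq_pmull// muln_gt0 !fact_gt0.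
  apply: (@le_trans _ _ (C * expR (c / 2 * L.+1%:R) * expR (- (c * L.+1%:R)))).
    by rewrite ler_wpM2r ?expR_ge0.
  rewrite -mulrA -expRD -xE ler_pM2l// ler_expR.
  by lra.
apply: le_trans (lerD (ih LL) hstep) _; rewrite -addrA lerD2l.
have -> : x ^+ L0 - x ^+ L.+1 = (x ^+ L0 - x ^+ L) + x ^+ L * (1 - x) by rewrite exprSr; ring.
rewrite [leRHS]mulrDr lerD2l.
have -> : C / (1 - x) * (x ^+ L * (1 - x)) = C * x ^+ L by field; rewrite subr_eq0 gt_eqF.
by rewrite ler_pM2l// exprS ler_piMl ?exprn_ge0 ?(ltW x0)// ltW.
Qed.

Lemma pow_near1 (D : nat) (eta : R) : 0 < eta -> exists e : R, [/\ 0 < e, e < 1 / 2,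
  (1 + 2 * e) ^+ D <= 1 + eta & 1 - eta <= (1 - 2 * e) ^+ D].
Proof.
move=> eta0.
have h (a : R) : (fun e : R => (1 + a * e) ^+ D) @ (0 : R) --> (1 : R).
  have g : (fun e : R => 1 + a * e) @ (0 : R) --> (1 : R).
    have := cvgD (cvg_cst (1 : R)) (cvgM (cvg_cst a) (@cvg_id _ (nbhs (0 : R)))).
    by rewrite mulr0 addr0; apply.
  have := @exprn_continuous R D 1; rewrite /continuous_at expr1n => hx.
  exact: (cvg_comp _ _ g hx).
have /cvgrPdist_le/(_ eta eta0)[e1 /= e10 h1] := h 2.
have /cvgrPdist_le/(_ eta eta0)[e2 /= e20 h2] := h (-2).
pose e := Num.min (1 / 4) (Num.min (e1 / 2) (e2 / 2)).
have e0 : 0 < e by rewrite !lt_min !divr_gt0.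
have l0 : e <= 1 / 4 by rewrite ge_min lexx.
have l1 : e <= e1 / 2 by rewrite /e !ge_min lexx orbT.
have l2 : e <= e2 / 2 by rewrite /e !ge_min lexx !orbT.
exists e; split => //; first lra.
  have := h1 e; rewrite /ball/= sub0r normrN gtr0_norm// => /(_ ltac:(lra)).
  by rewrite ler_norml => /andP[]; lra.
have := h2 e; rewrite /ball/= sub0r normrN gtr0_norm// => /(_ ltac:(lra)).
by rewrite ler_norml mulNr => /andP[]; lra.
Qed.

(** The partial sums increase with [L], so a lower bound for some [L] and an upper bound for all [L]
    control the infinite sum without naming it. *)
Theorem tail_sum_asymptotics n k (eta : R) : 0 < eta -> \forall s \near +oo,
  (exists L, (E - eta) * (gam * s) ^+ (n + k) <= (n`! * k`!)%:R * tail_sum n k L s) /\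
  (forall L, (n`! * k`!)%:R * tail_sum n k L s <= (E + eta) * (gam * s) ^+ (n + k)).
Proof.
move=> eta0; pose D := (n + k)%N; pose F : R := (n`! * k`!)%:R.
have F0 : 0 < F by rewrite ltr0n muln_gt0 !fact_gt0.
(* The upper bound collects four errors of size [eta']: one from the bulk, two from the counts, one
   from the outer sum. *)
pose eta' := Num.min (eta / 8) (1 / 2).
have eta'0 : 0 < eta' by rewrite lt_min !divr_gt0.
have eta'1 : eta' <= eta / 8 by rewrite ge_min lexx.
have eta'2 : eta' <= 1 / 2 by rewrite ge_min lexx orbT.
have E1 : E <= 1 := euler_le1 p0 pq pq1 sol.
have [eps [eps0 eps1 epsU epsL]] := pow_near1 D eta'0.
have [c [C [c0 C0 hout]]] := outer_sum n k eps0.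
have eps2 : eps < 1 by lra.
near=> s.
have sbulk : forall L (l : part), (l n <= k)%N -> l \in box L L ->
    L%:R <= (1 - eps) * (gam * s) -> `|v s l - E| <= eta'.
  by near: s; exact: (bulk_uniform p0 pq pq1 sol).
have s1 : 1 <= gam * s by near: s; exact: near_ge_scale.
have sD : (D.+1%:R) / eps <= gam * s.
  by near: s; exact: near_ge_scale.
have sD2 : (D.+1%:R) / (1 - 2 * eps) <= gam * s.
  by near: s; exact: near_ge_scale.
have sexp : F * C * expR (- (c * gam * s)) <= eta'.
  by near: s; apply: near_expRN_le; rewrite ?mulr_gt0.
have s0 : 0 <= s by rewrite -(pmulr_rge0 _ gam0); lra.
set t := gam * s in sbulk s1 sD sD2 *.
have tD1 : 1 <= t ^+ D by rewrite exprn_ege1.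
have {}sD : D%:R + 1 <= eps * t.
  by move: sD; rewrite ler_pdivrMr// -natr1 [t * _]mulrC.
have {}sD2 : D%:R + 1 <= (1 - 2 * eps) * t.
  by move: sD2; rewrite ler_pdivrMr ?[t * _]mulrC -?natr1//; lra.
have t0 : 0 <= t by lra.
pose L1 := Num.truncn ((1 - eps) * t).
have e1t : 0 <= (1 - eps) * t by rewrite mulr_ge0//; lra.
have L1u : L1%:R <= (1 - eps) * t by rewrite /L1 truncn_le.
have L1l : (1 - eps) * t < L1%:R + 1 by rewrite natr1 truncnS_gt.
have DL1 : (D <= L1)%N.
  by rewrite -(ler_nat R); lra.
pose L2 := (Num.truncn ((1 + eps) * t)).+1.
have L2l : (1 + eps) * t <= L2%:R by rewrite ltW// truncnS_gt.
have L2u : L2%:R <= (1 + eps) * t + 1.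
  by rewrite -natr1 lerD2r truncn_le// mulr_ge0//; lra.
have L12 : (L1 <= L2)%N.
  by rewrite -(ler_nat R); apply: le_trans L1u (le_trans _ L2l); rewrite ler_pM2r; lra.
have e2t : 0 <= (1 - 2 * eps) * t by rewrite mulr_ge0//; lra.
have cntL1l : (1 - 2 * eps) ^+ D * t ^+ D <= F * (cnt n k L1 L1)%:R.
  rewrite -exprMn; apply: (@le_trans _ _ ((L1 - D)%:R ^+ D)); last first.
    by rewrite /F -natrM -natrX ler_nat; exact: cnt_diag_ge.
  by rewrite lerXn2r ?nnegrE// natrB//; lra.
have cntL1u : F * (cnt n k L1 L1)%:R <= t ^+ D.
  apply: (@le_trans _ _ ((L1 + D)%:R ^+ D)).
    rewrite /F -natrM -natrX ler_nat; apply: cnt_diag_le.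
    by apply: leq_trans DL1; exact: leq_addr.
  by rewrite lerXn2r ?nnegrE// natrD; lra.
have cntL2u : F * (cnt n k L2 L2)%:R <= (1 + 2 * eps) ^+ D * t ^+ D.
  rewrite -exprMn; apply: (@le_trans _ _ ((L2 + D)%:R ^+ D)).
    rewrite /F -natrM -natrX ler_nat; apply: cnt_diag_le.
    by apply: leq_trans L12; apply: leq_trans DL1; exact: leq_addr.
  by rewrite lerXn2r ?nnegrE//; [rewrite mulr_ge0//; lra|rewrite natrD; lra].
have [S1u S1l] : tail_sum n k L1 s <= (E + eta') * (cnt n k L1 L1)%:R /\
    (E - eta') * (cnt n k L1 L1)%:R <= tail_sum n k L1 s.
  rewrite -tail_sum_count !mulr_sumr /tail_sum; split; rewrite big_seq_cond [leRHS]big_seq_cond;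
    apply: ler_sum => l /andP[lB lk]; have := sbulk L1 l lk lB L1u;
    rewrite mulr1 ler_norml => /andP[h1 h2]; first by rewrite -lerBlDl.
  by rewrite -lerBrDl.
have xl : (1 - eta') * t ^+ D <= F * (cnt n k L1 L1)%:R.
  by apply: le_trans cntL1l; rewrite ler_pM2r// (lt_le_trans _ tD1).
have yu : F * (cnt n k L2 L2)%:R <= (1 + eta') * t ^+ D.
  by apply: le_trans cntL2u _; rewrite ler_pM2r// (lt_le_trans _ tD1).
split.
  exists L1; apply: le_trans (ler_wpM2l (ltW F0) S1l).
  rewrite mulrCA -/D; move: (F * _) (t ^+ D) xl cntL1u tD1 => x T xl xu T1.
  by have [h|h] := leP 0 (E - eta'); nra.
move=> L; pose L3 := maxn L L2.
apply: le_trans (ler_wpM2l (ltW F0) (tail_sum_incr n k s0 (leq_maxl L L2))) _.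
have nL2 : (n <= L2)%N by apply: leq_trans L12; apply: leq_trans DL1; exact: leq_addr.
apply: le_trans (ler_wpM2l (ltW F0) (hout s L2 _ s0 nL2 L2l (leq_maxr L L2))) _.
(* Across the front nothing is known beyond [v <= 1], but the layer between [L1] and [L2] contains
   only a small fraction of the partitions. *)
have h12 : tail_sum n k L2 s <= tail_sum n k L1 s + ((cnt n k L2 L2)%:R - (cnt n k L1 L1)%:R).
  rewrite (tail_sum_split n k s L12) lerD2l (cnt_split n k L12) [_ + _ - _]addrC addKr.
  by apply: ler_sum => l _; case: ifP => // _; exact: v1.
have hE : F * (C * expR (- (c * L2%:R))) <= eta' * t ^+ D.
  apply: (@le_trans _ _ eta'); last by rewrite ler_peMr// ltW.
  apply: (le_trans _ sexp); rewrite mulrA ler_pM2l ?mulr_gt0// ler_expR lerN2 -mulrA ler_pM2l//.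
  by apply: (le_trans _ L2l); have := mulr_ge0 (ltW eps0) t0; rewrite -/t; lra.
rewrite mulrDr; apply: le_trans (lerD (ler_wpM2l (ltW F0) h12) hE) _.
have S1u' := ler_wpM2l (ltW F0) S1u.
rewrite mulrDr; apply: le_trans (lerD (lerD S1u' (lexx _)) (lexx _)) _.
rewrite mulrCA mulrBr -/D.
move: (F * _) (F * _) (t ^+ D) xl cntL1u tD1 yu => x y T xl xu T1 yu.
have Ee : 0 <= E + eta' by rewrite addr_ge0 ?(ltW E0)// ltW.
have T0 : 0 <= T by rewrite (le_trans _ T1).
have h1 := ler_wpM2l Ee xu; have h2 := ler_wpM2r T0 eta'1.
have h3 := mulr_ge0 (ltW eta0) T0.
by lra.
Unshelve. all: by end_near.
Qed.

End sum_asymptotics.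

(** * Independent clocks *)

Section independence.
Context {R : realType} {d : measure_display} {Omega : measurableType d}
  (P : probability Omega R) (I : eqType) (J : set I) (F : I -> set_system Omega).
Hypothesis F_meas : forall i A, F i A -> measurable A.
Hypothesis F_setI : forall i, setI_closed (F i).
Hypothesis F_setT : forall i, F i setT.
Hypothesis indepF : mutually_independent P J F.

Definition others (i0 : I) : set_system Omega :=
  [set A | exists (s : seq I) (B : I -> set Omega),
    [/\ uniq s, forall i, i \in s -> [/\ J i, i != i0 & F i (B i)] &
        A = \bigcap_(i in [set` s]) B i]].

Lemma others_meas i0 A : others i0 A -> measurable A.
Proof.
move=> [s [B [us hB ->]]].
have fs : finite_set [set` s] by exact: finite_seq.
apply: fin_bigcap_measurable => // i /= si.
by have [_ _] := hB i si; exact: F_meas.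
Qed.

Lemma others_setI i0 : setI_closed (others i0).
Proof.
move=> _ _ [s1 [B1 [us1 h1 ->]]] [s2 [B2 [us2 h2 ->]]].
exists (undup (s1 ++ s2)), (fun i => (if i \in s1 then B1 i else setT) `&` (if i \in s2 then B2 i else setT)).
split; first exact: undup_uniq.
  move=> i; rewrite mem_undup mem_cat => /orP[] si.
    have [J1 n1 f1] := h1 i si; split => //; rewrite si; apply: F_setI => //.
    by case: ifP => // /h2[].
  have [J1 n1 f1] := h2 i si; split => //; rewrite si; apply: F_setI => //.
  by case: ifP => // /h1[].
apply/seteqP; split => [w [w1 w2] i /= _|w h].
  by split; case: ifP => // si; [exact: w1|exact: w2].
by split => i /= si; have := h i; rewrite /= mem_undup mem_cat si ?orbT => /(_ isT)[].
Qed.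

Lemma others_sub i0 i A : J i -> i != i0 -> F i A -> others i0 A.
Proof.
move=> Ji ni FA; exists [:: i], (fun=> A); split => //.
  by move=> j; rewrite inE => /eqP ->.
by apply/seteqP; split => [w h j //|w h]; exact: (h i (mem_head _ _)).
Qed.

(** Mutual independence gives the product formula on finite intersections, which form a pi-system;
    Dynkin's lemma extends it to the generated sigma-algebra. *)
Lemma indep_others i0 B : J i0 -> F i0 B -> forall A, <<s others i0 >> A ->
  P (A `&` B) = (P A * P B)%E.
Proof.
move=> Ji FB; have mB := F_meas FB.
have mS A : <<s others i0 >> A -> measurable A.
  by move=> h; apply: (smallest_sub (@sigma_algebra_measurable _ Omega) _ h) => X; exact: others_meas.
have finP (A : set Omega) : measurable A -> P A \is a fin_num by exact: fin_num_measure.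
pose T' := g_sigma_algebraType (others i0).
apply: (@dynkin_induction _ T' (others i0) (fun A => P (A `&` B) = (P A * P B)%E)) => //.
- exact: others_setI.
- by rewrite setTI probability_setT mul1e.
- move=> _ [s [C [us hC ->]]].
  pose C' i := if i == i0 then B else C i.
  have ns : i0 \notin s by apply/negP => /hC[_]; rewrite eqxx.
  have := indepF (s := i0 :: s) (A := C'); rewrite /= ns us => /(_ isT).
  have h1 : forall i, i \in i0 :: s -> J i /\ F i (C' i).
    move=> i; rewrite inE /C'; case: eqVneq => [->//|ne] /= /hC[]; by split.
  have := indepF us (fun i si => let: And3 a _ c := hC i si in conj a c).
  move=> e0 /(_ h1); rewrite big_cons /C' eqxx => e1.
  rewrite e0 muleC -[X in (_ * X)%E](_ : (\prod_(j <- s) P (if j == i0 then B else C j))%E = _); last first.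
    by apply: eq_big_seq => j js; case: eqP => // ji; move: ns; rewrite -ji js.
  rewrite -e1; congr (P _); apply/seteqP; split => [w [w1 w2] i|w h] /=.
    by rewrite inE; case: eqP => //= _; exact: w1.
  split; last by have := h i0 (mem_head _ _); rewrite /= eqxx.
  move=> i si; have := h i; rewrite /= inE si orbT => /(_ isT).
  by case: eqP => // ji; move: ns; rewrite -ji si.
- move=> S mS' e; have {}mS' : measurable (S : set Omega) by exact: mS.
  have -> : ~` S `&` B = B `\` S by rewrite setDE setIC.
  rewrite measureD// ?probability_setC//; last by rewrite -ge0_fin_numE ?finP.
  have eS : P (B `&` S) = (P S * P B)%E by rewrite setIC.
  by rewrite [X in (_ - X)%E]eS muleBl ?mul1e ?finP// fin_num_adde_defl// fin_numN finP.
- move=> G mG tG hG; have mG2 n : measurable (G n : set Omega) by exact: mS (mG n).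
  rewrite setI_bigcupl measure_bigcup//; last 2 first.
  + by move=> n _; exact: measurableI.
  + exact: trivIset_setIr.
  rewrite (eq_eseriesr (g := fun n => ((fine (P B))%:E * P (G n))%E)); last first.
    by move=> n _; apply: etrans (hG n) _; rewrite fineK ?finP// muleC.
  rewrite nneseriesZl// fineK ?finP// [RHS]muleC; congr (_ * _)%E.
  by rewrite [RHS]measure_bigcup.
Qed.

Lemma others_generated_meas i0 A : <<s others i0 >> A -> measurable A.
Proof.
move=> h; apply: (smallest_sub (@sigma_algebra_measurable _ Omega) _ h) => X.
exact: others_meas.
Qed.

(* [Omega] with the sigma-algebra of all [F i] with [i != i0]: independence of
   [F i0] then says that the law of the pair (identity, Y) is a product. *)
Definition othersType (i0 : I) : measurableType (sigma_display (others i0)) :=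
  g_sigma_algebraType (others i0).

Definition to_others (i0 : I) (w : Omega) : othersType i0 := w.

Lemma measurable_to_others i0 : measurable_fun setT (to_others i0).
Proof. by move=> _ A mA; rewrite setTI; exact: others_generated_meas mA. Qed.

Section fubini.
Context {d' : measure_display} {E : measurableType d'} (i0 : I) (Y : {RV P >-> E}).
Hypotheses (Ji0 : J i0) (FY : F i0 = generated Y).

Definition pair_others (w : Omega) : (othersType i0 * E)%type := (to_others i0 w, Y w).

Lemma measurable_pair_others : measurable_fun setT pair_others.
Proof. by apply: measurable_fun_pair; [exact: measurable_to_others|exact: measurable_funPT]. Qed.

Let mto : {mfun Omega >-> othersType i0} :=
  mfun_Sub (mem_set (@measurable_to_others i0)).
Let mpair : {mfun Omega >-> (othersType i0 * E)%type} :=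
  mfun_Sub (mem_set measurable_pair_others).

Lemma integral_indep (f : (othersType i0 * E)%type -> \bar R) :
  measurable_fun setT f -> (forall x, 0 <= f x)%E ->
  (\int[P]_w f (to_others i0 w, Y w) = \int[P]_w \int[distribution P Y]_y f (to_others i0 w, y))%E.
Proof.
move=> mf f0.
pose P1 := distribution P mto.
have -> : (\int[P]_w f (to_others i0 w, Y w) = \int[distribution P mpair]_z f z)%E.
  by rewrite ge0_integral_distribution.
have hP : forall X, measurable X -> (P1 \x distribution P Y)%E X = distribution P mpair X.
  apply: product_measure_unique => A B mA mB.
  apply: (@indep_others i0 (Y @^-1` B) Ji0 _ A mA); rewrite FY /generated.
  by exists B => //; rewrite setTI.
have -> : (\int[distribution P mpair]_z f z = \int[(P1 \x distribution P Y)%E]_z f z)%E.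
  apply: eq_measure_integral => X mX _. exact: esym (hP _ mX).
rewrite fubini_tonelli1//.
by rewrite ge0_integral_distribution//; [exact: measurable_fun_fubini_tonelli_F|
  move=> x; exact: integral_ge0].
Qed.

End fubini.

End independence.

Lemma is_derive_continuous {R : realType} (f : R -> R) (x df : R) :
  is_derive x 1 f df -> f y @[y --> x] --> f x.
Proof.
by move=> [df' _]; apply: differentiable_continuous; apply/derivable1_diffP.
Qed.

Lemma measurable_bool_natr {d : measure_display} {T : measurableType d} {R : realType}
    (f : T -> bool) :
  measurable_fun setT f -> measurable_fun setT (fun x => (f x)%:R : R).
Proof.
move=> mf; have -> : (fun x => (f x)%:R) = (fun x => if f x then 1 else 0 : R).
  by apply/funext => x; case: (f x).
exact: measurable_fun_ifT.
Qed.

(** [g] has the same integrals over measurable sets as the Radon-Nikodym derivative, hence equals it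
    almost everywhere. *)
Lemma integral_density {d : measure_display} {T : measurableType d} {R : realType}
    (nu : {finite_measure set T -> \bar R}) (mu : {sigma_finite_measure set T -> \bar R})
    (g : T -> \bar R) :
  mu.-integrable setT g -> (forall A, measurable A -> nu A = (\int[mu]_(x in A) g x)%E) ->
  forall f : T -> \bar R, measurable_fun setT f -> (forall x, 0 <= f x)%E ->
  (\int[nu]_x f x = \int[mu]_x (f x * g x))%E.
Proof.
move=> ig nug f mf f0.
have mg := measurable_int _ ig.
have dom : nu `<< mu.
  apply/null_content_dominatesP => A mA A0; rewrite nug//.
  by apply: null_set_integral => //; exact: measurable_funTS.
rewrite -(Radon_Nikodym_SigmaFinite.change_of_variables dom)//.
have iRN := Radon_Nikodym_SigmaFinite.f_integrable dom.
apply: ae_eq_integral => //.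
- by apply: emeasurable_funM => //; exact: measurable_int iRN.
- exact: emeasurable_funM.
apply: ae_eqe_mul2l; apply: integral_ae_eq => //.
by move=> E _ mE; rewrite -Radon_Nikodym_SigmaFinite.f_integral// nug.
Qed.

(** * Integrals against the exponential law *)

Section exponential_integrals.
Context {R : realType} (nu : probability R R).
Hypothesis nuE : forall B : set R, measurable B -> nu B = exponential_prob 1 B.

Lemma integral_exponential (f : R -> \bar R) : measurable_fun setT f ->
  (forall x, 0 <= f x)%E ->
  (\int[nu]_x f x = \int[lebesgue_measure]_x (f x * (exponential_pdf 1 x)%:E))%E.
Proof.
have mid : @measurable_fun _ _ R (measurableTypeR R) setT id.
  by move=> _ A mA; rewrite setTI.
pose X : {RV nu >-> measurableTypeR R} := @mfun_Sub _ _ R (measurableTypeR R) _ (mem_set mid).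
move=> mf f0; transitivity (\int[distribution nu X]_x f x)%E.
  by rewrite ge0_integral_distribution.
apply: (@integral_density _ _ _ (distribution nu X) lebesgue_measure (EFin \o exponential_pdf 1)) => //.
exact: integrable_exponential_pdf.
Qed.

Let dF (x : R) : is_derive x 1 (fun x => - expR (- x)) (expR (- x)).
Proof.
have h : is_derive x 1 (fun x : R => - expR (- x)) (- (expR (- x) * (-1))).
  by apply: is_deriveN; apply: is_derive1_comp.
by rewrite mulrN1 opprK in h.
Qed.

Lemma integral_exponential_gt (r : R) : 0 <= r ->
  (\int[nu]_x ((r < x)%R%:R)%:E = (expR (- r))%:E)%E.
Proof.
move=> r0; rewrite integral_exponential//; last first.
  by apply/measurable_EFinP; apply: measurable_bool_natr; exact: measurable_fun_ltr.
transitivity (\int[lebesgue_measure]_(x in `]r, +oo[) (exponential_pdf 1 x)%:E)%E.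
  rewrite [RHS]integral_mkcond; apply: eq_integral => x _; rewrite patchE mem_setE in_itv/= andbT.
  by case: ifP => _; rewrite ?mul1e ?mul0e.
have mpdf D : measurable_fun D (EFin \o @exponential_pdf R 1).
  by apply/measurable_funTS/measurable_EFinP; exact: measurable_exponential_pdf.
rewrite integral_itv_obnd_cbnd//.
rewrite (@ge0_continuous_FTC2y _ _ (fun x => - expR (- x)) _ 0)//.
- by rewrite -EFinB sub0r opprK.
- by move=> x _; exact: exponential_pdf_ge0.
- apply: continuous_subspaceW (@within_continuous_exponential_pdf R 1).
  by apply: subset_itvr; rewrite bnd_simp.
- by rewrite -oppr0; apply: cvgN; exact: cvgr_expR.
- by apply: cvg_at_right_filter; exact: is_derive_continuous (dF r).
- move=> x; rewrite in_itv/= andbT => rx.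
  rewrite derive1E derive_val exponential_pdfE ?mul1r ?mulN1r ?mulrN1 ?opprK//.
  by rewrite (le_trans r0)// ltW.
Qed.

(** The two exponentials multiply to the constant [expR (- r)], leaving a polynomial to integrate.
    Iterated over the rings of a word this builds the simplex volume [s ^+ n / n!]. *)
Lemma integral_exponential_poly (a r : R) (k : nat) : 0 <= a ->
  (\int[nu]_x (((a < x) && (x <= r))%R%:R * ((r - x) ^+ k / k`!%:R * expR (- (r - x))))%:E =
   ((a <= r)%R%:R * ((r - a) ^+ k.+1 / k.+1`!%:R) * expR (- r))%:E)%E.
Proof.
move=> a0.
pose G (x : R) := - ((r - x) ^+ k.+1 / k.+1`!%:R * expR (- r)).
pose g (x : R) := (r - x) ^+ k / k`!%:R * expR (- r).
have dG (x : R) : is_derive x 1 G (g x).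
  have h0 : is_derive x 1 (fun y : R => r - y) (0 - 1).
    by apply: is_deriveB.
  have h1 := is_deriveX k.+1 h0.
  have h2 := is_deriveN (is_deriveZ (expR (- r) / k.+1`!%:R) h1).
  rewrite (_ : G = - ((expR (- r) / k.+1`!%:R) \*: ((fun y : R => r - y) ^+ k.+1))); last first.
    by apply/funext => y; rewrite /G /GRing.scale/= !fctE/=; congr (- _); rewrite [LHS]mulrC mulrA [RHS]mulrAC.
  rewrite (_ : g x = - ((expR (- r) / k.+1`!%:R) *: ((k.+1%:R * (r - x) ^+ k) *: (0 - 1))))//.
  rewrite /g /GRing.scale/= factS natrM.
  have k1 : k`!%:R != 0 :> R by rewrite pnatr_eq0 -lt0n fact_gt0.
  have k2 : k.+1%:R != 0 :> R by rewrite pnatr_eq0.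
  rewrite sub0r mulrN1 mulrN opprK invfM; set A := _ ^+ k.
  by move: k1 k2; move: (k.+1%:R : R) (k`!%:R : R) => B C nC nB; field; rewrite nC nB.
have cg : continuous g.
  move=> x; apply: cvgM; last exact: cvg_cst.
  apply: cvgM; last exact: cvg_cst.
  apply: (continuous_comp (f := fun y => r - y) (g := fun y => y ^+ k)); last exact: exprn_continuous.
  by apply: cvgB; [exact: cvg_cst|exact: cvg_id].
have mg : measurable_fun setT g by exact: continuous_measurable_fun.
have cG : continuous G.
  by move=> x; exact: is_derive_continuous (dG x).
rewrite integral_exponential; last 2 first.
- apply/measurable_EFinP; apply: measurable_funM.
    by apply: measurable_bool_natr; apply: measurable_and; [exact: measurable_fun_ltr|exact: measurable_fun_ler].
  have mrx : measurable_fun setT (fun x : R => r - x) by exact: measurable_funB.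
  apply: measurable_funM; last by apply: measurableT_comp => //; exact: measurable_funN.
  by apply: measurable_funM => //; exact: measurable_funX.
- move=> x; rewrite lee_fin; case: andP => [[_ xr]|_]; last by rewrite mul0r.
  by rewrite mul1r mulr_ge0 ?expR_ge0// divr_ge0 ?ler0n// exprn_ge0// subr_ge0.
transitivity (\int[lebesgue_measure]_(x in `]a, r]) (g x)%:E)%E.
  rewrite [RHS]integral_mkcond; apply: eq_integral => x _; rewrite patchE mem_setE in_itv/=.
  case: ifP => [/andP[ax xr]|_]; last by rewrite mul0r mul0e.
  rewrite mul1r exponential_pdfE; last by rewrite (le_trans a0)// ltW.
  have e : expR (- r) = expR (- (r - x)) * expR (- x) by rewrite -expRD; congr expR; lra.
  by rewrite -EFinM mul1r mulN1r /g e [in RHS]mulrA.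
have [ar|ar|->] := ltgtP a r; last 2 first.
- by rewrite set_itv_ge ?integral_set0 ?mul0r// bnd_simp -leNgt ltW.
- by rewrite set_itv_ge ?integral_set0 ?subrr ?expr0n ?mul0r ?mulr0 ?mul0r// bnd_simp ltxx.
rewrite integral_itv_obnd_cbnd; last by apply/measurable_funTS/measurable_EFinP.
rewrite (@continuous_FTC2 _ _ G)//.
- by rewrite /G -EFinB subrr expr0n/= !mul0r oppr0 sub0r opprK mul1r.
- exact: continuous_subspaceT.
- split; first by move=> x _; exact: ex_derive.
  + by apply: cvg_at_right_filter; exact: cG.
  + by apply: cvg_at_left_filter; exact: cG.
- by move=> x _; rewrite derive1E derive_val.
Qed.

Lemma exponential_lt0 : nu [set x | x < 0] = 0%E.
Proof.
have -> : [set x : R | x < 0] = `]-oo, 0[%classic by apply/seteqP; split => x /=; rewrite in_itv.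
rewrite nuE//; apply: integral0_eq => x /=; rewrite in_itv/= => x0.
by rewrite lt0_exponential_pdf.
Qed.

End exponential_integrals.

(* The letter [(i, e)] is a ring of particle [i+1], attempting a jump to the
   right if [e]. *)
Definition letter : eqType := (nat * bool)%type.

(** * Finite words recording the order of the rings *)

Section words.
Context {R : realType}.
Implicit Types (w : nat -> nat -> R) (b : nat -> nat -> bool) (rw : seq letter).

Definition occ (j : nat) rw : nat := count (fun x => x.1 == j) rw.

Definition ticks w (j n : nat) : R := \sum_(c < n) w j c.

Definition clk w (j : nat) rw : R := ticks w j (occ j rw).

Definition now w rw : R := if rw is x :: _ then clk w x.1 rw else 0.

(* Letters are in reverse chronological order: the head is the last ring. *)
Fixpoint follows w b rw : bool :=
  if rw is x :: rw' then
    [&& follows w b rw', now w rw' < clk w x.1 rw & b x.1 (occ x.1 rw') == x.2]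
  else true.

Lemma occ_cons j x rw : occ j (x :: rw) = ((x.1 == j) + occ j rw)%N.
Proof. by []. Qed.

Lemma occ_head x rw : occ x.1 (x :: rw) = (occ x.1 rw).+1.
Proof. by rewrite occ_cons eqxx. Qed.

Lemma occ_tail j x rw : j != x.1 -> occ j (x :: rw) = occ j rw.
Proof. by rewrite occ_cons eq_sym => /negbTE ->. Qed.

Lemma ticksS w j n : ticks w j n.+1 = ticks w j n + w j n.
Proof. by rewrite /ticks big_ord_recr. Qed.

Lemma follows_now_ge0 w b rw : follows w b rw -> 0 <= now w rw.
Proof.
elim: rw => [//|x rw IH] /= /and3P[/IH h lt _].
exact: le_trans h (ltW lt).
Qed.

Lemma follows_clk_le w b rw j : follows w b rw -> clk w j rw <= now w rw.
Proof.
elim: rw => [_|x rw IH]; first by rewrite /clk/= /ticks big_ord0.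
move=> /= /and3P[/IH h lt _]; have [->//|jx] := eqVneq j x.1.
by rewrite {1}/clk occ_tail//; exact: le_trans h (ltW lt).
Qed.

Lemma follows_clk_lt w b x rw j : follows w b (x :: rw) -> j != x.1 ->
  clk w j (x :: rw) < clk w x.1 (x :: rw).
Proof.
move=> /= /and3P[f lt _] jx; apply: le_lt_trans lt.
by rewrite {1}/clk occ_tail//; exact: follows_clk_le f.
Qed.

(** The last letter must belong to the particle whose recorded clock is latest, so the numbers of
    rings determine the word, letter by letter. *)
Lemma follows_inj w b rw1 rw2 : follows w b rw1 -> follows w b rw2 ->
  (forall j, occ j rw1 = occ j rw2) -> rw1 = rw2.
Proof.
elim: rw1 rw2 => [|x1 rw1 IH] [|x2 rw2]//.
- by move=> _ _ /(_ x2.1); rewrite occ_head.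
- by move=> _ _ /(_ x1.1); rewrite occ_head.
move=> f1 f2 e.
have e1 : x1.1 = x2.1.
  apply/eqP; apply: contraT => ne; have := follows_clk_lt f2 ne.
  rewrite eq_sym in ne; have := follows_clk_lt f1 ne.
  by rewrite /clk !e => lt1 lt2; have := lt_trans lt1 lt2; rewrite ltxx.
have {}e j : occ j rw1 = occ j rw2.
  by have := e j; rewrite !occ_cons e1 => /addnI.
move: f1 f2 => /= /and3P[f1 _ /eqP b1] /and3P[f2 _ /eqP b2].
rewrite (IH rw2)//; congr (_ :: _).
by case: x1 x2 e1 b1 b2 => [i1 c1] [i2 c2] /= -> <- <-; rewrite e.
Qed.

Definition upd {T : Type} (w : nat -> nat -> T) (i c : nat) (y : T) : nat -> nat -> T :=
  fun j k => if (j == i) && (k == c) then y else w j k.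

Lemma upd_id {T : Type} (w : nat -> nat -> T) i c : upd w i c (w i c) = w.
Proof.
by apply/funext => j; apply/funext => k; rewrite /upd; case: andP => [[/eqP -> /eqP ->]|].
Qed.

Lemma updE {T : Type} (w : nat -> nat -> T) i c y : upd w i c y i c = y.
Proof. by rewrite /upd !eqxx. Qed.

Lemma upd_lt {T : Type} (w : nat -> nat -> T) i c y j n : (j == i -> n <= c)%N ->
  forall k, (k < n)%N -> upd w i c y j k = w j k.
Proof.
move=> h k kn; rewrite /upd; case: ifP => // /andP[ji /eqP kc].
by have := h ji; rewrite leqNgt -kc kn.
Qed.

Lemma ticks_upd w i c y j n : (j == i -> n <= c)%N ->
  ticks (upd w i c y) j n = ticks w j n.
Proof. by move=> h; apply: eq_bigr => k _; exact: upd_lt h _ _. Qed.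

Lemma now_upd w i c y rw : (occ i rw <= c)%N -> now (upd w i c y) rw = now w rw.
Proof. by case: rw => [//|x rw] h; rewrite /now /clk ticks_upd// => /eqP ->. Qed.

(** A word reads only the entries that its own rings have consumed, so the next waiting time and
    direction of a particle are still fresh and can be integrated out. *)
Lemma follows_upd w b i c y e rw : (occ i rw <= c)%N ->
  follows (upd w i c y) (upd b i c e) rw = follows w b rw.
Proof.
elim: rw => [//|x rw IH] h /=.
have h' : (occ i rw <= c)%N by apply: leq_trans h; rewrite occ_cons leq_addl.
rewrite IH// now_upd// /clk ticks_upd; last by move=> /eqP ->.
by rewrite (@upd_lt _ b i c e x.1 (occ x.1 (x :: rw)))// ?occ_head// => /eqP e0; rewrite -occ_head e0.
Qed.

Lemma follows_updw w b i c y rw : (occ i rw <= c)%N ->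
  follows (upd w i c y) b rw = follows w b rw.
Proof. by move=> h; rewrite -{1}(upd_id b i c) follows_upd. Qed.

Lemma follows_updb w b i c e rw : (occ i rw <= c)%N ->
  follows w (upd b i c e) rw = follows w b rw.
Proof. by move=> h; rewrite -{1}(upd_id w i c) follows_upd. Qed.

Section measurability.
Context {d : measure_display} {T : measurableType d}
  (w : T -> nat -> nat -> R) (b : T -> nat -> nat -> bool).
Hypothesis mw : forall j c, measurable_fun setT (fun z => w z j c).
Hypothesis mb : forall j c, measurable_fun setT (fun z => b z j c).

Lemma measurable_ticks j n : measurable_fun setT (fun z => ticks (w z) j n).
Proof. by rewrite /ticks; apply: measurable_sum. Qed.

Lemma measurable_clk j rw : measurable_fun setT (fun z => clk (w z) j rw).
Proof. exact: measurable_ticks. Qed.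

Lemma measurable_now rw : measurable_fun setT (fun z => now (w z) rw).
Proof. by case: rw => [|x rw]; [exact: measurable_cst|exact: measurable_clk]. Qed.

Lemma measurable_follows rw : measurable_fun setT (fun z => follows (w z) (b z) rw).
Proof.
elim: rw => [|x rw IH] /=; first exact: measurable_cst.
apply: measurable_and => //; apply: measurable_and.
  by apply: measurable_fun_ltr; [exact: measurable_now|exact: measurable_clk].
have -> : (fun z => b z x.1 (occ x.1 rw) == x.2) =
   (fun z => if b z x.1 (occ x.1 rw) then x.2 else ~~ x.2).
  by apply/funext => z; case: (b _ _ _); case: x.2.
by apply: measurable_fun_ifT.
Qed.

End measurability.

End words.

Lemma generated_meas {d d' : measure_display} {Omega : measurableType d}
    {E : measurableType d'} (Y : Omega -> E) :
  measurable_fun setT Y -> forall A, generated Y A -> measurable A.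
Proof. by move=> mY A [B mB <-]; exact: mY. Qed.

Lemma generated_setI {d d' : measure_display} {Omega : measurableType d}
    {E : measurableType d'} (Y : Omega -> E) : setI_closed (generated Y).
Proof.
move=> _ _ [A mA <-] [B mB <-]; exists (A `&` B); first exact: measurableI.
by rewrite !setTI preimage_setI.
Qed.

Lemma generated_setT {d d' : measure_display} {Omega : measurableType d}
    {E : measurableType d'} (Y : Omega -> E) : generated Y setT.
Proof. by exists setT => //; rewrite setTI preimage_setT. Qed.

(* Quantifying over all spaces lets one entry of the arrays be replaced by an
   independent coordinate. *)
Definition meas_functional {R : realType} {dZ : measure_display} {Z : measurableType dZ}
    (Phi : (nat -> nat -> R) -> (nat -> nat -> bool) -> Z) : Prop :=
  forall (d : measure_display) (T : measurableType d)
    (w : T -> nat -> nat -> R) (b : T -> nat -> nat -> bool),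
    (forall j c, measurable_fun setT (fun z => w z j c)) ->
    (forall j c, measurable_fun setT (fun z => b z j c)) ->
    measurable_fun setT (fun z => Phi (w z) (b z)).

(** * The probability that a given word records all rings up to time [s] *)

Section clocks.
Context {R : realType} {d : measure_display} {Omega : measurableType d}
  (P : probability Omega R) (p : R)
  (W : nat -> nat -> {RV P >-> R}) (D : nat -> nat -> {RV P >-> bool}).
Hypothesis p01 : 0 <= p <= 1.
Hypothesis clocks : asep_clocks p W D.

Let J := [set i : (nat * nat) + (nat * nat) |
  match i with inl mk | inr mk => (0 < mk.1)%N end].
Let F (i : (nat * nat) + (nat * nat)) : set_system Omega :=
  match i with
  | inl mk => generated (W mk.1 mk.2)
  | inr mk => generated (D mk.1 mk.2)
  end.

Let F_meas i A : F i A -> measurable A.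
Proof. by case: i => mk; apply: generated_meas; exact: measurable_funPT. Qed.

Let F_setI i : setI_closed (F i).
Proof. by case: i => mk; exact: generated_setI. Qed.

Let F_setT i : F i setT.
Proof. by case: i => mk; exact: generated_setT. Qed.

Let indepF : mutually_independent P J F.
Proof. by case: clocks. Qed.

Let T_ := othersType J F.

Let mW i0 j k : i0 != inl (j.+1, k) ->
  measurable_fun setT (fun z : T_ i0 => W j.+1 k (z : Omega)).
Proof.
move=> ne _ B mB; rewrite setTI; apply: sub_sigma_algebra.
apply: (others_sub (i := inl (j.+1, k))) => //; first by rewrite eq_sym.
by exists B => //; rewrite setTI.
Qed.

Let mD i0 j k : i0 != inr (j.+1, k) ->
  measurable_fun setT (fun z : T_ i0 => D j.+1 k (z : Omega)).
Proof.
move=> ne _ B mB; rewrite setTI; apply: sub_sigma_algebra.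
apply: (others_sub (i := inr (j.+1, k))) => //; first by rewrite eq_sym.
by exists B => //; rewrite setTI.
Qed.

Definition waits (omega : Omega) (j c : nat) : R := W j.+1 c omega.
Definition dirs (omega : Omega) (j c : nat) : bool := D j.+1 c omega.

Lemma measurable_waits j c : measurable_fun setT (fun omega => waits omega j c).
Proof. exact: measurable_funPT. Qed.

Lemma measurable_dirs j c : measurable_fun setT (fun omega => dirs omega j c).
Proof. exact: measurable_funPT. Qed.

(** One waiting time is replaced by an independent coordinate and integrated first; the other
    entries are measurable for the sigma-algebra that omits it. *)
Lemma integral_wait (Phi : (nat -> nat -> R) -> (nat -> nat -> bool) -> R) i c :
  meas_functional Phi -> (forall w b, 0 <= Phi w b) ->
  (\int[P]_omega (Phi (waits omega) (dirs omega))%:E =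
   \int[P]_omega \int[distribution P (W i.+1 c)]_y
     (Phi (upd (waits omega) i c y) (dirs omega))%:E)%E.
Proof.
move=> mPhi Phi0.
pose i0 : (nat * nat) + (nat * nat) := inl (i.+1, c).
pose f (z : (T_ i0 * R)%type) : \bar R :=
  (Phi (upd (waits z.1) i c z.2) (dirs z.1))%:E.
have mf : measurable_fun setT f.
  apply/measurable_EFinP; apply: mPhi => j k.
    have [/andP[/eqP -> /eqP ->]|ne] := boolP ((j == i) && (k == c)).
      by rewrite (_ : (fun _ => _) = snd)//; apply/funext => z; rewrite updE.
    rewrite (_ : (fun _ => _) = (fun z : T_ i0 => W j.+1 k (z : Omega)) \o fst); last first.
      by apply/funext => z; rewrite /upd (negbTE ne).
    apply: measurableT_comp => //; apply: mW; apply: contra ne => /eqP [-> ->].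
    by rewrite !eqxx.
  rewrite (_ : (fun _ => _) = (fun z : T_ i0 => D j.+1 k (z : Omega)) \o fst)//.
  by apply: measurableT_comp => //; exact: mD.
have f0 z : (0 <= f z)%E by rewrite lee_fin.
have := @integral_indep _ _ _ P _ J F F_meas F_setI F_setT indepF _ _ i0 (W i.+1 c) isT erefl f mf f0.
rewrite /f => <-; apply: eq_integral => omega _ /=.
by rewrite -{1}(upd_id (waits omega) i c).
Qed.

Lemma integral_dir (Phi : (nat -> nat -> R) -> (nat -> nat -> bool) -> R) i c :
  meas_functional Phi -> (forall w b, 0 <= Phi w b) ->
  (\int[P]_omega (Phi (waits omega) (dirs omega))%:E =
   \int[P]_omega (p * Phi (waits omega) (upd (dirs omega) i c true) +
      (1 - p) * Phi (waits omega) (upd (dirs omega) i c false))%:E)%E.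
Proof.
move=> mPhi Phi0.
pose i0 : (nat * nat) + (nat * nat) := inr (i.+1, c).
pose f (z : (T_ i0 * bool)%type) : \bar R :=
  (Phi (waits z.1) (upd (dirs z.1) i c z.2))%:E.
have mf : measurable_fun setT f.
  apply/measurable_EFinP; apply: mPhi => j k.
    rewrite (_ : (fun _ => _) = (fun z : T_ i0 => W j.+1 k (z : Omega)) \o fst)//.
    by apply: measurableT_comp => //; exact: mW.
  have [/andP[/eqP -> /eqP ->]|ne] := boolP ((j == i) && (k == c)).
    by rewrite (_ : (fun _ => _) = snd)//; apply/funext => z; rewrite updE.
  rewrite (_ : (fun _ => _) = (fun z : T_ i0 => D j.+1 k (z : Omega)) \o fst); last first.
    by apply/funext => z; rewrite /upd (negbTE ne).
  apply: measurableT_comp => //; apply: mD; apply: contra ne => /eqP [-> ->].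
  by rewrite !eqxx.
have f0 z : (0 <= f z)%E by rewrite lee_fin.
have := @integral_indep _ _ _ P _ J F F_meas F_setI F_setT indepF _ _ i0 (D i.+1 c) isT erefl f mf f0.
rewrite /f /= => e; transitivity (\int[P]_omega
    (Phi (waits omega) (upd (dirs omega) i c (D i.+1 c omega)))%:E)%E.
  by apply: eq_integral => omega _; rewrite -{1}(upd_id (dirs omega) i c).
rewrite e; apply: eq_integral => omega _.
rewrite (eq_measure_integral (bernoulli_prob p)); last first.
  by move=> A mA _; case: clocks => _ + _; exact.
by rewrite integral_bernoulli_prob// => b; rewrite lee_fin.
Qed.

Definition letter_weight (x : letter) : R := if x.2 then p else 1 - p.

Variables (M : nat) (s : R).

Definition residual (m : nat) (w : nat -> nat -> R) (rw : seq letter) : R :=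
  \prod_(j < M) (if (j < m)%N then (s < clk w j rw + w j (occ j rw))%R%:R
                 else expR (- (s - clk w j rw))).

(* The integrand left after the last [k] rings of a word ending in [rw] have been
   integrated out; for [j >= m] the indicator that particle [j+1] does not ring
   again before [s] is replaced by its conditional probability. *)
Definition density (k m : nat) (rw : seq letter) (w : nat -> nat -> R)
    (b : nat -> nat -> bool) : R :=
  (follows w b rw && (now w rw <= s))%:R * ((s - now w rw) ^+ k / k`!%:R) *
  residual m w rw.

Let predensity (k : nat) (x : letter) (rw : seq letter) (w : nat -> nat -> R)
    (b : nat -> nat -> bool) : R :=
  ([&& follows w b rw, now w rw < clk w x.1 (x :: rw) & clk w x.1 (x :: rw) <= s])%:R *
  ((s - clk w x.1 (x :: rw)) ^+ k / k`!%:R) * residual 0 w (x :: rw).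

Lemma residual_ge0 m w rw : 0 <= residual m w rw.
Proof. by apply: prodr_ge0 => j _; case: ifP => _; rewrite ?ler0n ?expR_ge0. Qed.

Lemma density_ge0 k m rw w b : 0 <= density k m rw w b.
Proof.
rewrite /density mulr_ge0 ?residual_ge0//.
case: andP => [[_ h]|_]; rewrite ?mul0r// mul1r divr_ge0 ?ler0n//.
by rewrite exprn_ge0// subr_ge0.
Qed.

Let predensity_ge0 k x rw w b : 0 <= predensity k x rw w b.
Proof.
rewrite /predensity mulr_ge0 ?residual_ge0//.
case: and3P => [[_ _ h]|_]; rewrite ?mul0r// mul1r divr_ge0 ?ler0n//.
by rewrite exprn_ge0// subr_ge0.
Qed.

Lemma meas_residual m rw : meas_functional (fun w _ => residual m w rw).
Proof.
move=> dT T w b mw mb; rewrite /residual; apply: measurable_prod => j _; case: (j < m)%N.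
  apply: measurable_bool_natr; apply: measurable_fun_ltr => //.
  by apply: measurable_funD => //; exact: measurable_clk.
apply: measurableT_comp => //; apply: measurable_funN; apply: measurable_funB => //.
exact: measurable_clk.
Qed.

Lemma meas_density k m rw : meas_functional (density k m rw).
Proof.
move=> dT T w b mw mb; apply: measurable_funM; last exact: meas_residual mw mb.
apply: measurable_funM.
  apply: measurable_bool_natr; apply: measurable_and; first exact: measurable_follows.
  by apply: measurable_fun_ler => //; exact: measurable_now.
apply: measurable_funM => //; apply: measurable_funX; apply: measurable_funB => //.
exact: measurable_now.
Qed.

Let meas_predensity k x rw : meas_functional (predensity k x rw).
Proof.
move=> dT T w b mw mb; apply: measurable_funM; last exact: meas_residual mw mb.
apply: measurable_funM.
  apply: measurable_bool_natr; apply: measurable_and; first exact: measurable_follows.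
  apply: measurable_and.
    by apply: measurable_fun_ltr; [exact: measurable_now|exact: measurable_clk].
  by apply: measurable_fun_ler => //; exact: measurable_clk.
apply: measurable_funM => //; apply: measurable_funX; apply: measurable_funB => //.
exact: measurable_clk.
Qed.

Let nuE i c : forall B : set R, measurable B ->
  distribution P (W i.+1 c) B = exponential_prob 1 B.
Proof. by case: clocks => h _ _ B mB; exact: h. Qed.

Let integral_cM i c (C : R) (f : R -> R) : 0 <= C -> measurable_fun setT f ->
  (forall y, 0 <= f y) ->
  (\int[distribution P (W i.+1 c)]_y (C * f y)%:E =
   C%:E * \int[distribution P (W i.+1 c)]_y (f y)%:E)%E.
Proof.
move=> C0 mf f0; under eq_integral do rewrite EFinM.
by rewrite ge0_integralZl_EFin// ?lee_fin//; [move=> y _; rewrite lee_fin|exact/measurable_EFinP].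
Qed.

(** Integrates the first waiting time of particle [m+1] not consumed by the word: exceeding the
    remaining time [s - clk w m rw] has the exponential probability that [residual] stores. *)
Lemma integral_density_peel k m rw : (m < M)%N ->
  (\int[P]_omega (density k m.+1 rw (waits omega) (dirs omega))%:E =
   \int[P]_omega (density k m rw (waits omega) (dirs omega))%:E)%E.
Proof.
move=> mM; rewrite (integral_wait m (occ m rw) (@meas_density k m.+1 rw))//; last exact: density_ge0.
apply: eq_integral => omega _.
move: (waits omega) (dirs omega) => w b.
pose A : R := (follows w b rw && (now w rw <= s))%:R * ((s - now w rw) ^+ k / k`!%:R).
pose B : R := \prod_(j < M | j != Ordinal mM)
  (if (j < m)%N then (s < clk w j rw + w j (occ j rw))%R%:R
                 else expR (- (s - clk w j rw))).
have A0 : 0 <= A.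
  rewrite /A; case: andP => [[_ h]|_]; rewrite ?mul0r// mul1r divr_ge0 ?ler0n//.
  by rewrite exprn_ge0// subr_ge0.
have B0 : 0 <= B by apply: prodr_ge0 => j _; case: ifP => _; rewrite ?ler0n ?expR_ge0.
have -> : density k m rw w b = A * B * expR (- (s - clk w m rw)).
  rewrite /density -/A /residual (bigD1 (Ordinal mM))//= ltnn -/B; ring.
under eq_integral => y _.
  have -> : density k m.+1 rw (upd w m (occ m rw) y) b = A * B * (s - clk w m rw < y)%R%:R.
    rewrite /density follows_updw// now_upd// -/A -[RHS]mulrA; congr (_ * _).
    rewrite /residual (bigD1 (Ordinal mM))//= ltnSn mulrC updE /clk ticks_upd//.
    rewrite ltrBlDl; congr (_ * _); apply: eq_bigr => j jm.
    have {}jm : (j == m :> nat) = false by apply/negbTE.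
    rewrite ltnS leq_eqVlt jm /= ticks_upd ?jm//.
    by rewrite /upd jm.
  over.
rewrite integral_cM//; last 2 first.
- exact: mulr_ge0.
- by apply: measurable_bool_natr; exact: measurable_fun_ltr.
have [/andP[fw ns]|nf] := boolP (follows w b rw && (now w rw <= s)); last first.
  by rewrite /A (negbTE nf) !mul0r mul0e.
rewrite (integral_exponential_gt (nu := distribution P (W m.+1 (occ m rw))) (nuE _ _))//.
by rewrite subr_ge0 (le_trans _ ns)// (follows_clk_le m fw).
Qed.

(** The direction of the last ring gives the letter weight. Its waiting time then combines with the
    residual of the same particle: the exponentials merge into the residual of the shorter word, and
    the polynomial gains one degree. *)
Lemma integral_density_cons k x rw : (x.1 < M)%N ->
  (\int[P]_omega (density k 0 (x :: rw) (waits omega) (dirs omega))%:E =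
   (letter_weight x)%:E * \int[P]_omega (density k.+1 0 rw (waits omega) (dirs omega))%:E)%E.
Proof.
move=> iM; set i := x.1; set c := occ i rw.
have w0 : 0 <= letter_weight x.
  by case/andP: p01 => p0 p1; rewrite /letter_weight; case: ifP => // _; rewrite subr_ge0.
rewrite (integral_dir i c (@meas_density k 0 (x :: rw)))//; last exact: density_ge0.
transitivity (\int[P]_omega (letter_weight x * predensity k x rw (waits omega) (dirs omega))%:E)%E.
  apply: eq_integral => omega _; congr (_%:E).
  have dE e : density k 0 (x :: rw) (waits omega) (upd (dirs omega) i c e) =
      (e == x.2)%:R * predensity k x rw (waits omega) (dirs omega).
    rewrite /density/= follows_updb// updE /predensity -/i.
    by case: follows; case: (_ < _); case: (e == _); case: (_ <= _); rewrite /= ?mul0r ?mulr0 ?mul1r.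
  by rewrite !dE /letter_weight; case: (x.2); rewrite /= mul1r mul0r mulr0 ?addr0 ?add0r.
under eq_integral do rewrite EFinM.
have mpre : measurable_fun setT (fun omega =>
    (predensity k x rw (waits omega) (dirs omega))%:E).
  by apply/measurable_EFinP; apply: meas_predensity; [exact: measurable_waits|exact: measurable_dirs].
have pre0 omega : setT omega -> (0 <= (predensity k x rw (waits omega) (dirs omega))%:E)%E.
  by rewrite lee_fin.
rewrite (ge0_integralZl_EFin P measurableT pre0 mpre w0).
congr (_ * _)%E; rewrite (integral_wait i c (@meas_predensity k x rw))//.
apply: eq_integral => omega _.
move: (waits omega) (dirs omega) => w b.
pose B : R := \prod_(j < M | j != Ordinal iM) expR (- (s - clk w j rw)).
have B0 : 0 <= B by apply: prodr_ge0 => j _; exact: expR_ge0.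
(* The waiting time [y] of the last ring must exceed [a] to come after the preceding ring of any
   particle, and be at most [r] to happen by time [s]. *)
pose r := s - clk w i rw; pose a := now w rw - clk w i rw.
under eq_integral => y _.
  have -> : predensity k x rw (upd w i c y) b = ((follows w b rw)%:R * B) *
     (((a < y) && (y <= r))%R%:R * ((r - y) ^+ k / k`!%:R * expR (- (r - y)))).
    have eclk : clk (upd w i c y) i (x :: rw) = clk w i rw + y.
      by rewrite /clk /i occ_head ticksS updE ticks_upd.
    rewrite /predensity follows_updw// now_upd// -/i eclk /residual (bigD1 (Ordinal iM))//= eclk.
    rewrite (eq_bigr (fun j : 'I_M => expR (- (s - clk w j rw)))) -/B; last first.
      move=> j ji; have {}ji : (j == i :> nat) = false by apply/negbTE.
      by rewrite /clk ticks_upd ?ji// occ_tail// ji.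
    have -> : s - (clk w i rw + y) = r - y by rewrite /r; lra.
    have -> : (now w rw < clk w i rw + y) = (a < y) by rewrite /a ltrBlDl.
    have -> : (clk w i rw + y <= s) = (y <= r) by rewrite /r lerBrDl.
    move: ((r - y) ^+ k / k`!%:R) (expR (- (r - y))) => E1 E2.
    by case: (follows w b rw); case: (a < y); case: (y <= r); rewrite /=; ring.
  over.
have [fw|nf] := boolP (follows w b rw); last first.
  rewrite /density (negbTE nf) !mul0r.
  by under eq_integral do rewrite mul0r; rewrite integral0.
have a0 : 0 <= a by rewrite subr_ge0 (follows_clk_le i fw).
have mrx : measurable_fun setT (fun x : R => r - x) by exact: measurable_funB.
rewrite integral_cM//; last 3 first.
- by rewrite mulr_ge0.
- apply: measurable_funM.
    by apply: measurable_bool_natr; apply: measurable_and; [exact: measurable_fun_ltr|exact: measurable_fun_ler].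
  apply: measurable_funM; last by apply: measurableT_comp => //; exact: measurable_funN.
  by apply: measurable_funM => //; exact: measurable_funX.
- move=> y; case: andP => [[_ yr]|_]; last by rewrite mul0r.
  by rewrite mul1r mulr_ge0 ?expR_ge0// divr_ge0 ?ler0n// exprn_ge0// subr_ge0.
rewrite (integral_exponential_poly (nu := distribution P (W i.+1 c)) (nuE _ _))// -EFinM; congr (_%:E).
rewrite /density fw /residual (bigD1 (Ordinal iM))//= -/B -/r.
have -> : r - a = s - now w rw by rewrite /r /a; lra.
have -> : (a <= r) = (now w rw <= s) by rewrite /r /a lerD2r.
move: (_ ^+ k.+1 / _) (expR (- r)) => E1 E2.
by case: (_ <= _); rewrite /=; ring.
Qed.

Lemma integral_density_word k rw : 0 <= s -> all (fun x => x.1 < M)%N rw ->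
  (\int[P]_omega (density k 0 rw (waits omega) (dirs omega))%:E =
   ((\prod_(x <- rw) letter_weight x) * (s ^+ (k + size rw) / (k + size rw)`!%:R) *
     expR (- s) ^+ M)%:E)%E.
Proof.
move=> s0; elim: rw k => [|x rw IH] k.
  move=> _; under eq_integral => omega _.
    rewrite /density /= s0 mul1r subr0 /residual.
    under eq_bigr do rewrite /= /clk /ticks big_ord0 subr0.
    rewrite prodr_const card_ord; over.
  rewrite big_nil mul1r addn0 -[RHS]mule1 -(@probability_setT _ _ _ P).
  exact: integral_cst.
move=> /= /andP[xM aM]; rewrite integral_density_cons// IH// -EFinM; congr (_%:E).
by rewrite big_cons addnS -!mulrA.
Qed.

Definition word_event (rw : seq letter) : set Omega :=
  [set omega | [/\ follows (waits omega) (dirs omega) rw, now (waits omega) rw <= s &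
    forall j, (j < M)%N -> s < ticks (waits omega) j (occ j rw).+1]].

Let word_event_indic rw omega : density 0 M rw (waits omega) (dirs omega) =
  \1_(word_event rw) omega.
Proof.
rewrite indicE /density expr0 fact0 divr1 mulr1.
have [h|h] := boolP (omega \in word_event rw).
  move: h; rewrite inE => -[-> -> h] /=; rewrite mul1r /residual big1// => j _.
  by rewrite ltn_ord; have := h j (ltn_ord j); rewrite ticksS /clk => ->.
have [/andP[fw nw]|_] := boolP (_ && _); last by rewrite mul0r.
rewrite mul1r; apply/eqP; rewrite prodf_seq_eq0; apply/hasP.
apply: contrapT => h'; move: h; rewrite notin_setE; apply; split => // j jM.
rewrite ltNge; apply/negP => le; apply: h'; exists (Ordinal jM).
  by rewrite mem_index_enum.
by rewrite /= jM; move: le; rewrite ticksS leNgt => /negbTE ->.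
Qed.

Lemma word_event_measurable rw : measurable (word_event rw).
Proof.
have m1 : measurable_fun setT (fun omega => density 0 M rw (waits omega) (dirs omega)).
  by apply: meas_density; [exact: measurable_waits|exact: measurable_dirs].
have -> : word_event rw = setT `&` (fun omega => density 0 M rw (waits omega) (dirs omega)) @^-1` [set 1].
  rewrite setTI; apply/seteqP; split => omega /=; rewrite word_event_indic indicE.
    by move=> h; rewrite mem_set.
  by case: (boolP (omega \in _)) => [|_ /eqP]; rewrite ?inE// eq_sym oner_eq0.
exact: m1.
Qed.

(** All non-ringing conditions are integrated first, then the letters from the last to the first;
    the answer is that of a rate [M] Poisson process with independent marks. *)
Lemma word_event_prob rw : 0 <= s -> all (fun x => x.1 < M)%N rw ->
  P (word_event rw) = ((\prod_(x <- rw) letter_weight x) * (s ^+ size rw / (size rw)`!%:R) *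
     expR (- s) ^+ M)%:E.
Proof.
move=> s0 aM.
have -> : P (word_event rw) = (\int[P]_omega (density 0 M rw (waits omega) (dirs omega))%:E)%E.
  under eq_integral do rewrite word_event_indic.
  by rewrite integral_indic ?setIT//; exact: word_event_measurable.
have h m : (m <= M)%N -> (\int[P]_omega (density 0 m rw (waits omega) (dirs omega))%:E =
    \int[P]_omega (density 0 0 rw (waits omega) (dirs omega))%:E)%E.
  by elim: m => [//|m IH] mM; rewrite integral_density_peel// IH// ltnW.
by rewrite h// integral_density_word// add0n.
Qed.

End clocks.

(** * Words and the truncated system *)

Lemma cvgn_sum_seq {R : realType} {I : Type} (r : seq I) (f : nat -> I -> R) (g : I -> R) :
  (forall i, f n i @[n --> \oo] --> g i) ->
  \sum_(i <- r) f n i @[n --> \oo] --> \sum_(i <- r) g i.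
Proof.
move=> h; elim: r => [|i r IH].
  by rewrite big_nil; under eq_fun do rewrite big_nil; exact: cvg_cst.
by rewrite big_cons; under eq_fun do rewrite big_cons; exact: cvgD.
Qed.

Lemma gen_cvg {R : realType} (p q : R) (f : nat -> part -> R) (g : part -> R) (l : part) :
  (forall l', f n l' @[n --> \oo] --> g l') ->
  gen p q (f n) l @[n --> \oo] --> gen p q g l.
Proof.
move=> h; apply: cvgn_sum_seq => i; rewrite /gent.
by apply: cvgD; apply: cvgMl_tmp; apply: cvgB.
Qed.

Lemma gen_norm_le {R : realType} (p q : R) (f : part -> R) (l : part) (B : R) :
  0 <= p -> 0 <= q -> p + q = 1 ->
  (forall l', (len l' <= (len l).+1)%N -> `|f l'| <= B) ->
  `|gen p q f l| <= (2 * (len l).+1)%:R * B.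
Proof.
move=> p0 q0 pq h; rewrite /gen; apply: le_trans (ler_norm_sum _ _ _) _.
have -> : (2 * (len l).+1)%:R * B = \sum_(i < (len l).+1) (2 * B).
  by rewrite sumr_const card_ord -mulr_natl natrM; ring.
apply: ler_sum => i _; rewrite /gent.
have h0 := h l (leqnSn _).
have ha := h _ (@len_addp_le l i _ (leqnn _)).
have hr := h _ (leq_trans (@len_remp_le l i _ (leqnn _)) (leqnSn _)).
have -> : 2 * B = p * (2 * B) + q * (2 * B) by rewrite -mulrDl pq mul1r.
apply: le_trans (ler_normD _ _) _; rewrite !normrM (ger0_norm p0) (ger0_norm q0).
by apply: lerD; apply: ler_wpM2l => //; apply: le_trans (ler_normB _ _) _; lra.
Qed.

Section egf.
Context {R : realType}.

Definition egf (k : nat -> R) (s : R) : R := limn (pseries (fun n => k n / n`!%:R) s).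

Variables (B : R) (B0 : 0 <= B).
Implicit Types k : nat -> R.

Lemma egf_cvg k C s : (forall n, `|k n| <= C * B ^+ n) ->
  cvgn (pseries (fun n => k n / n`!%:R) s).
Proof.
move=> hk; apply: normed_cvg.
apply: (@series_le_cvg _ _ (fun n => C * exp_coeff (B * `|s|) n)).
- by move=> n; exact: normr_ge0.
- by move=> n; rewrite mulr_ge0//; [have := hk 0%N; rewrite expr0 mulr1; apply: le_trans|
    apply: exp_coeff_ge0; rewrite mulr_ge0].
- move=> n; rewrite /= normrM normf_div normrX /exp_coeff/= exprMn.
  rewrite [`|n`!%:R|]ger0_norm// mulrA mulrA mulrAC.
  by apply: ler_wpM2r; [rewrite invr_ge0|apply: ler_wpM2r => //; rewrite exprn_ge0].
- by apply: is_cvg_seriesZ; exact: is_cvg_series_exp_coeff.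
Qed.

Let egf_diffs k : pseries_diffs (fun n => k n / n`!%:R) = (fun n => k n.+1 / n`!%:R).
Proof.
apply/funext => n; rewrite /pseries_diffs factS natrM.
have n1 : n.+1%:R != 0 :> R by rewrite pnatr_eq0.
have n2 : n`!%:R != 0 :> R by rewrite pnatr_eq0 -lt0n fact_gt0.
by move: (n.+1%:R : R) (n`!%:R : R) n1 n2 => a b na nb; field; rewrite na nb.
Qed.

Lemma egf_derive k C (s : R) : (forall n, `|k n| <= C * B ^+ n) ->
  is_derive s 1 (egf k) (egf (fun n => k n.+1) s).
Proof.
move=> hk.
have hS k' C' : (forall n, `|k' n| <= C' * B ^+ n) -> (forall n, `|k' n.+1| <= (C' * B) * B ^+ n).
  by move=> h n; rewrite -mulrA -exprS.
have h1 := hS _ _ hk; have h2 := hS _ _ h1.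
rewrite /egf -(egf_diffs k).
apply: (@pseries_snd_diffs _ _ (`|s| + 1)) => /=.
- exact: egf_cvg hk.
- by rewrite egf_diffs; exact: egf_cvg h1.
- by rewrite egf_diffs (egf_diffs (fun n => k n.+1)); exact: egf_cvg h2.
- by rewrite (ger0_norm (_ : 0 <= `|s| + 1)) ?ltrDl// addr_ge0.
Qed.

End egf.

(** * Generating functions of words and the truncated equation *)

Section word_series.
Context {R : realType} (p q : R).
Hypotheses (p0 : 0 <= p) (q0 : 0 <= q) (pq1 : p + q = 1).

Definition step (l : part) (x : letter) : part :=
  if x.2 then remp l x.1 else addp l x.1.

Definition run (rw : seq letter) : part := foldr (fun x l => step l x) empty_part rw.

Definition letters (M : nat) : seq letter :=
  [seq (i, b) | i <- iota 0 M, b <- [:: true; false]].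

Fixpoint words (M n : nat) : seq (seq letter) :=
  if n is n'.+1 then [seq x :: rw | x <- letters M, rw <- words M n'] else [:: [::]].

Lemma words_uniq M n : uniq (words M n).
Proof.
elim: n => [//|n IH] /=; apply: allpairs_uniq => //.
  by apply: allpairs_uniq => //; [exact: iota_uniq|move=> [a b] [c e]].
by move=> [x r] [y r'] _ _ [-> ->].
Qed.

Lemma mem_words M n rw : rw \in words M n -> (size rw == n) && all (fun x => x.1 < M)%N rw.
Proof.
elim: n rw => [|n IH] rw /=; first by rewrite inE => /eqP ->.
move=> /allpairsP[[x r] /= [hx hr ->]] /=.
have /andP[/eqP -> ->] := IH r hr; rewrite eqxx andbT /=.
by move: hx => /allpairsP[[i b] /= [hi _ ->]] /=; rewrite mem_iota add0n in hi.
Qed.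

Definition word_weight (rw : seq letter) : R := \prod_(x <- rw) letter_weight p x.

Definition word_mass (M n : nat) (mu : part) : R :=
  \sum_(rw <- words M n | run rw == mu) word_weight rw.

Let q1p : 1 - p = q. Proof. by rewrite -pq1 addrAC subrr add0r. Qed.

Lemma word_weight_ge0 rw : 0 <= word_weight rw.
Proof. by apply: prodr_ge0 => x _; rewrite /letter_weight; case: ifP => _; rewrite ?q1p. Qed.

Lemma sum_letters M (F : letter -> R) :
  \sum_(x <- letters M) F x = \sum_(i < M) (F (nat_of_ord i, true) + F (nat_of_ord i, false)).
Proof.
rewrite /letters big_allpairs -{1}(subn0 M) -[iota _ _]/(index_iota 0 M) big_mkord.
by apply: eq_bigr => i _; rewrite !big_cons big_nil /= addr0.
Qed.

Lemma sum_words_weight M n : \sum_(rw <- words M n) word_weight rw = M%:R ^+ n.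
Proof.
elim: n => [|n IH] /=; first by rewrite big_seq1 /word_weight big_nil.
rewrite big_allpairs_dep /=; under eq_bigr => x _.
  under eq_bigr do rewrite /word_weight big_cons.
  rewrite -mulr_sumr IH; over.
rewrite -mulr_suml sum_letters exprS; congr (_ * _).
rewrite /letter_weight /= (eq_bigr (fun=> 1)); last by move=> i _; rewrite q1p pq1.
by rewrite sumr_const card_ord.
Qed.

Lemma word_mass_ge0 M n mu : 0 <= word_mass M n mu.
Proof. by apply: sumr_ge0 => rw _; exact: word_weight_ge0. Qed.

Lemma word_mass_le M n mu : word_mass M n mu <= M%:R ^+ n.
Proof.
rewrite -sum_words_weight /word_mass big_mkcond; apply: ler_sum => rw _.
by case: ifP => // _; exact: word_weight_ge0.
Qed.

(** The predecessors of [mu] under a right attempt are [addp mu i], if that move is possible, and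
    [mu] itself, if the attempt is blocked. *)
Let step_right (l mu : part) i : (remp l i == mu)%:R =
  (canL mu i)%:R * (l == addp mu i)%:R + (~~ canR mu i)%:R * (l == mu)%:R :> R.
Proof.
have [c|c] := boolP (canR l i).
  have [<-|ne] := eqVneq (remp l i) mu.
    rewrite canL_remp// rempK// eqxx mulr1; have [e|] := eqVneq l (remp l i); rewrite ?mulr0 ?addr0//.
    by rewrite -e c mul0r addr0.
  have -> : ((canL mu i)%:R * (l == addp mu i)%:R = 0 :> R).
    case: (boolP (canL mu i)) => cm; rewrite ?mul0r// mul1r; case: eqP => // e.
    by move: ne; rewrite e addpK// eqxx.
  by rewrite add0r; case: eqP => [e|]; rewrite ?mulr0// -e c mul0r.
rewrite remp_id//.
have -> : ((canL mu i)%:R * (l == addp mu i)%:R = 0 :> R).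
  case: (boolP (canL mu i)) => cm; rewrite ?mul0r// mul1r; case: eqP => // e.
  by move: c; rewrite e canR_addp.
by rewrite add0r; case: eqP => [<-|]; rewrite ?mulr0// c mul1r.
Qed.

Let step_left (l mu : part) i : (addp l i == mu)%:R =
  (canR mu i)%:R * (l == remp mu i)%:R + (~~ canL mu i)%:R * (l == mu)%:R :> R.
Proof.
have [c|c] := boolP (canL l i).
  have [<-|ne] := eqVneq (addp l i) mu.
    rewrite canR_addp// addpK// eqxx mulr1; have [e|] := eqVneq l (addp l i); rewrite ?mulr0 ?addr0//.
    by rewrite -e c mul0r addr0.
  have -> : ((canR mu i)%:R * (l == remp mu i)%:R = 0 :> R).
    case: (boolP (canR mu i)) => cm; rewrite ?mul0r// mul1r; case: eqP => // e.
    by move: ne; rewrite e rempK// eqxx.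
  by rewrite add0r; case: eqP => [e|]; rewrite ?mulr0// -e c mul0r.
rewrite addp_id//.
have -> : ((canR mu i)%:R * (l == remp mu i)%:R = 0 :> R).
  case: (boolP (canR mu i)) => cm; rewrite ?mul0r// mul1r; case: eqP => // e.
  by move: c; rewrite e canL_remp.
by rewrite add0r; case: eqP => [<-|]; rewrite ?mulr0// c mul1r.
Qed.

Let KnE M n mu : word_mass M n mu = \sum_(rw <- words M n) (run rw == mu)%:R * word_weight rw.
Proof.
rewrite /word_mass big_mkcond; apply: eq_bigr => rw _.
by case: ifP => _; rewrite ?mul1r ?mul0r.
Qed.

(** Here the forward dynamics becomes the backward generator. Collecting the diagonal gives 1 plus
    [p - q] times [canL - canR] per particle, and [sum_canL_canR] makes the total independent of
    [mu]; [len mu < M] ensures that every movable row has a letter. *)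
Lemma word_mass_rec M n mu : (len mu < M)%N ->
  word_mass M n.+1 mu = (M%:R - (q - p)) * word_mass M n mu + gen p q (word_mass M n) mu.
Proof.
move=> lM; rewrite KnE /= big_allpairs_dep /= sum_letters.
have E i : \sum_(rw <- words M n) (run ((i, true) :: rw) == mu)%:R * word_weight ((i, true) :: rw) +
    \sum_(rw <- words M n) (run ((i, false) :: rw) == mu)%:R * word_weight ((i, false) :: rw) =
    p * ((canL mu i)%:R * word_mass M n (addp mu i) + (~~ canR mu i)%:R * word_mass M n mu) +
    q * ((canR mu i)%:R * word_mass M n (remp mu i) + (~~ canL mu i)%:R * word_mass M n mu).
  have sumE (a b c : R) u v : c * (a * word_mass M n u + b * word_mass M n v) = \sum_(rw <- words M n)
      c * (a * (run rw == u)%:R + b * (run rw == v)%:R) * word_weight rw.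
    by rewrite !KnE !mulr_sumr -big_split /= mulr_sumr; apply: eq_bigr => rw _; ring.
  rewrite !sumE; congr (_ + _); apply: eq_bigr => rw _.
    rewrite /word_weight big_cons /step/= step_right /letter_weight/=; ring.
  rewrite /word_weight big_cons /step/= step_left /letter_weight/= q1p; ring.
under eq_bigr do rewrite E.
rewrite (gen_wide _ _ _ lM).
have -> : M%:R - (q - p) = \sum_(i < M) (1 + (p - q) * ((canL mu i)%:R - (canR mu i)%:R)).
  rewrite big_split /= -mulr_sumr sum_canL_canR// mulr1 sumr_const card_ord.
  by rewrite opprB.
rewrite mulr_suml -big_split /=; apply: eq_bigr => i _; rewrite /gent.
have -> : word_mass M n (addp mu i) = (canL mu i)%:R * word_mass M n (addp mu i) + (1 - (canL mu i)%:R) * word_mass M n mu.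
  case: (boolP (canL mu i)) => c; first by rewrite mul1r subrr mul0r addr0.
  by rewrite addp_id// mul0r subr0 mul1r add0r.
have -> : word_mass M n (remp mu i) = (canR mu i)%:R * word_mass M n (remp mu i) + (1 - (canR mu i)%:R) * word_mass M n mu.
  case: (boolP (canR mu i)) => c; first by rewrite mul1r subrr mul0r addr0.
  by rewrite remp_id// mul0r subr0 mul1r add0r.
rewrite -q1p; case: (canL mu i); case: (canR mu i) => /=; ring.
Qed.

(* [exp ((q - p) s)] times the probability of [mu] for the system of the first
   [M] particles, the next one being frozen. *)
Definition trunc_sol (M : nat) (s : R) (mu : part) : R :=
  expR (- (M%:R - (q - p)) * s) * egf (fun n => word_mass M n mu) s.

Let word_mass_norm M mu n : `|word_mass M n mu| <= 1 * M%:R ^+ n.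
Proof. by rewrite mul1r ger0_norm ?word_mass_le ?word_mass_ge0. Qed.

Lemma egf_word_mass_cvg M s mu : cvgn (pseries (fun n => word_mass M n mu / n`!%:R) s).
Proof. exact: (@egf_cvg _ _ (ler0n R M) (word_mass M ^~ mu) 1 s (word_mass_norm M mu)). Qed.

Lemma trunc_sol_ge0 M s mu : 0 <= s -> 0 <= trunc_sol M s mu.
Proof.
move=> s0; rewrite mulr_ge0 ?expR_ge0//; apply: limr_ge; first exact: egf_word_mass_cvg.
near=> n; apply: sumr_ge0 => i _.
by rewrite mulr_ge0 ?exprn_ge0// divr_ge0 ?word_mass_ge0.
Unshelve. all: by end_near. Qed.

Lemma trunc_sol_le M s mu : 0 <= s -> trunc_sol M s mu <= expR ((q - p) * s).
Proof.
move=> s0; rewrite /trunc_sol.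
have h : egf (fun n => word_mass M n mu) s <= expR (M%:R * s).
  apply: ler_lim; [exact: egf_word_mass_cvg|exact: is_cvg_series_exp_coeff|].
  near=> n; apply: ler_sum => i _; rewrite /exp_coeff/= exprMn mulrAC.
  by apply: ler_wpM2r; rewrite ?invr_ge0//; apply: ler_wpM2r; rewrite ?exprn_ge0 ?word_mass_le.
apply: le_trans (ler_wpM2l (expR_ge0 _) h) _.
by rewrite -expRD ler_expR; nra.
Unshelve. all: by end_near. Qed.

(** Differentiating an exponential generating function shifts its coefficients, so [word_mass_rec]
    is the equation read coefficient by coefficient; the exponential prefactor cancels the scalar
    term. *)
Lemma trunc_sol_derive M (s : R) mu : (len mu < M)%N ->
  is_derive s 1 (fun s => trunc_sol M s mu) (gen p q (trunc_sol M s) mu).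
Proof.
move=> lM; set c := M%:R - (q - p).
have dE : is_derive s 1 (fun s : R => expR (- c * s)) (expR (- c * s) * - c).
  have h : is_derive s 1 (fun s : R => - c * s) (- c).
    have := @is_deriveZ _ _ _ id (- c) s 1 1 (is_derive_id _ _).
    by rewrite /GRing.scale/= mulr1.
  exact: is_derive1_comp.
have dF := @egf_derive _ _ (ler0n R M) (word_mass M ^~ mu) 1 s (word_mass_norm M mu).
have eF : egf (fun n => word_mass M n.+1 mu) s =
    c * egf (fun n => word_mass M n mu) s + gen p q (fun l => egf (fun n => word_mass M n l) s) mu.
  apply: cvg_lim => //.
  have -> : pseries (fun n => word_mass M n.+1 mu / n`!%:R) s = fun N =>
      c * pseries (fun n => word_mass M n mu / n`!%:R) s N +
      gen p q (fun l => pseries (fun n => word_mass M n l / n`!%:R) s N) mu.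
    apply/funext => N; rewrite /pseries/= /series/=.
    under eq_bigr do rewrite word_mass_rec//.
    elim: N => [|N IH]; first by rewrite !big_geq// mulr0 add0r; under eq_fun do rewrite big_geq//; rewrite gen_cst.
    rewrite !big_nat_recr//= {}IH.
    have -> : (fun l => \sum_(0 <= k < N.+1) word_mass M k l / k`!%:R * s ^+ k) =
        (fun l => \sum_(0 <= k < N) word_mass M k l / k`!%:R * s ^+ k + word_mass M N l / N`!%:R * s ^+ N).
      by apply/funext => l; rewrite big_nat_recr.
    rewrite genD mulrDr.
    have -> : gen p q (fun x => word_mass M N x / N`!%:R * s ^+ N) mu = N`!%:R^-1 * s ^+ N * gen p q (word_mass M N) mu.
      by rewrite -genZ; congr gen; apply/funext => x; ring.
    rewrite -/c; ring.
  apply: cvgD; first by apply: cvgMl_tmp; exact: egf_word_mass_cvg.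
  by apply: gen_cvg => l; exact: egf_word_mass_cvg.
have := is_deriveM dE dF.
rewrite eF /GRing.scale/= => h.
rewrite (_ : gen p q (trunc_sol M s) mu = expR (- c * s) * gen p q (fun l => egf (fun n => word_mass M n l) s) mu); last first.
  by rewrite -genZ.
rewrite (_ : expR (- c * s) * gen _ _ _ _ = expR (- c * s) * (c * egf (fun n => word_mass M n mu) s +
  gen p q (fun l => egf (fun n => word_mass M n l) s) mu) + egf (fun n => word_mass M n mu) s * (expR (- c * s) * - c))//.
ring.
Qed.

End word_series.

(** * Trajectories driven by a word *)

Lemma run_len (rw : seq letter) M : all (fun x => x.1 < M)%N rw -> (len (run rw) <= M)%N.
Proof.
elim: rw => [|x rw IH] /=; first by rewrite len_empty.
move=> /andP[xM /IH h]; rewrite /step; case: ifP => _; first exact: len_remp_le.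
have [e|] := eqVneq (len (run rw)) M; last first.
  move=> ne; rewrite len_le; have h' : (len (run rw) < M)%N by rewrite ltn_neqAle ne.
  by have := len_addp_le x.1 (leqnn (len (run rw))); move/leq_trans => /(_ _ h'); rewrite len_le.
by rewrite len_le addpE (gtn_eqF xM) addn0 -len_le.
Qed.

Section trajectory.
Context {R : realType} (w' : nat -> nat -> R) (b' : nat -> nat -> bool) (x : nat -> R -> int).
Hypothesis traj : asep_step_trajectory w' b' x.
Hypothesis w0 : forall m k, 0 <= w' m.+1 k.

Let w (j c : nat) : R := w' j.+1 c.
Let b (j c : nat) : bool := b' j.+1 c.

Let ticks_mono j n n' : (n <= n')%N -> ticks w j n <= ticks w j n'.
Proof.
move=> /subnK <-; elim: (n' - n)%N => [//|k IH].
by rewrite addSn ticksS; apply: le_trans IH _; rewrite lerDl; exact: w0.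
Qed.

Let rest_from j n a u : 0 <= a -> a <= u -> ticks w j n <= a -> u < ticks w j n.+1 ->
  x j.+1 u = x j.+1 a.
Proof.
move=> a0 au na un; apply: (asep_rest traj) => // k; apply/negP => /andP[ak ku].
have [kn|nk] := ltnP k n.
  have := lt_le_trans ak (le_trans (ticks_mono j kn) na).
  by rewrite ltxx.
have := le_lt_trans ku (lt_le_trans un (ticks_mono j (_ : (n.+1 <= k.+1)%N))).
by rewrite ltxx => /(_ nk).
Qed.

Let order_add i k t : 0 <= t -> x i.+1 t + k%:Z <= x (i + k).+1 t.
Proof.
move=> t0; elim: k => [|k IH]; first by rewrite addn0 addr0.
by have := asep_ordered traj (ltn0Sn (i + k)) t0; rewrite addnS; lia.
Qed.

Let order_le i j t : 0 <= t -> (i <= j)%N -> x i.+1 t <= x j.+1 t.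
Proof. by move=> t0 ij; have := order_add i (j - i) t0; rewrite subnKC//; lia. Qed.

Let attempt_run (l : part) i e t : 0 <= t ->
  (forall j, (j <= i.+1)%N -> x j.+1 t = j.+1%:Z - (l j)%:Z) ->
  attempt (occupied x t) (x i.+1 t) e = i.+1%:Z - (step l (i, e) i)%:Z.
Proof.
move=> t0 h; have hi := h i (leqnSn _); have hi1 := h i.+1 (leqnn _).
rewrite /attempt /step /=; case: e => /=.
  rewrite eqxx /canR/=; case: (boolP (_ \in _)) => [|no].
    rewrite inE => -[[//|m] _ xm].
    have [mi|im] := leqP m i; first by have := order_le t0 mi; lia.
    have := order_le t0 im; have := part_le l (leqnSn i); lia.
  have ne : l i.+1 != l i.
    apply: contra no => /eqP e; rewrite inE; exists i.+2 => //.
    by rewrite hi1 hi e; lia.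
  have := part_le l (leqnSn i); rewrite leq_eqVlt (negbTE ne) /= => lt; rewrite lt; lia.
rewrite eqxx /canL/=; case: (boolP (_ \in _)) => [|no].
  rewrite inE => -[[//|m] _ xm].
  have [im|mi] := leqP i m; first by have := order_le t0 im; lia.
  case: i => [//|i] in h hi hi1 xm mi *.
  have hi' := h i (leq_trans (leqnSn _) (leqnSn _)).
  have := order_le t0 (_ : (m <= i)%N); move=> /(_ mi).
  by have := part_le l (leqnSn i); rewrite /=; case: ltnP; lia.
case: i => [|i] in h hi hi1 no *; first by rewrite /=; lia.
have hi' := h i (leq_trans (leqnSn _) (leqnSn _)).
have ne : l i.+1 != l i.
  apply: contra no => /eqP e; rewrite inE; exists i.+1 => //.
  by rewrite hi' hi e; lia.
have := part_le l (leqnSn i); rewrite leq_eqVlt (negbTE ne) /= => lt; rewrite lt; lia.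
Qed.

(** The conclusion includes particle [M+1], at rest at its initial site, because a right attempt of
    particle [M] has to see it. *)
Lemma run_trajectory M rw u : follows w b rw -> all (fun x => x.1 < M)%N rw ->
  now w rw <= u -> (forall j, (j <= M)%N -> u < ticks w j (occ j rw).+1) ->
  forall i, (i <= M)%N -> x i.+1 u = i.+1%:Z - (run rw i)%:Z.
Proof.
elim: rw u => [|y rw IH] u.
  move=> _ _ /= u0 h i iM; rewrite (@rest_from i 0 0 u)//.
  - by rewrite (asep_step_initial traj)//; lia.
  - by rewrite /ticks big_ord0.
  - exact: h.
case: y => [i e] fw /andP[iM aM] nu h.
rewrite /= in iM aM.
have := fw => /= /and3P[fr lt /eqP be].
set c := occ i rw in be; rewrite /now in nu; set t0 := clk w i ((i, e) :: rw) in lt nu.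
have et0 : t0 = ticks w i c.+1 by rewrite /t0 /clk (@occ_head (i, e)).
have n0 := follows_now_ge0 fr.
(* The jump rule speaks of times just before the ring [t0]; [v] is one of them after the previous
   ring, so the induction hypothesis describes the configuration there. *)
have [v [nv vt jump]] : exists v, [/\ now w rw < v, v < t0 &
    x i.+1 t0 = attempt (occupied x v) (x i.+1 v) (b i c)].
  have := asep_jump traj c (ltn0Sn i).
  rewrite -[ring_time _ _]/(ticks w i c.+1) -et0 => hj.
  have h1 : \forall v \near t0^'-, now w rw < v by exact: nbhs_left_gt.
  have h2 : \forall v \near t0^'-, v < t0 by exact: nbhs_left_lt.
  have [v [? [? ?]]] := filter_ex (filterI h1 (filterI h2 hj)).
  by exists v.
have clock_next v' : v' < t0 -> forall j, (j <= M)%N -> v' < ticks w j (occ j rw).+1.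
  move=> vt' j jM; have [->|ne] := eqVneq j i; first by rewrite -/c -et0.
  by have := h j jM; rewrite (@occ_tail j (i, e))//; apply: lt_trans; exact: lt_le_trans nu.
have stv := IH v fr aM (ltW nv) (clock_next v vt).
have v0 : 0 <= v by exact: le_trans (ltW nv).
have t00 : 0 <= t0 by exact: le_trans (ltW vt).
move=> j jM; have [->|ne] := eqVneq j i.
  rewrite (@rest_from i c.+1 t0 u)//; last 2 first.
  - by rewrite et0.
  - by have := h i (ltnW iM); rewrite (@occ_head (i, e)).
  rewrite jump be (@attempt_run (run rw))// => k ki; apply: stv.
  exact: leq_trans ki iM.
have -> : step (run rw) (i, e) j = run rw j.
  by rewrite /step/=; case: ifP => _; rewrite ?rempE ?addpE (negbTE ne) ?subn0 ?addn0.
rewrite (@rest_from j (occ j rw) (now w rw) u)//.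
- apply: IH => // k kM; exact: clock_next.
- exact: le_trans (ltW lt) nu.
- exact: follows_clk_le fr.
- by have := h j jM; rewrite (@occ_tail j (i, e)).
Qed.

(** Particles beyond [M+1] may have rung, but they cannot have moved: each lies between particle
    [M+1] and a later frozen particle, both at their initial sites, with no gap between. *)
Lemma run_trajectory_all M rw u : follows w b rw -> all (fun x => x.1 < M)%N rw ->
  now w rw <= u -> (forall j, (j <= M)%N -> u < ticks w j (occ j rw).+1) ->
  (forall N, exists2 j, (N <= j)%N & u < w j 0%N) ->
  forall i, x i.+1 u = i.+1%:Z - (run rw i)%:Z.
Proof.
move=> fw aM nu h frozen i; have u0 := le_trans (follows_now_ge0 fw) nu.
have st := run_trajectory fw aM nu h.
have [iM|Mi] := leqP i M; first exact: st.
have [j ij uj] := frozen i.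
have xj : x j.+1 u = j.+1%:Z.
  rewrite (@rest_from j 0 0 u)// ?(asep_step_initial traj)//.
  - by rewrite /ticks big_ord0.
  - by rewrite /ticks big_ord1.
have r0 k : (M <= k)%N -> run rw k = 0%N.
  by move=> Mk; apply/eqP; rewrite -len_le; exact: leq_trans (run_len aM) Mk.
have xM := st M (leqnn M).
rewrite r0 in xM; last by [].
rewrite r0; last exact: ltnW.
have h1 := order_add M (i - M) u0; rewrite subnKC in h1; last exact: ltnW.
have h2 := order_add i (j - i) u0; rewrite subnKC in h2; last by [].
by clear - xj xM h1 h2 ij Mi; lia.
Qed.

End trajectory.

(** * Averaging over frozen particles *)

Section cesaro_limits.
Context {R : realType}.
Implicit Types (x y : nat -> R).

(* All shifts are required, so that finitely many terms can be ignored. *)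
Definition cesaro_to x (l : R) : Prop :=
  forall N, (\sum_(n < K) x (N + n)%N) / K%:R @[K --> \oo] --> l.

Lemma cesaro_unique x l l' : cesaro_to x l -> cesaro_to x l' -> l = l'.
Proof. by move=> /(_ 0%N) h /(_ 0%N) h'; exact: cvg_unique h h'. Qed.

Lemma cesaro_eq x y l : x =1 y -> cesaro_to x l -> cesaro_to y l.
Proof. by move=> /funext ->. Qed.

Lemma cesaroD x y l l' : cesaro_to x l -> cesaro_to y l' ->
  cesaro_to (fun n => x n + y n) (l + l').
Proof.
move=> h h' N; under eq_fun do rewrite big_split mulrDl.
by apply: cvgD.
Qed.

Lemma cesaroZ a x l : cesaro_to x l -> cesaro_to (fun n => a * x n) (a * l).
Proof.
move=> h N; under eq_fun do rewrite -mulr_sumr -mulrA.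
by apply: cvgMl_tmp.
Qed.

Lemma cesaroB x y l l' : cesaro_to x l -> cesaro_to y l' ->
  cesaro_to (fun n => x n - y n) (l - l').
Proof.
move=> h /(@cesaroZ (-1) _ _) h'; rewrite -[- l']mulN1r.
by apply: cesaro_eq (cesaroD h h') => n; rewrite mulN1r.
Qed.

(** For fixed [mu] the generator is a finite linear combination, so it commutes with averaging. *)
Lemma cesaro_gen (p q : R) (f : nat -> part -> R) (g : part -> R) mu :
  (forall l, cesaro_to (f ^~ l) (g l)) ->
  cesaro_to (fun n => gen p q (f n) mu) (gen p q g mu).
Proof.
move=> h N; under eq_fun => K.
  rewrite (_ : _ / _ = gen p q (fun l => (\sum_(n < K) f (N + n)%N l) / K%:R) mu); first over.
  under [in RHS]eq_fun do rewrite mulrC.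
  rewrite genZ mulrC; congr (_ * _).
  elim: K => [|K IH]; last by rewrite big_ord_recr /= {}IH -genD; under [in RHS]eq_fun do rewrite big_ord_recr.
  by rewrite big_ord0; under eq_fun do rewrite big_ord0; rewrite gen_cst.
by apply: gen_cvg => l; exact: h.
Qed.

Lemma cesaro_le x l c N : cesaro_to x l -> (forall n, (N <= n)%N -> x n <= c) -> l <= c.
Proof.
move=> /(_ N) h hx; rewrite -(cvg_lim (@Rhausdorff R) h); apply: limr_le.
  by apply/cvg_ex; exists l.
near=> K.
have K0 : 0 < K%:R :> R by rewrite ltr0n; near: K; exact: nbhs_infty_gt.
rewrite ler_pdivrMr// (_ : c * K%:R = \sum_(n < K) c); last first.
  by rewrite sumr_const card_ord mulr_natr.
by apply: ler_sum => n _; apply: hx; exact: leq_addr.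
Unshelve. all: by end_near. Qed.

Lemma cesaro_norm_le x l c N : cesaro_to x l -> (forall n, (N <= n)%N -> `|x n| <= c) -> `|l| <= c.
Proof.
move=> h hx; rewrite ler_norml; apply/andP; split; last first.
  by apply: cesaro_le h (_ : forall n, (N <= n)%N -> _) => n /hx; rewrite ler_norml => /andP[].
rewrite lerNl; have := @cesaroZ (-1) _ _ h; rewrite mulN1r => h'.
apply: cesaro_le h' (_ : forall n, (N <= n)%N -> _) => n /hx.
by rewrite ler_norml mulN1r lerNl => /andP[].
Qed.

End cesaro_limits.

(** * Averaging over pairwise independent events *)

Section mixing.
Context {R : realType} {d : measure_display} {Omega : measurableType d}
  (P : probability Omega R).

Let pr (A : set Omega) : R := fine (P A).

Let prK A : measurable A -> (pr A)%:E = P A.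
Proof. by move=> mA; rewrite fineK// fin_num_measure. Qed.

(** The double sum is the second moment of the linear combination of indicators. *)
Lemma gram_ge0 (A : nat -> set Omega) (c : nat -> R) (n : nat) :
  (forall i, measurable (A i)) ->
  0 <= \sum_(i < n) \sum_(j < n) c i * c j * pr (A i `&` A j).
Proof.
move=> mA; have mI i j : measurable (A i `&` A j) by exact: measurableI.
have h i j : P.-integrable setT (fun w => (c i * c j)%:E * (\1_(A i `&` A j) w)%:E)%E.
  by apply: integrableZl => //; exact: integrable_indic.
have E : (\sum_(i < n) \sum_(j < n) c i * c j * pr (A i `&` A j))%:E =
    (\int[P]_w ((\sum_(i < n) c i * \1_(A i) w) ^+ 2)%:E)%E.
  transitivity (\int[P]_w (\sum_(i < n) \sum_(j < n) (c i * c j)%:E * (\1_(A i `&` A j) w)%:E))%E.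
    rewrite integral_sum//; last by move=> i; exact: integrable_sum.
    rewrite -sumEFin; apply: eq_bigr => i _.
    rewrite integral_sum//.
    rewrite -sumEFin; apply: eq_bigr => j _.
    rewrite integralZl//; last exact: integrable_indic.
    by rewrite integral_indic ?setIT ?EFinM ?prK.
  apply: eq_integral => w _.
  rewrite expr2 mulr_suml -sumEFin; apply: eq_bigr => i _.
  rewrite mulr_sumr -sumEFin; apply: eq_bigr => j _.
  by rewrite indicI -EFinM; congr (_%:E); rewrite /=; ring.
by rewrite -lee_fin E integral_ge0// => w _; rewrite lee_fin sqr_ge0.
Qed.

Variables (B : nat -> set Omega) (beta : R).
Hypothesis mB : forall n, measurable (B n).
Hypothesis prB : forall n, pr (B n) = beta.
Hypothesis prBB : forall n m, n != m -> pr (B n `&` B m) = beta ^+ 2.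

Let beta0 : 0 <= beta. Proof. by rewrite -(prB 0%N) fine_ge0. Qed.

(* Nonnegativity of the second moment of [lam 1_E - sum (1_B - beta)]. *)
Lemma mixing_quadratic (E : set Omega) (lam : R) K N : measurable E ->
  2 * lam * (\sum_(n < K) pr (E `&` B (N + n)%N) - K%:R * (beta * pr E)) <= lam ^+ 2 + K%:R.
Proof.
move=> mE.
pose A n := if n is n'.+1 then if n' is n''.+1 then B (N + n'') else setT else E.
pose c n : R := if n is n'.+1 then if n' is n''.+1 then -1 else K%:R * beta else lam.
have mA n : measurable (A n).
  by case: n => [//|[|n]]; [exact: measurableT|exact: mB].
have T1 : pr setT = 1 by rewrite /pr probability_setT.
have sum2 (F : nat -> R) : \sum_(j < K.+2) F j = F 0%N + (F 1%N + \sum_(j < K) F j.+2).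
  by rewrite !big_ord_recl /=; congr (_ + (_ + _)); apply: eq_bigr.
have sumcst (z : R) : \sum_(j < K) z = K%:R * z by rewrite sumr_const card_ord mulr_natl.
pose S := \sum_(n < K) pr (E `&` B (N + n)%N).
have E0 : \sum_(j < K.+2) c 0%N * c j * pr (A 0%N `&` A j) =
    lam ^+ 2 * pr E + lam * (K%:R * beta) * pr E - lam * S.
  rewrite (sum2 (fun j => c 0%N * c j * pr (A 0%N `&` A j))) /= setIid setIT /S mulr_sumr -sumrN.
  rewrite addrA -expr2; congr (_ + _); apply: eq_bigr => j _; ring.
have E1 : \sum_(j < K.+2) c 1%N * c j * pr (A 1%N `&` A j) =
    lam * (K%:R * beta) * pr E + 0.
  rewrite (sum2 (fun j => c 1%N * c j * pr (A 1%N `&` A j))) /= setIid setTI T1.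
  under eq_bigr do rewrite setTI prB.
  rewrite sumcst; ring.
have E2 : \sum_(i < K) \sum_(j < K.+2) c i.+2 * c j * pr (A i.+2 `&` A j) =
    - (lam * S) - (K%:R * beta) ^+ 2 + (K%:R * beta + K%:R * (K%:R * beta ^+ 2 - beta ^+ 2)).
  have inner (i : 'I_K) : \sum_(j < K.+2) c i.+2 * c j * pr (A i.+2 `&` A j) =
      - (lam * pr (E `&` B (N + i)%N)) - K%:R * beta ^+ 2 + (beta + (K%:R * beta ^+ 2 - beta ^+ 2)).
    rewrite (sum2 (fun j => c i.+2 * c j * pr (A i.+2 `&` A j))) /= setIT prB setIC.
    rewrite (bigD1 i)//= setIid prB (eq_bigr (fun=> beta ^+ 2)); last first.
      move=> j ji; rewrite prBB; first by ring.
      by rewrite eqn_add2l eq_sym.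
    have : \sum_(j < K) beta ^+ 2 = beta ^+ 2 + \sum_(j < K | j != i) beta ^+ 2 by rewrite (bigD1 i).
    rewrite sumcst; set Z := (\sum_(j < K | _) _) => hz.
    have -> : Z = K%:R * beta ^+ 2 - beta ^+ 2 by rewrite hz addrC addKr.
    ring.
  rewrite (eq_bigr _ (fun i _ => inner i)) !big_split /= !sumcst sumrN -mulr_sumr -/S; ring.
have := gram_ge0 c K.+2 mA.
rewrite (sum2 (fun i => \sum_(j < K.+2) c i * c j * pr (A i `&` A j))) E0 E1 E2 -/S.
have pE0 : 0 <= pr E by exact: fine_ge0.
have pE1 : pr E <= 1 by rewrite -lee_fin prK// probability_le1.
have b1 : beta <= 1 by rewrite -(prB 0%N) -lee_fin prK// probability_le1.
have KK : 0 <= K%:R :> R by [].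
have h1 : lam ^+ 2 * pr E <= lam ^+ 2 by rewrite ler_piMr ?sqr_ge0.
have h2 : K%:R * beta <= K%:R by rewrite ler_piMr.
have h3 : 0 <= K%:R * beta ^+ 2 by rewrite mulr_ge0 ?sqr_ge0.
nra.
Qed.

Lemma mixing (E : set Omega) : measurable E ->
  cesaro_to (fun n => pr (E `&` B n)) (beta * pr E).
Proof.
move=> mE N; apply/cvgrPdist_le => e e0.
near=> K.
have eK : e^-1 ^+ 2 <= K%:R by near: K; exact: nbhs_infty_ger.
have K0 : 0 < K%:R :> R by apply: lt_le_trans eK; rewrite exprn_gt0 ?invr_gt0.
have ee : e * e^-1 = 1 by rewrite divff ?gt_eqF.
have ei : 0 < e^-1 by rewrite invr_gt0.
have eK2 : 1 <= e ^+ 2 * K%:R.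
  have := ler_wpM2l (sqr_ge0 e) eK; rewrite -exprMn ee expr1n; exact.
set S := \sum_(n < K) _.
(* Taking [lam] equal to plus or minus [e * K] bounds the deviation of the average by
   [e / 2 + 1 / (2 * e * K)], which is at most [e] once [1 <= e ^+ 2 * K]. *)
have h1 := mixing_quadratic (e * K%:R) K N mE.
have h2 := mixing_quadratic (- (e * K%:R)) K N mE.
rewrite -/S in h1 h2; set D := S - _ in h1 h2.
have -> : beta * pr E - S / K%:R = - (D / K%:R).
  by rewrite /D mulrBl mulrAC divff ?gt_eqF// mul1r opprB.
rewrite normrN ler_norml ler_pdivrMr// ler_pdivlMr//.
have KK : K%:R * 1 <= K%:R * (e ^+ 2 * K%:R) by rewrite ler_pM2l.
have eK0 : 0 < e * K%:R by rewrite mulr_gt0.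
apply/andP; split.
  rewrite -(ler_pM2l (_ : 0 < 2 * (e * K%:R))); last by rewrite mulr_gt0.
  nra.
rewrite -(ler_pM2l (_ : 0 < 2 * (e * K%:R))); last by rewrite mulr_gt0.
nra.
Unshelve. all: by end_near. Qed.

End mixing.

Lemma mvt_norm_le {R : realType} (f df : R -> R) (a b c : R) : a <= b ->
  (forall x : R, is_derive x 1 f (df x)) ->
  (forall x, a < x < b -> `|df x| <= c) -> `|f b - f a| <= c * (b - a).
Proof.
move=> ab fd hc.
have cont (g dg : R -> R) : (forall x : R, is_derive x 1 g (dg x)) -> {within `[a, b], continuous g}.
  by move=> h; apply: derivable_within_continuous => x _; have [] := h x.
rewrite ler_norml; apply/andP; split; last first.
  by apply: (@mvt_le _ _ df) => // [|x /hc]; [exact: cont fd|rewrite ler_norml => /andP[]].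
pose g x := - f x.
have gd (x : R) : is_derive x 1 g (- df x) by exact: is_deriveN.
have := @mvt_le _ g (fun x => - df x) a b c ab (cont _ _ gd) (fun x _ => gd x).
have h x : a < x < b -> - df x <= c by move=> /hc; rewrite ler_norml => /andP[]; lra.
by move=> /(_ h); rewrite /g; lra.
Qed.

(** A quadratic error bound, unlike a derivative, survives pointwise limits; this converts it back
    into a derivative. *)
Lemma is_derive_quadratic {R : realType} (f : R -> R) (x l C e : R) : 0 < e ->
  (forall h, `|h| < e -> `|f (x + h) - f x - h * l| <= C * h ^+ 2) -> is_derive x 1 f l.
Proof.
move=> e0 hf.
have cv : h^-1 *: (f (h *: (1 : R) + x) - f x) @[h --> (0 : R)^'] --> l.
  apply/cvgrPdist_le => eps eps0; near=> h.
  have h0 : h != 0 by near: h; exact: nbhs_dnbhs_neq.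
  have he : `|h| < e by near: h; apply: dnbhs0_lt.
  have hC : `|h| < eps / (`|C| + 1) by near: h; apply: dnbhs0_lt; rewrite divr_gt0// ltr_wpDl.
  rewrite distrC /GRing.scale/= mulr1 [h + x]addrC.
  have -> : (h^-1 * (f (x + h) - f x) - l) = h^-1 * (f (x + h) - f x - h * l).
    by rewrite [RHS]mulrBr mulKf.
  rewrite normrM normfV ler_pdivrMl ?normr_gt0//.
  apply: le_trans (hf h he) _.
  have hh : h ^+ 2 = `|h| ^+ 2 by rewrite -normrX ger0_norm// sqr_ge0.
  have n0 : 0 < `|h| by rewrite normr_gt0.
  rewrite ltr_pdivlMr ?ltr_wpDl// in hC; have CC := ler_norm C.
  rewrite hh; nra.
apply: DeriveDef; first by apply/cvg_ex; exists l.
exact: cvg_lim cv.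
Unshelve. all: by end_near. Qed.

Lemma lipschitz_within_continuous {R : realType} (f : R -> R) (T C : R) :
  (forall a b, 0 <= a -> a <= b -> b <= T -> `|f b - f a| <= C * (b - a)) ->
  {within `[0, T], continuous f}.
Proof.
move=> hf; apply/subspace_continuousP => x /=; rewrite in_itv/= => /andP[x0 xT].
apply/cvgrPdist_le => eps eps0; near=> y.
have yA : `[0, T]%classic y by near: y; exact: withinT.
move: yA; rewrite /= in_itv/= => /andP[y0 yT].
have hy : `|x - y| < eps / (`|C| + 1).
  by near: y; apply: cvg_within; apply: nbhsx_ballx; rewrite divr_gt0// ltr_wpDl.
have C1 : 0 < `|C| + 1 by rewrite ltr_wpDl.
rewrite ltr_pdivlMr// in hy.
have CC := ler_norm C.
have n0 := normr_ge0 (x - y).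
have [xy|yx] := leP x y.
  rewrite distrC; apply: le_trans (hf _ _ x0 xy yT) _.
  rewrite ler0_norm ?subr_le0// in hy; nra.
apply: le_trans (hf _ _ y0 (ltW yx) xT) _.
rewrite ger0_norm ?subr_ge0 1?ltW// in hy; nra.
Unshelve. all: by end_near. Qed.

Section limit_solution.
Context {R : realType} (p q : R).
Hypotheses (p0 : 0 <= p) (pq : p <= q) (pq1 : p + q = 1).

Let q0 : 0 <= q. Proof. exact: le_trans pq. Qed.
Let gam : R := q - p.
Let gam0 : 0 <= gam. Proof. by rewrite subr_ge0. Qed.
Let N (l : part) : R := (2 * (len l).+1)%:R.

Let trunc_sol_norm M T s l : 0 <= s -> s <= T -> `|trunc_sol p q M s l| <= expR (gam * T).
Proof.
move=> s0 sT; rewrite ger0_norm ?trunc_sol_ge0//; apply: le_trans (trunc_sol_le p0 q0 pq1 M l s0) _.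
by rewrite ler_expR ler_wpM2l.
Qed.

Let gen_trunc_sol_norm M T s l : 0 <= s -> s <= T ->
  `|gen p q (trunc_sol p q M s) l| <= N l * expR (gam * T).
Proof. by move=> s0 sT; apply: gen_norm_le => // l' _; exact: trunc_sol_norm. Qed.

Let trunc_sol_lip M T l a b : (len l < M)%N -> 0 <= a -> a <= b -> b <= T ->
  `|trunc_sol p q M b l - trunc_sol p q M a l| <= N l * expR (gam * T) * (b - a).
Proof.
move=> lM a0 ab bT.
have D (x : R) : is_derive x 1 (fun s => trunc_sol p q M s l) (gen p q (trunc_sol p q M x) l).
  exact: (trunc_sol_derive p0 q0 pq1 x lM).
refine (mvt_norm_le ab D _) => x /andP[ax xb].
by apply: gen_trunc_sol_norm; [exact: le_trans a0 (ltW ax)|exact: le_trans (ltW xb) bT].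
Qed.

Let C2 (T : R) l : R := N l * ((2 * (len l).+2)%:R * expR (gam * T)).

Let gen_trunc_sol_lip M T l a b : ((len l).+1 < M)%N -> 0 <= a -> a <= b -> b <= T ->
  `|gen p q (trunc_sol p q M b) l - gen p q (trunc_sol p q M a) l| <= C2 T l * (b - a).
Proof.
move=> lM a0 ab bT; rewrite -genB -mulrA; apply: gen_norm_le => // l' ll'.
apply: le_trans (trunc_sol_lip (leq_ltn_trans ll' lM) a0 ab bT) _.
by rewrite ler_wpM2r ?subr_ge0// ler_wpM2r ?expR_ge0// ler_nat leq_mul2l /= ltnS.
Qed.

(** The constant does not depend on [M], so the estimate passes to the limit. The base point may be
    either end, which yields the derivative from both sides; [(len l).+1 < M] covers the neighbours
    of [l], which can be one row longer. *)
Let trunc_sol_taylor M T l a b g : ((len l).+1 < M)%N -> 0 <= a -> a <= b -> b <= T ->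
  g = a \/ g = b ->
  `|trunc_sol p q M b l - trunc_sol p q M a l - (b - a) * gen p q (trunc_sol p q M g) l| <= C2 T l * (b - a) ^+ 2.
Proof.
move=> lM a0 ab bT hg; set G := gen _ _ _ _.
have -> : trunc_sol p q M b l - trunc_sol p q M a l - (b - a) * G =
  (trunc_sol p q M b l - b * G) - (trunc_sol p q M a l - a * G) by ring.
rewrite expr2 mulrA.
have D (x : R) : is_derive x 1 (fun s => trunc_sol p q M s l - s * G) (gen p q (trunc_sol p q M x) l - G).
  apply: is_deriveB; first exact: (trunc_sol_derive p0 q0 pq1 x (ltnW lM)).
  have := @is_deriveZ _ _ _ (id : R -> R) G x 1 1 (is_derive_id _ _).
  rewrite /GRing.scale/= mulr1; congr is_derive.
  by apply/funext => y; rewrite /= mulrC.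
refine (mvt_norm_le ab D _) => x /andP[ax xb].
have C0 : 0 <= C2 T l by rewrite !mulr_ge0 ?expR_ge0// ler0n.
rewrite /G; case: hg => ->.
  apply: le_trans (gen_trunc_sol_lip lM a0 (ltW ax) (le_trans (ltW xb) bT)) _.
  by rewrite ler_wpM2l// lerD2r ltW.
rewrite distrC; apply: le_trans (gen_trunc_sol_lip lM (le_trans a0 (ltW ax)) (ltW xb) bT) _.
by rewrite ler_wpM2l// lerD2l lerN2 ltW.
Qed.

Variable v : R -> part -> R.
Hypothesis v_init : forall l, v 0 l = (l == empty_part)%:R.
Hypothesis v_lim : forall s l, 0 <= s -> cesaro_to (fun M => trunc_sol p q M s l) (v s l).

Let v_taylor T l a b g : 0 <= a -> a <= b -> b <= T -> g = a \/ g = b ->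
  `|v b l - v a l - (b - a) * gen p q (v g) l| <= C2 T l * (b - a) ^+ 2.
Proof.
move=> a0 ab bT hg.
have b0 := le_trans a0 ab.
have g0 : 0 <= g by case: hg => ->.
apply: (@cesaro_norm_le _ (fun M => trunc_sol p q M b l - trunc_sol p q M a l - (b - a) * gen p q (trunc_sol p q M g) l) _ _ (len l).+2).
  apply: cesaroB; first by apply: cesaroB; exact: v_lim.
  by apply: cesaroZ; apply: cesaro_gen => l'; exact: v_lim.
by move=> M lM; exact: trunc_sol_taylor.
Qed.

Let v_lip T l a b : 0 <= a -> a <= b -> b <= T ->
  `|v b l - v a l| <= N l * expR (gam * T) * (b - a).
Proof.
move=> a0 ab bT; have b0 := le_trans a0 ab.
apply: (@cesaro_norm_le _ (fun M => trunc_sol p q M b l - trunc_sol p q M a l) _ _ (len l).+1).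
  by apply: cesaroB; exact: v_lim.
by move=> M lM; exact: trunc_sol_lip.
Qed.

Lemma limit_backward_solution : backward_solution p q v.
Proof.
split => //.
- by move=> T l; apply: lipschitz_within_continuous => a b; exact: v_lip.
- move=> s l s0; apply: (is_derive_quadratic (C := C2 (s + s) l) s0) => h hs.
  rewrite ltr_norml in hs; case/andP: hs => hs1 hs2.
  have [h0|h0] := leP 0 h.
    have := @v_taylor (s + s) l s (s + h) s (ltW s0).
    have -> : s + h - s = h by ring.
    by apply; [lra|lra|left].
  have := @v_taylor (s + s) l (s + h) s s.
  have -> : s - (s + h) = - h by ring.
  rewrite sqrrN => ht; rewrite -normrN.
  have -> : - (v (s + h) l - v s l - h * gen p q (v s) l) =
    v s l - v (s + h) l - - h * gen p q (v s) l by ring.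
  by apply: ht; [lra|lra|lra|right].
- move=> s l s0; rewrite -oppr_le0.
  have h := @cesaroZ _ (-1) _ _ (@v_lim s l s0); rewrite mulN1r in h.
  by apply: (cesaro_le (N := 0) h) => M _; rewrite mulN1r oppr_le0 trunc_sol_ge0.
- move=> T; exists (expR (gam * T)) => s l /andP[s0 sT].
  apply: (cesaro_le (N := 0) (@v_lim s l s0)) => M _.
  exact: le_trans (ler_norm _) (trunc_sol_norm _ _ s0 sT).
Qed.

End limit_solution.

(** * The law of the configuration *)

Section probability_toolbox.
Context {R : realType} {d : measure_display} {Omega : measurableType d}
  (P : probability Omega R).

Definition pr (A : set Omega) : R := fine (P A).

Lemma prK A : measurable A -> (pr A)%:E = P A.
Proof. by move=> mA; rewrite fineK// fin_num_measure. Qed.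

Lemma pr_ge0 A : 0 <= pr A.
Proof. exact: fine_ge0. Qed.

Lemma pr_le A B : measurable A -> measurable B -> A `<=` B -> pr A <= pr B.
Proof. by move=> mA mB AB; rewrite -lee_fin !prK// le_measure// inE. Qed.

Lemma prDI A B : measurable A -> measurable B -> pr A = pr (A `\` B) + pr (A `&` B).
Proof.
move=> mA mB; apply: EFin_inj; rewrite EFinD !prK//; [exact: measureDI|exact: measurableI|exact: measurableD].
Qed.

Section null_set.
Variable N : set Omega.
Hypotheses (mN : measurable N) (N0 : P N = 0%E).

Lemma pr_null A : measurable A -> pr (A `\` N) = pr A.
Proof.
move=> mA; rewrite [RHS](prDI mA mN) -[LHS]addr0; congr (_ + _).
apply/esym/eqP; rewrite eq_le pr_ge0 andbT.
have -> : 0 = pr N by rewrite /pr N0.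
by apply: pr_le => //; exact: measurableI.
Qed.

Lemma pr_le_null A B : measurable A -> measurable B -> A `\` N `<=` B -> pr A <= pr B.
Proof. by move=> mA mB AB; rewrite -pr_null//; apply: pr_le => //; exact: measurableD. Qed.

(** Additivity for events that are disjoint and contained in [Z] only off the null set [N]. *)
Lemma sum_pr_le {I : eqType} (r : seq I) (F : I -> set Omega) (Z : set Omega) :
  uniq r -> (forall i, i \in r -> measurable (F i)) -> measurable Z ->
  (forall i, i \in r -> F i `\` N `<=` Z) ->
  (forall i j w, i \in r -> j \in r -> ~ N w -> F i w -> F j w -> i = j) ->
  \sum_(i <- r) pr (F i) <= pr Z.
Proof.
elim: r Z => [|i r IH] Z; first by rewrite big_nil pr_ge0.
move=> /= /andP[ni ur] mF mZ sF dF; rewrite big_cons.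
have mFi : measurable (F i) by apply: mF; exact: mem_head.
rewrite (prDI mZ mFi) addrC; apply: lerD.
  apply: IH => //.
  - by move=> j jr; apply: mF; rewrite inE jr orbT.
  - exact: measurableD.
  - move=> j jr w [Fj Nw]; split; first by apply: (sF j) => //; rewrite inE jr orbT.
    move=> Fiw; move: ni; rewrite (dF i j w)// ?mem_head// ?inE ?jr ?orbT//.
  - by move=> j k w jr kr; apply: dF; rewrite inE ?jr ?kr orbT.
apply: pr_le_null => //; first exact: measurableI.
by move=> w [Fiw Nw]; split => //; apply: (sF i) => //; exact: mem_head.
Qed.

End null_set.

Lemma pr_cover_le {I : eqType} (r : seq I) (F : I -> set Omega) :
  (forall i, i \in r -> measurable (F i)) ->
  measurable [set w | exists2 i, i \in r & F i w] /\
  pr [set w | exists2 i, i \in r & F i w] <= \sum_(i <- r) pr (F i).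
Proof.
elim: r => [|i r IH] mF.
  have -> : [set w | exists2 i, i \in [::] & F i w] = set0.
    by apply/seteqP; split => // w [].
  by rewrite big_nil /pr measure0.
have [mr lr] := IH (fun j jr => mF j (mem_behead (s := i :: r) jr)).
have mFi : measurable (F i) by apply: mF; exact: mem_head.
have -> : [set w | exists2 j, j \in i :: r & F j w] = F i `|` [set w | exists2 j, j \in r & F j w].
  apply/seteqP; split => w.
    by move=> [j]; rewrite inE => /predU1P[->|jr] Fj; [left|right; exists j].
  by move=> [Fi|[j jr Fj]]; [exists i => //; exact: mem_head|exists j => //; rewrite inE jr orbT].
split; first exact: measurableU.
rewrite big_cons; apply: le_trans (lerD (lexx _) lr).
rewrite -lee_fin EFinD !prK//; last exact: measurableU.
exact: measureU2.
Qed.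

End probability_toolbox.

Section words_upto.
Context {R : realType} (p q : R).
Hypothesis pq1 : p + q = 1.

Fixpoint words_upto (M N : nat) : seq (seq letter) :=
  if N is N'.+1 then words_upto M N' ++ words M N' else [::].

Lemma mem_words_upto M N rw : rw \in words_upto M N ->
  (size rw < N)%N && all (fun x => x.1 < M)%N rw.
Proof.
elim: N => [//|N IH] /=; rewrite mem_cat => /orP[/IH/andP[h ->]|/mem_words/andP[/eqP -> ->]].
  by rewrite andbT ltnW.
by rewrite ltnSn.
Qed.

Lemma words_upto_uniq M N : uniq (words_upto M N).
Proof.
elim: N => [//|N IH] /=; rewrite cat_uniq IH words_uniq andbT /=.
apply/hasPn => rw /mem_words/andP[/eqP e _]; apply/negP => /mem_words_upto.
by rewrite e ltnn.
Qed.

Lemma sum_words_upto M N (C : pred (seq letter)) (s : R) :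
  \sum_(rw <- words_upto M N | C rw) word_weight p rw * (s ^+ size rw / (size rw)`!%:R) =
  \sum_(0 <= n < N) (\sum_(rw <- words M n | C rw) word_weight p rw) / n`!%:R * s ^+ n.
Proof.
elim: N => [|N IH] /=; first by rewrite big_nil big_geq.
rewrite big_cat IH big_nat_recr//=; congr (_ + _).
rewrite -mulrA [in RHS]mulrC mulr_sumr big_seq_cond [RHS]big_seq_cond.
apply: eq_bigr => rw /andP[/mem_words/andP[/eqP -> _] _]; ring.
Qed.

Lemma sum_words_upto_cvg M (s : R) :
  \sum_(rw <- words_upto M N) word_weight p rw * (s ^+ size rw / (size rw)`!%:R) @[N --> \oo]
    --> expR (M%:R * s).
Proof.
have -> : (fun N => \sum_(rw <- words_upto M N) word_weight p rw * (s ^+ size rw / (size rw)`!%:R)) =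
    series (exp_coeff (M%:R * s)).
  apply/funext => N; rewrite sum_words_upto /series/=; apply: eq_bigr => n _.
  by rewrite (sum_words_weight pq1) /exp_coeff/= exprMn mulrAC.
exact: is_cvg_series_exp_coeff.
Qed.

End words_upto.

Section process.
Context {R : realType} {d : measure_display} {Omega : measurableType d}
  (P : probability Omega R) (p q : R)
  (W : nat -> nat -> {RV P >-> R}) (D : nat -> nat -> {RV P >-> bool})
  (X : nat -> R -> Omega -> int).
Hypotheses (p0 : 0 <= p) (q0 : 0 <= q) (pq1 : p + q = 1).
Hypothesis mX : forall m t y, (0 < m)%N -> 0 <= t -> measurable [set omega | X m t omega = y].
Hypothesis clocks : asep_clocks p W D.
Hypothesis traj : {ae P, forall omega, asep_step_trajectory
  (fun m k => W m k omega) (fun m k => D m k omega) (fun m t => X m t omega)}.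

Definition frozen (s : R) (M : nat) : set Omega := [set omega | s < W M.+1 0%N omega].

Definition state (s : R) (mu : part) : set Omega :=
  [set omega | forall i, X i.+1 s omega = i.+1%:Z - (mu i)%:Z].

Lemma frozen_measurable s M : measurable (frozen s M).
Proof.
have -> : frozen s M = setT `&` W M.+1 0%N @^-1` `]s, +oo[.
  by rewrite setTI; apply/seteqP; split => w; rewrite /= in_itv/= andbT.
exact: measurable_funPT.
Qed.

Lemma state_measurable s mu : 0 <= s -> measurable (state s mu).
Proof.
move=> s0; have -> : state s mu = \bigcap_i [set omega | X i.+1 s omega = i.+1%:Z - (mu i)%:Z].
  by apply/seteqP; split => w h i //=; exact: h.
by apply: bigcapT_measurable => i; exact: mX.
Qed.

Lemma frozen_prob s M : 0 <= s -> pr P (frozen s M) = expR (- s).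
Proof.
move=> s0; apply: EFin_inj; rewrite prK; last exact: frozen_measurable.
have nuE (B : set R) : measurable B ->
    distribution P (W M.+1 0%N) B = exponential_prob 1 B.
  by case: clocks => h _ _ mB; exact: h.
rewrite -(integral_exponential_gt nuE s0).
rewrite (eq_integral (fun x => (\1_(`]s, +oo[) x)%:E)); last first.
  by move=> x _; rewrite indicE mem_setE in_itv/= andbT.
rewrite integral_indic ?setIT//; rewrite /distribution /pushforward.
by congr (P _); apply/seteqP; split => w; rewrite /= in_itv/= andbT.
Qed.

Lemma frozen_prob2 s n m : 0 <= s -> n != m ->
  pr P (frozen s n `&` frozen s m) = expR (- s) ^+ 2.
Proof.
move=> s0 nm; case: clocks => _ _ indep.
pose A (i : (nat * nat) + (nat * nat)) : set Omega :=
  if i is inl mk then frozen s mk.1.-1 else setT.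
have h := indep [:: inl (n.+1, 0%N); inl (m.+1, 0%N)] A.
have u : uniq [:: inl (n.+1, 0%N) : (nat * nat) + (nat * nat); inl (m.+1, 0%N)].
  rewrite /= inE andbT; apply: contra nm => /eqP [->]; exact: eqxx.
have mF k : generated (W k.+1 0%N) (frozen s k).
  exists `]s, +oo[%classic => //; rewrite setTI.
  by apply/seteqP; split => w; rewrite /= in_itv/= andbT.
have {}h := h u; apply: EFin_inj; rewrite prK; last first.
  by apply: measurableI; exact: frozen_measurable.
transitivity (P (\bigcap_(i in [set` [:: inl (n.+1, 0%N) : (nat * nat) + (nat * nat); inl (m.+1, 0%N)]]) A i)).
  congr (P _); apply/seteqP; split => w.
    by move=> [h1 h2] i /=; rewrite !inE => /orP[]/eqP ->.
  move=> hw; split; first by apply: (hw (inl (n.+1, 0%N))); rewrite /= inE eqxx.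
  by apply: (hw (inl (m.+1, 0%N))); rewrite /= !inE eqxx orbT.
rewrite h; last by move=> i; rewrite !inE => /orP[]/eqP ->; split => //; exact: mF.
rewrite !big_cons big_nil mule1 /A /= -!prK; [|exact: frozen_measurable..].
by rewrite !frozen_prob// expr2 EFinM.
Qed.

Lemma frozen_mixing s (E : set Omega) : 0 <= s -> measurable E ->
  cesaro_to (fun M => pr P (E `&` frozen s M)) (expR (- s) * pr P E).
Proof.
move=> s0 mE; apply: mixing => //.
- by move=> n; exact: frozen_measurable.
- by move=> n; exact: frozen_prob.
- by move=> n m; exact: frozen_prob2.
Qed.

Lemma cesaro0 (x : nat -> R) : (forall n, x n = 0) -> cesaro_to x 0.
Proof.
move=> h N; under eq_fun => K.
  rewrite big1; first by rewrite mul0r; over.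
  by move=> i _; exact: h.
exact: cvg_cst.
Qed.

(** If every intersection is null, so is the averaged limit, which by mixing is [expR (- s)] times
    the probability of [E]. *)
Lemma never_frozen (E : set Omega) s : 0 <= s -> measurable E ->
  (forall M, pr P (E `&` frozen s M) = 0) -> P E = 0%E.
Proof.
move=> s0 mE h; rewrite -prK//; congr (_%:E).
have := cesaro_unique (frozen_mixing s0 mE) (cesaro0 h).
by move=> /eqP; rewrite mulf_eq0 gt_eqF ?expR_gt0//= => /eqP.
Qed.

Definition good (s : R) (omega : Omega) : Prop :=
  [/\ asep_step_trajectory (fun m k => W m k omega) (fun m k => D m k omega)
        (fun m t => X m t omega),
      forall m k, 0 <= W m.+1 k omega
    & forall N, exists2 j, (N <= j)%N & s < W j.+1 0%N omega].

Lemma good_ae s : 0 <= s -> {ae P, forall omega, good s omega}.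
Proof.
move=> s0.
have wait_ge0 : {ae P, forall omega, forall m k, 0 <= W m.+1 k omega}.
  apply: ae_foralln => m; apply: ae_foralln => k.
  exists (setT `&` W m.+1 k @^-1` [set x | x < 0]); split.
  - apply: measurable_funPT => //.
    have -> : [set x : R | x < 0] = `]-oo, 0[%classic by apply/seteqP; split => x; rewrite /= in_itv.
    exact: measurable_itv.
  - rewrite setTI; apply: (@exponential_lt0 _ (distribution P (W m.+1 k))) => B mB.
    by case: clocks => h _ _; exact: h.
  - by move=> w /negP; rewrite -ltNge.
have infinitely_frozen : {ae P, forall omega, forall N, exists2 j, (N <= j)%N & s < W j.+1 0%N omega}.
  apply: ae_foralln => N.
  (* On [E] no particle from index [N] on is frozen, so the intersections with late frozen events
     are empty and mixing forces [E] to be null. *)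
  pose E := \bigcap_j ~` (frozen s (N + j)).
  have mE : measurable E.
    by apply: bigcapT_measurable => j; apply: measurableC; exact: frozen_measurable.
  exists E; split => //.
    transitivity ((pr P E)%:E); first by rewrite prK.
    congr (_%:E); apply/eqP.
    have h := frozen_mixing s0 mE.
    have l0 : expR (- s) * pr P E <= 0.
      apply: (cesaro_le (N := N) h) => n Nn.
      rewrite (_ : E `&` _ = set0) ?/pr ?measure0//.
      apply/seteqP; split => // w [hE]; have := hE (n - N)%N Logic.I.
      by rewrite /= subnKC.
    by rewrite eq_le pr_ge0 andbT -(pmulr_rle0 _ (expR_gt0 (- s))).
  move=> w /= h j _; apply: contra_notP h => /contrapT h.
  by exists (N + j)%N => //; exact: leq_addr.
apply: filterS3 traj wait_ge0 infinitely_frozen => w *; split => //.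
Qed.

Section fixed_time.
Variable s : R.
Hypothesis s0 : 0 <= s.

(** The event controls the clocks of particles [1] to [M+1] while the letters only name the first
    [M], so particle [M+1] has not rung. *)
Lemma word_state M rw omega : good s omega -> all (fun x => x.1 < M)%N rw ->
  word_event W D M.+1 s rw omega -> state s (run rw) omega /\ frozen s M omega.
Proof.
move=> [tr w0 fz] aM [fw nw nxt]; split.
  exact: (run_trajectory_all tr w0 fw aM nw nxt fz).
have := nxt M (ltnSn M); have -> : occ M rw = 0%N.
  apply/eqP; rewrite -leqn0 leqNgt -has_count; apply/hasPn => x xr.
  by rewrite (ltn_eqF (allP aM x xr)).
by rewrite /ticks big_ord1.
Qed.

Lemma word_event_inj M rw1 rw2 omega : good s omega ->
  all (fun x => x.1 < M)%N rw1 -> all (fun x => x.1 < M)%N rw2 ->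
  word_event W D M.+1 s rw1 omega -> word_event W D M.+1 s rw2 omega -> rw1 = rw2.
Proof.
move=> [_ w0 _] a1 a2 [f1 n1 x1] [f2 n2 x2]; apply: (follows_inj f1 f2) => j.
have occ0 rw : all (fun x => x.1 < M)%N rw -> (M <= j)%N -> occ j rw = 0%N.
  move=> aM Mj; apply/eqP; rewrite -leqn0 leqNgt -has_count; apply/hasPn => x xr.
  by rewrite (ltn_eqF (leq_trans (allP aM x xr) Mj)).
have [Mj|jM] := leqP M j; first by rewrite !occ0.
have mono n n' : (n <= n')%N -> ticks (waits W omega) j n <= ticks (waits W omega) j n'.
  move=> /subnK <-; elim: (n' - n)%N => [//|k IH].
  by rewrite addSn ticksS; apply: le_trans IH _; rewrite lerDl; exact: w0.
have le rw rw' : follows (waits W omega) (dirs D omega) rw -> now (waits W omega) rw <= s ->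
    (forall j, (j < M.+1)%N -> s < ticks (waits W omega) j (occ j rw').+1) ->
    (occ j rw <= occ j rw')%N.
  move=> f n x; rewrite leqNgt; apply/negP => lt.
  have := le_lt_trans (le_trans (follows_clk_le j f) n) (x j (ltnW jM)).
  by rewrite ltNge mono.
by apply/eqP; rewrite eqn_leq (le _ _ f1 n1 x2) (le _ _ f2 n2 x1).
Qed.

Lemma good_null : exists N : set Omega,
  [/\ measurable N, P N = 0%E & forall omega, ~ N omega -> good s omega].
Proof.
have [N [mN N0 h]] := good_ae s0; exists N; split => // w nN.
by apply: contrapT => ng; apply: nN; exact: h.
Qed.

Let term (rw : seq letter) : R :=
  word_weight p rw * (s ^+ size rw / (size rw)`!%:R).

Lemma word_sum_le M N (C : pred (seq letter)) (Z : set Omega) : measurable Z ->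
  (forall rw omega, good s omega -> all (fun x => x.1 < M)%N rw -> C rw ->
    word_event W D M.+1 s rw omega -> Z omega) ->
  expR (- s) ^+ M.+1 * \sum_(rw <- words_upto M N | C rw) term rw <= pr P Z.
Proof.
move=> mZ hZ; have [N0 [mN0 N00 hgood]] := good_null.
have p01 : 0 <= p <= 1 by rewrite p0 -pq1 lerDl.
have -> : expR (- s) ^+ M.+1 * \sum_(rw <- words_upto M N | C rw) term rw =
    \sum_(rw <- [seq rw <- words_upto M N | C rw]) pr P (word_event W D M.+1 s rw).
  rewrite big_filter mulr_sumr big_seq_cond [RHS]big_seq_cond.
  apply: eq_bigr => rw /andP[/mem_words_upto/andP[_ aM] _].
  rewrite /pr (word_event_prob p01 clocks s0)//; last first.
    by apply: sub_all aM => x; exact: leq_trans.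
  by rewrite /= mulrC.
have hall rw : rw \in [seq rw <- words_upto M N | C rw] -> C rw /\ all (fun x => x.1 < M)%N rw.
  by rewrite mem_filter => /andP[-> /mem_words_upto/andP[_ ->]].
apply: (sum_pr_le mN0 N00) => //.
- by rewrite filter_uniq// words_upto_uniq.
- by move=> rw _; exact: word_event_measurable.
- by move=> rw /hall[Crw aM] w [Gw Nw]; apply: hZ Gw => //; exact: hgood.
- move=> rw1 rw2 w /hall[_ a1] /hall[_ a2] Nw; exact: word_event_inj (hgood w Nw) a1 a2.
Qed.

Let expS M : expR (- s) ^+ M.+1 = expR (- (M.+1%:R * s)).
Proof. by rewrite -expRM_natl mulrN. Qed.

Let total_cvg M : expR (- s) ^+ M.+1 * \sum_(rw <- words_upto M N) term rw @[N --> \oo]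
  --> expR (- s).
Proof.
have e : expR (- s) ^+ M.+1 * expR (M%:R * s) = expR (- s).
  by rewrite expS -expRD; congr expR; rewrite -[M.+1]addn1 natrD; ring.
have h : expR (- s) ^+ M.+1 * \sum_(rw <- words_upto M N) term rw @[N --> \oo]
    --> expR (- s) ^+ M.+1 * expR (M%:R * s).
  by apply: cvgMl_tmp; exact: (@sum_words_upto_cvg _ _ _ pq1 M s).
by rewrite e in h.
Qed.

(* The word events already have total probability [expR (- s)], that of [frozen s M]. *)
Lemma frozen_cover M (Z : set Omega) : measurable Z ->
  (forall rw omega, good s omega -> all (fun x => x.1 < M)%N rw ->
    word_event W D M.+1 s rw omega -> Z omega) -> expR (- s) <= pr P Z.
Proof.
move=> mZ hZ.
have h := @total_cvg M.
rewrite -(cvg_lim (@Rhausdorff R) h); apply: limr_le; first by apply/cvg_ex; eexists; exact: h.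
near=> N; apply: (@word_sum_le M N xpredT Z mZ) => rw w g a _; exact: hZ.
Unshelve. all: by end_near. Qed.

(** Words leading to [mu] bound this probability from below, and the other words bound that of the
    rest of [frozen s M]. The two bounds add up to the probability of [frozen s M], so both are
    equalities. *)
Lemma state_frozen_prob M mu :
  pr P (state s mu `&` frozen s M) = expR (- s) * expR (- ((q - p) * s)) * trunc_sol p q M s mu.
Proof.
set F := egf (fun n => word_mass p M n mu) s.
have -> : expR (- s) * expR (- ((q - p) * s)) * trunc_sol p q M s mu = expR (- s) ^+ M.+1 * F.
  rewrite expS /trunc_sol mulrA -!expRD; congr (expR _ * _).
  by rewrite -[M.+1]addn1 natrD; ring.
have mS := state_measurable mu s0; have mF := frozen_measurable s M.
have hlim : expR (- s) ^+ M.+1 * \sum_(rw <- words_upto M N | run rw == mu) term rw @[N --> \oo]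
    --> expR (- s) ^+ M.+1 * F.
  apply: cvgMl_tmp; under eq_fun do rewrite /term sum_words_upto.
  exact: (@egf_word_mass_cvg _ _ _ p0 q0 pq1 M s mu).
have hlim2 : expR (- s) ^+ M.+1 * \sum_(rw <- words_upto M N | run rw != mu) term rw @[N --> \oo]
    --> expR (- s) - expR (- s) ^+ M.+1 * F.
  rewrite (_ : (fun N => _) = (fun N => expR (- s) ^+ M.+1 * \sum_(rw <- words_upto M N) term rw -
      expR (- s) ^+ M.+1 * \sum_(rw <- words_upto M N | run rw == mu) term rw)).
    by apply: cvgB => //; exact: total_cvg.
  apply/funext => N.
  by rewrite [in RHS](bigID (fun rw => run rw == mu))/= mulrDr addrAC subrr add0r.
have le1 : expR (- s) ^+ M.+1 * F <= pr P (state s mu `&` frozen s M).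
  rewrite -(cvg_lim (@Rhausdorff R) hlim); apply: limr_le; first by apply/cvg_ex; eexists; exact: hlim.
  near=> N; apply: word_sum_le; first exact: measurableI.
  by move=> rw w g a /eqP <- G; exact: word_state g a G.
have le2 : expR (- s) - expR (- s) ^+ M.+1 * F <= pr P (frozen s M `\` state s mu).
  rewrite -(cvg_lim (@Rhausdorff R) hlim2); apply: limr_le; first by apply/cvg_ex; eexists; exact: hlim2.
  near=> N; apply: word_sum_le; first exact: measurableD.
  move=> rw w g a ne G; have [st fz] := word_state g a G; split => // st'.
  move/negP: ne; apply; apply/eqP; apply: part_inj => i.
  by have := st i; rewrite (st' i) => /addrI /oppr_inj [].
have := frozen_prob M s0; rewrite (prDI P mF mS) setIC.
move: le1 le2; move: (pr P (state s mu `&` _)) (pr P (_ `\` _)) => a b.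
lra.
Unshelve. all: by end_near. Qed.

Definition scaled_prob (mu : part) : R := expR ((q - p) * s) * pr P (state s mu).

(** Conditioning on different frozen particles gives different truncated laws; by [frozen_mixing]
    their average is the unconditioned one. *)
Lemma scaled_prob_cesaro mu : cesaro_to (fun M => trunc_sol p q M s mu) (scaled_prob mu).
Proof.
have mS := state_measurable mu s0.
have h := @cesaroZ _ (expR s * expR ((q - p) * s)) _ _ (frozen_mixing s0 mS).
have e1 : expR s * expR (- s) = 1 by rewrite -expRD subrr expR0.
have e2 : expR ((q - p) * s) * expR (- ((q - p) * s)) = 1 by rewrite -expRD subrr expR0.
have -> : scaled_prob mu = expR s * expR ((q - p) * s) * (expR (- s) * pr P (state s mu)).
  by rewrite mulrACA e1 mul1r.
apply: cesaro_eq h => M; rewrite state_frozen_prob.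
move: (expR s) (expR (- s)) (expR ((q - p) * s)) (expR (- (_ * _))) (trunc_sol _ _ _ _ _) e1 e2 => a b c e f e1 e2.
transitivity ((a * b) * (c * e) * f); first by ring.
by rewrite e1 e2 !mul1r.
Qed.

End fixed_time.

Lemma scaled_prob0 l : scaled_prob 0 l = (l == empty_part)%:R.
Proof.
have [N0 [mN0 N00 hgood]] := good_null (lexx 0).
have mS l' := state_measurable l' (lexx (0 : R)).
rewrite /scaled_prob mulr0 expR0 mul1r; apply/eqP; rewrite eq_le.
have st0 w l' : ~ N0 w -> state 0 l' w -> l' = empty_part.
  move=> /hgood [tr _ _] h; apply: part_inj => i.
  have := h i; rewrite (asep_step_initial tr (ltn0Sn i)) /=.
  by move=> /eqP; rewrite eq_sym subr_eq -[X in X == _]addr0 (inj_eq (addrI _)) eq_sym => /eqP [].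
have [->|ne] := eqVneq l empty_part; last first.
  rewrite pr_ge0 andbT; have -> : 0%:R = pr P set0 by rewrite /pr measure0.
  apply: (pr_le_null mN0 N00) => // w [h nN].
  by move: ne; rewrite (st0 w l) ?eqxx.
apply/andP; split.
  by rewrite -lee_fin prK// probability_le1.
have -> : 1%:R = pr P setT by rewrite /pr probability_setT.
apply: (pr_le_null mN0 N00) => // w [_ /hgood [tr _ _]] i.
by rewrite (asep_step_initial tr (ltn0Sn i)) subr0.
Qed.

Lemma scaled_prob_solution : p <= q -> backward_solution p q scaled_prob.
Proof.
move=> pq; apply: limit_backward_solution => //; first exact: scaled_prob0.
by move=> s l s0; exact: scaled_prob_cesaro.
Qed.

Lemma tail_measurable n (x : int) s : 0 <= s -> measurable [set omega | x < X n.+1 s omega].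
Proof.
move=> s0; have -> : [set omega | x < X n.+1 s omega] =
    \bigcup_j [set omega | X n.+1 s omega = x + j.+1%:Z].
  apply/seteqP; split => w /=.
    move=> h; exists (`|X n.+1 s w - x|%N.-1) => //=; lia.
  by move=> [j _ /= ->]; lia.
by apply: bigcupT_measurable => j; exact: mX.
Qed.

Section tail_probability.
Variables (n k : nat) (s : R).
Hypothesis s0 : 0 <= s.

Let A : set Omega := [set omega | (n%:Z - k%:Z) < X n.+1 s omega].

Let mA : measurable A. Proof. exact: tail_measurable. Qed.

Let boxes L : seq part := [seq l : part <- box L L | (l n <= k)%N].

Let mstate l := state_measurable l s0.

Let tail_sumE L : tail_sum scaled_prob n k L s =
  expR ((q - p) * s) * \sum_(l <- boxes L) pr P (state s l).
Proof. by rewrite /tail_sum /boxes big_filter mulr_sumr. Qed.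

Lemma tail_ge L : tail_sum scaled_prob n k L s <= expR ((q - p) * s) * pr P A.
Proof.
rewrite tail_sumE ler_wpM2l ?expR_ge0//.
apply: (sum_pr_le (measurable0 : measurable (set0 : set Omega)) (measure0 P)) => //.
- by rewrite filter_uniq// box_uniq.
- move=> l; rewrite mem_filter => /andP[lk _] w [h _].
  by rewrite /A /= (h n); lia.
- move=> l l' w _ _ _ h h'; apply: part_inj => i.
  by have := h i; rewrite (h' i) => /addrI /oppr_inj [].
Qed.

Let U L : set Omega := [set w | exists2 l, l \in box L L & state s l w].

Let mU L : measurable (U L).
Proof. by have [] := @pr_cover_le _ _ _ P _ (box L L) (state s) (fun l _ => mstate l). Qed.

(** Given any frozen particle the configuration is almost surely a partition, by [frozen_cover];
    [never_frozen] removes the conditioning. *)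
Let U_full : P (~` \bigcup_L U L) = 0%E.
Proof.
have mUU : measurable (\bigcup_L U L) by exact: bigcupT_measurable.
apply: (never_frozen s0); first exact: measurableC.
move=> M; have mF := frozen_measurable s M.
have cover : expR (- s) <= pr P (frozen s M `&` \bigcup_L U L).
  apply: (frozen_cover s0 (M := M)); first exact: measurableI.
  move=> rw w g a G; have [st fz] := word_state g a G; split => //.
  exists (len (run rw) + run rw 0%N)%N => //; exists (run rw) => //.
  by rewrite mem_box leq_addr leq_addl.
have := frozen_prob M s0; rewrite (prDI P mF mUU) => e.
have -> : ~` (\bigcup_L U L) `&` frozen s M = frozen s M `\` \bigcup_L U L.
  by rewrite setDE setIC.
by apply/eqP; rewrite eq_le pr_ge0 andbT; lra.
Qed.

(** Continuity from below along growing boxes: up to a null set, the event is the union of the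
    states with [l n <= k]. *)
Lemma tail_le eps : 0 < eps ->
  exists L, expR ((q - p) * s) * pr P A <= tail_sum scaled_prob n k L s + eps.
Proof.
move=> eps0; pose V L := [set w | exists2 l, l \in boxes L & state s l w].
have mV L : measurable (V L) /\ pr P (V L) <= \sum_(l <- boxes L) pr P (state s l).
  exact: (@pr_cover_le _ _ _ P _ (boxes L) (state s) (fun l _ => mstate l)).
have mVV : measurable (\bigcup_L V L) by apply: bigcupT_measurable => L; have [] := mV L.
have ndV : {homo V : a b / (a <= b)%N >-> (a <= b)%O}.
  move=> a b ab; apply/subsetPset => w [l]; rewrite mem_filter mem_box => /andP[lk /andP[l1 l2]] h.
  by exists l => //; rewrite mem_filter lk mem_box (leq_trans l1)//= (leq_trans l2).
have hA : pr P A <= pr P (\bigcup_L V L).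
  have mN : measurable (~` \bigcup_L U L) by apply: measurableC; exact: bigcupT_measurable.
  apply: (pr_le_null mN U_full) => // w [Aw /contrapT [L _ [l lL h]]].
  exists L => //; exists l => //; rewrite mem_filter lL andbT.
  by move: Aw; rewrite /A /= (h n); lia.
have cv : pr P (V L) @[L --> \oo] --> pr P (\bigcup_L V L).
  apply: fine_cvg; rewrite prK//.
  by apply: nondecreasing_cvg_mu => // L; have [] := mV L.
pose e := expR ((q - p) * s).
have e0 : 0 < e by exact: expR_gt0.
have /cvgrPdist_lt/(_ (eps / e)) := cv; rewrite divr_gt0// => /(_ isT) [L0 _ /(_ L0 (leqnn L0))].
rewrite /= ltr_norml => /andP[_ h]; exists L0; rewrite tail_sumE -/e.
have [_ h2] := mV L0.
have h3 : pr P A <= \sum_(l <- boxes L0) pr P (state s l) + eps / e by lra.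
have := ler_wpM2l (ltW e0) h3; rewrite mulrDr [e * (eps / e)]mulrC divfK ?gt_eqF//.
Qed.

End tail_probability.

Lemma tail_asymptotics (n k : nat) (eta : R) : 0 < p -> p < q -> 0 < eta ->
  \forall t \near +oo, let c := (n`! * k`!)%:R * (expR t *
      pr P [set omega | n%:Z - k%:Z < X n.+1 (t / (q - p)) omega]) in
    (euler_product (p / q) - eta) * t ^+ (n + k) <= c <=
    (euler_product (p / q) + eta) * t ^+ (n + k).
Proof.
move=> pp pq eta0; have g0 : 0 < q - p by rewrite subr_gt0.
have sol := scaled_prob_solution (ltW pq).
have h := tail_sum_asymptotics pp pq pq1 sol n k eta0.
have {}h : \forall t \near +oo, (exists L : nat,
      (euler_product (p / q) - eta) * ((q - p) * (t / (q - p))) ^+ (n + k) <=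
      (n`! * k`!)%:R * tail_sum scaled_prob n k L (t / (q - p))) /\
    (forall L : nat, (n`! * k`!)%:R * tail_sum scaled_prob n k L (t / (q - p)) <=
      (euler_product (p / q) + eta) * ((q - p) * (t / (q - p))) ^+ (n + k)).
  have [A [Ar hA]] := h; exists (A * (q - p)); split; first by rewrite realM// gtr0_real.
  by move=> t At; apply: hA; rewrite ltr_pdivlMr.
near=> t.
have t0 : 0 <= t by near: t; exact: nbhs_pinfty_ge.
have s0 : 0 <= t / (q - p) by rewrite divr_ge0// ltW.
have et : (q - p) * (t / (q - p)) = t by rewrite mulrC divfK// gt_eqF.
have [[L hL] hU] : (exists L : nat,
      (euler_product (p / q) - eta) * ((q - p) * (t / (q - p))) ^+ (n + k) <=
      (n`! * k`!)%:R * tail_sum scaled_prob n k L (t / (q - p))) /\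
    (forall L : nat, (n`! * k`!)%:R * tail_sum scaled_prob n k L (t / (q - p)) <=
      (euler_product (p / q) + eta) * ((q - p) * (t / (q - p))) ^+ (n + k)).
  by near: t.
rewrite !et in hL hU.
have c0 : 0 < (n`! * k`!)%:R :> R by rewrite ltr0n muln_gt0 !fact_gt0.
rewrite /=; apply/andP; split.
  apply: le_trans hL _; rewrite ler_pM2l//.
  by have := tail_ge n k s0 L; rewrite et.
apply/ler_addgt0Pr => e e0.
have [L' hL'] := tail_le n k s0 (divr_gt0 e0 c0).
rewrite et in hL'; have := ler_wpM2l (ltW c0) hL'.
rewrite mulrDr [_ * (e / _)]mulrC divfK ?gt_eqF// => h'.
by apply: le_trans h' _; rewrite lerD2r.
Unshelve. all: by end_near. Qed.

End process.

Theorem theorem1 (R : realType) (d : measure_display)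
    (Omega : measurableType d) (P : probability Omega R)
    (p q gamma tau : R) (X : nat -> R -> Omega -> int) (m : nat) (x : int)
    (hq : q = 1 - p) (hp0 : 0 < p) (hpq : p < q)
    (hgamma : gamma = q - p) (htau : tau = p / q)
    (hX : asep_step P p X)
    (hm : (0 < m)%N) (hx : x < m%:Z) :
  fine (P [set omega | x < X m (t / gamma) omega]) /
    (euler_product tau *
     (t ^ (2 * m%:Z - x - 2) * expR (- t) /
      ((m.-1)`! * (`|(m%:Z - x - 1)%R|%N)`!)%:R))
    @[t --> +oo] --> (1 : R).
Proof.
case: hX => mX [W [D [clocks traj]]].
have pq1 : p + q = 1 by rewrite hq addrC subrK.
have q0 : 0 < q by exact: lt_trans hpq.
have [n em] : exists n, m = n.+1 by exists m.-1; rewrite prednK.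
have [k ek] : exists k : nat, m%:Z - x - 1 = k%:Z.
  by exists `|(m%:Z - x - 1)%R|%N; clear -hx; lia.
have ex : x = n%:Z - k%:Z by clear -em ek; lia.
have eD : 2 * m%:Z - x - 2 = (n + k)%N%:Z by clear -em ek; lia.
have tau01 : 0 < tau < 1 by rewrite htau divr_gt0//= ltr_pdivrMr// mul1r.
have E0 : 0 < euler_product tau by case/andP: tau01 => *; exact: euler_gt0.
rewrite ek eD ex em /=; set E := euler_product tau in E0 *.
apply/cvgrPdist_le => eps eps0.
have h := tail_asymptotics (ltW hp0) (ltW q0) pq1 mX clocks traj n k hp0 hpq (mulr_gt0 eps0 E0).
near=> t.
have t0 : 0 < t by near: t; exact: nbhs_pinfty_gt.
have : (E - eps * E) * t ^+ (n + k) <= (n`! * k`!)%:R * (expR t *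
      pr P [set omega | n%:Z - k%:Z < X n.+1 (t / (q - p)) omega]) <=
    (E + eps * E) * t ^+ (n + k).
  by rewrite /E htau; near: t; move: h; rewrite /E htau.
rewrite -hgamma /pr; set Q := fine _; rewrite -exprnP.
set T := t ^+ _; set c := (_ * _)%:R.
have T0 : 0 < T by rewrite exprn_gt0.
have c0 : 0 < c by rewrite ltr0n muln_gt0 !fact_gt0.
move=> /andP[h1 h2].
have e0 := expR_gt0 t.
(* The error is rewritten relative to [E * T], which matches the tolerance [eps * E] used in
   [tail_asymptotics]. *)
have -> : 1 - Q / (E * (T * expR (- t) / c)) = (E * T - c * (expR t * Q)) / (E * T).
  by rewrite expRN; field; rewrite !gt_eqF.
have ET : 0 < E * T by rewrite mulr_gt0.
rewrite normrM normfV (gtr0_norm ET) ler_pdivrMr// ler_norml.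
apply/andP; split; nra.
Unshelve. all: by end_near. Qed.
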